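(* Let $K$ be a transverse knot in $(S^3,\xi_{st})$ that is transversely isotopic to the closure of a $3$-braid $\beta\in B_3$ whose fractional Dehn twist coefficient satisfies $\tau(\beta)>1$. Then $\psi(K)\neq 0$, where $\psi$ is computed in Khovanov homology with coefficients in $\mathbb{Q}$, in $\mathbb{Z}$, and in $\mathbb{Z}/2\mathbb{Z}$; moreover $\psi'(K)\neq 0$.
   Context: $B_n$ is the Artin braid group with standard generators $\sigma_1,\dots,\sigma_{n-1}$; $\Delta^2=(\sigma_1\cdots\sigma_{n-1})^n$ is the full twist. The closure $\hat\beta$ of a braid is naturally a transverse link in the standard contact $3$-sphere $(S^3,\xi_{st})$, $\xi_{st}=\ker(dz+r^2d\theta)$, and transverse links up to transverse isotopy correspond to braids up to braid relations, conjugation and positive (de)stabilization. Khovanov complex conventions: for an oriented link diagram $D$ with $n_+$ positive and $n_-$ negative crossings, a Kauffman state chooses a $0$- or $1$-resolution at each crossing; to a state with $r$ one-resolutions and circles $C_1,\dots,C_m$ one assigns $V^{\otimes m}$, $V$ free on $v_+,v_-$ with $p(v_\pm)=\pm1$; homological grading $i=r-n_-$, quantum grading $j=p+i+n_+-n_-$; differential given by the merge map $m(v_+\otimes v_+)=v_+$, $m(v_+\otimes v_-)=m(v_-\otimes v_+)=v_-$, $m(v_-\otimes v_-)=0$ and split map $\Delta(v_+)=v_+\otimes v_-+v_-\otimes v_+$, $\Delta(v_-)=v_-\otimes v_-$, with the usual signs. Plamenevskaya's transverse invariant $\psi(\hat\beta)$ is the homology class of $v_-\otimes\cdots\otimes v_-$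 in the oriented resolution of the closed braid diagram (the $0$-resolution at every positive crossing and the $1$-resolution at every negative crossing); it lies in $Kh^{0}_{\mathrm{sl}(\hat\beta)}$ with $\mathrm{sl}(\hat\beta)=-b+n_+-n_-$ ($b$ the strand number) and is, up to sign, an invariant of the transverse link. The reduced version $\psi'$ lives in reduced Khovanov homology over $\mathbb{Z}/2\mathbb{Z}$ (quotient of the complex of a diagram with a marked point by the subcomplex of generators labelling the marked circle by $v_-$, quantum grading shifted by $-1$): it is the class of the generator in the oriented resolution labelling the marked circle $v_+$ and all other circles $v_-$. Fractional Dehn twist coefficient: a braid is Dehornoy positive ($\beta>1$) if for some $i$ it has a word containing no $\sigma_j^{\pm1}$ with $j<i$ and only positive powers of $\sigma_i$; $\alpha<\beta$ iff $\alpha^{-1}\beta>1$ defines a total left order on $B_n$. For $\beta\in B_n$ let $\lfloor\beta\rfloor$ be the unique integer $m$ with $\Delta^{2m}\le\beta<\Delta^{2m+2}$; then $\tau(\beta)=\lim_{k\to\infty}\lfloor\beta^k\rfloor/k$. *)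

(* Defs.v *)
From HB Require Import structures.
From mathcomp Require Import all_boot all_order all_algebra.
From Stdlib Require Rdefinitions Raxioms Rseries BinInt Relation_Operators.
Set Implicit Arguments. Unset Strict Implicit. Unset Printing Implicit Defensive.
Import GRing.Theory.

(* Braid words.  A letter (i, true) is sigma_i, (i, false) is sigma_i^-1 *)
Definition letter := (nat * bool)%type.
Definition bword := seq letter.
Definition valid_letter (n : nat) (a : letter) := (0 < a.1) && (a.1 < n).
Definition valid_word (n : nat) (w : bword) := all (valid_letter n) w.
Definition inv_letter (a : letter) : letter := (a.1, ~~ a.2).
Definition inv_word (w : bword) : bword := rev (map inv_letter w).
Definition wpow (w : bword) (k : nat) : bword := flatten (nseq k w).

Inductive relator (n : nat) : bword -> bword -> Prop :=
| rel_cancel i b : 0 < i < n -> relator n [:: (i, b); (i, ~~ b)] [::]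
| rel_far i j b c : 0 < i < n -> 0 < j < n -> (i + 2 <= j)%N ->
    relator n [:: (i, b); (j, c)] [:: (j, c); (i, b)]
| rel_braid i : 0 < i -> i.+1 < n ->
    relator n [:: (i, true); (i.+1, true); (i, true)]
              [:: (i.+1, true); (i, true); (i.+1, true)].

Inductive braid_step (n : nat) : bword -> bword -> Prop :=
| bstep l r x y : relator n x y -> braid_step n (l ++ x ++ r) (l ++ y ++ r).

Definition braid_eq (n : nat) : bword -> bword -> Prop :=
  Relation_Operators.clos_refl_sym_trans bword (braid_step n).

Definition sigma_positive_word (i : nat) (v : bword) : bool :=
  [&& all (fun a : letter => i <= a.1) v, (i, true) \in v & (i, false) \notin v].
Definition dehornoy_pos (n : nat) (w : bword) : Prop :=
  exists v, braid_eq n w v /\ exists i, sigma_positive_word i v.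
Definition blt (n : nat) (a b : bword) : Prop := dehornoy_pos n (inv_word a ++ b).
Definition ble (n : nat) (a b : bword) : Prop := blt n a b \/ braid_eq n a b.

Definition sigma_prod (n : nat) : bword := [seq (i.+1, true) | i <- iota 0 n.-1].
Definition full_twist (n : nat) : bword := wpow (sigma_prod n) n.
Definition full_twist_pow (n : nat) (m : BinInt.Z) : bword :=
  if BinInt.Z.leb BinNums.Z0 m then wpow (full_twist n) (BinInt.Z.to_nat m)
  else wpow (inv_word (full_twist n)) (BinInt.Z.to_nat (BinInt.Z.opp m)).

Definition floor_spec (n : nat) (w : bword) (m : BinInt.Z) : Prop :=
  ble n (full_twist_pow n m) w /\ blt n w (full_twist_pow n (BinInt.Z.add m (BinNums.Zpos BinNums.xH))).

Definition fdtc_gt1 (n : nat) (w : bword) : Prop :=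
  exists (t : Rdefinitions.R) (f : nat -> BinInt.Z),
    (forall k, floor_spec n (wpow w k.+1) (f k)) /\
    Rseries.Un_cv (fun k => Rdefinitions.Rdiv (Rdefinitions.IZR (f k)) (Raxioms.INR k.+1)) t /\
    Rdefinitions.Rlt Rdefinitions.R1 t.

Definition swap_pos (i p : nat) : nat :=
  if p == i.-1 then i else if p == i then i.-1 else p.
Definition braid_perm (w : bword) (p : nat) : nat :=
  foldr (fun a q => swap_pos a.1 q) p w.
Definition is_knot_closure (n : nat) (w : bword) : Prop :=
  forall p, p < n -> exists k, iter k (braid_perm w) 0 = p.

(* Khovanov complex of the closed braid diagram of w on n strands.
   Crossing c (0 <= c < size w) lies between levels c and c+1; nodes are
   (level, strand position) with levels 0..size w; level size w is joined
   to level 0 by the closure arcs.  A Kauffman state s assigns to each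
   crossing its resolution (true = 1-resolution).  At a crossing the
   oriented (vertical) smoothing is the 0-resolution if the crossing is
   positive (sigma_i) and the 1-resolution if negative (sigma_i^-1); the
   other smoothing is the turnback (cup/cap) joining positions i-1,i. *)
Definition lett (w : bword) (c : nat) : letter := nth (0%N, true) w c.
Definition node (n : nat) (w : bword) := ('I_(size w).+1 * 'I_n)%type.
Definition kstate (w : bword) := {ffun 'I_(size w) -> bool}.

Definition adj (n : nat) (w : bword) (s : kstate w) (x y : node n w) : bool :=
  [|| [&& (x.1 == size w :> nat), (y.1 == 0 :> nat) & (x.2 == y.2)] |
      [exists c : 'I_(size w),
        let i := (lett w c).1 in
        let orient := s c != (lett w c).2 in
        [&& (x.1 == c :> nat), (y.1 == c.+1 :> nat), (x.2 == y.2) &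
            orient || ((x.2 != i.-1 :> nat) && (x.2 != i :> nat))]
        || [&& ~~ orient, x.1 == y.1, (x.1 == c :> nat) || (x.1 == c.+1 :> nat),
               (x.2 == i.-1 :> nat) & (y.2 == i :> nat)]]].
Definition sadj (n : nat) (w : bword) (s : kstate w) : rel (node n w) :=
  fun x y => adj s x y || adj s y x.
Definition same_circle (n : nat) (w : bword) (s : kstate w) (x y : node n w) : bool :=
  connect (@sadj n w s) x y.

(* enhanced states: a state and a +/- labelling (true = v_+) constant on circles *)
Definition consistent (n : nat) (w : bword) (p : kstate w * {ffun node n w -> bool}) : bool :=
  [forall x, forall y, same_circle p.1 x y ==> (p.2 x == p.2 y)].
Definition gen (n : nat) (w : bword) := {p : kstate w * {ffun node n w -> bool} | consistent p}.

Definition n_pos (w : bword) : nat := count (fun a : letter => a.2) w.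
Definition n_neg (w : bword) : nat := count (fun a : letter => ~~ a.2) w.
Definition nones (w : bword) (s : kstate w) : nat := #|[pred c | s c]|.
Definition is_circle_root (n : nat) (w : bword) (s : kstate w) (x : node n w) : bool :=
  fingraph.root (@sadj n w s) x == x.
Definition n_plus (n : nat) (w : bword) (g : gen n w) : nat :=
  #|[pred x | is_circle_root (val g).1 x && (val g).2 x]|.
Definition n_minus (n : nat) (w : bword) (g : gen n w) : nat :=
  #|[pred x | is_circle_root (val g).1 x && ~~ (val g).2 x]|.
Definition hdeg (n : nat) (w : bword) (g : gen n w) : int :=
  ((nones (val g).1)%:Z - (n_neg w)%:Z)%R.
Definition qdeg (n : nat) (w : bword) (g : gen n w) : int :=
  (((n_plus g)%:Z - (n_minus g)%:Z) + hdeg g + (n_pos w)%:Z - (n_neg w)%:Z)%R.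

Definition loc (n : nat) (w : bword) (c : 'I_(size w)) (v : node n w) : bool :=
  ((v.1 == c :> nat) || (v.1 == c.+1 :> nat)) &&
  ((v.2 == (lett w c).1.-1 :> nat) || (v.2 == (lett w c).1 :> nat)).
Definition touched (n : nat) (w : bword) (s : kstate w) (c : 'I_(size w)) (v : node n w) : bool :=
  [exists u, loc c u && same_circle s u v].
Definition ncirc_loc (n : nat) (w : bword) (s : kstate w) (c : 'I_(size w)) : nat :=
  #|[set fingraph.root (@sadj n w s) u | u in [pred u | loc c u]]|.
Definition nplus_loc (n : nat) (w : bword) (s : kstate w) (lab : {ffun node n w -> bool})
    (c : 'I_(size w)) : nat :=
  #|[set fingraph.root (@sadj n w s) u | u in [pred u | loc c u && lab u]]|.

(* Matrix coefficient (0 or 1) of the merge / split map along the edge of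
   the cube changing crossing c from 0 to 1:
   merge m(v+ v+) = v+, m(v+ v-) = m(v- v+) = v-, m(v- v-) = 0;
   split D(v+) = v+ v- + v- v+, D(v-) = v- v-;
   circles not through c keep their labels. *)
Definition local_coef (n : nat) (w : bword) (c : 'I_(size w)) (x y : gen n w) : bool :=
  let s := (val x).1 in let lab := (val x).2 in
  let s' := (val y).1 in let lab' := (val y).2 in
  [forall v, ~~ touched s c v ==> (lab v == lab' v)] &&
  (if (ncirc_loc n s c == 2) && (ncirc_loc n s' c == 1) then
     ((nplus_loc s lab c == 2) && (nplus_loc s' lab' c == 1)) ||
     ((nplus_loc s lab c == 1) && (nplus_loc s' lab' c == 0))
   else if (ncirc_loc n s c == 1) && (ncirc_loc n s' c == 2) then
     ((nplus_loc s lab c == 1) && (nplus_loc s' lab' c == 1)) ||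
     ((nplus_loc s lab c == 0) && (nplus_loc s' lab' c == 0))
   else false).

Definition cube_edge (w : bword) (s s' : kstate w) (c : 'I_(size w)) : bool :=
  [&& ~~ s c, s' c & [forall c', (c' != c) ==> (s c' == s' c')]].
Definition edge_sign (w : bword) (s : kstate w) (c : 'I_(size w)) : int :=
  ((-1) ^+ #|[pred c' : 'I_(size w) | (c' < c)%N && s c']|)%R.

Definition edge_coef (n : nat) (w : bword) (x y : gen n w) : int :=
  (\sum_(c : 'I_(size w) | cube_edge (val x).1 (val y).1 c)
     (edge_sign (val x).1 c * (local_coef c x y)%:R)%R)%R.

Definition chain (R : pzRingType) (n : nat) (w : bword) := {ffun gen n w -> R}.
Definition kh_d (R : pzRingType) (n : nat) (w : bword) (z : chain R n w) : chain R n w :=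
  [ffun y => (\sum_x z x * (edge_coef x y)%:~R)%R].

Definition oriented_state (w : bword) : kstate w := [ffun c : 'I_(size w) => ~~ (lett w c).2].

Definition psi_chain (R : pzRingType) (n : nat) (w : bword) : chain R n w :=
  [ffun y => if ((val y).1 == oriented_state w) && ((val y).2 == [ffun _ => false])
             then 1%R else 0%R].

(* psi(closure of w) <> 0 in Kh^0(closure; R): psi is not the boundary of a
   chain of homological degree -1. *)
Definition psi_nonzero (R : pzRingType) (n : nat) (w : bword) : Prop :=
  ~ exists z : chain R n w,
      (forall x : gen n w, z x != 0%R -> hdeg x = (-1)%R) /\ kh_d z = psi_chain R n w.

(* Reduced version over Z/2 with marked point mk: quotient of the complex
   by the subcomplex spanned by generators labelling the marked circle v_-.
   psi' labels the marked circle v_+ and every other circle v_-. *)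
Definition psi'_chain (n : nat) (w : bword) (mk : node n w) : chain 'F_2 n w :=
  [ffun y => if ((val y).1 == oriented_state w) &&
                ((val y).2 == [ffun v => same_circle (oriented_state w) mk v])
             then 1%R else 0%R].
Definition psi'_nonzero (n : nat) (w : bword) (mk : node n w) : Prop :=
  ~ exists z : chain 'F_2 n w,
      (forall x : gen n w, z x != 0%R -> hdeg x = (-1)%R) /\
      (forall y : gen n w, (val y).2 mk -> kh_d z y = psi'_chain mk y).

(* Main.v *)
(** Since [fdtc_gt1 3 w] makes the Dehornoy floor of [w] at least 1, [w] is braid
    equivalent to [Delta^2k v] with [k >= 1] and [v] either positive or containing
    sigma_1 but not its inverse; the bound on the floor comes from the action of
    [B_3] on the universal cover of the rational projective line.  If psi vanishes
    for a word, it vanishes for every braid equivalent word, after a cyclic rotation,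
    and after the deletion of a positive letter.  Writing [a], [b] for the generators,
    one is reduced to the empty word or, as [Delta^2] is central and [a Delta^2]
    contains [aabba] as a subword, to [aabba b^-n].  For the latter the [n] negative
    crossings are replaced by the complex [e -> ... -> e -> 1] with [n] copies of the
    turnback [e], and an explicit linear functional, supported on at most 18 states
    and independent of [n], vanishes on boundaries and takes the value 1 on psi.

    The complex of the closure is encoded by polynomials: the state space of a
    diagram is a polynomial ring in the nodes of the diagram modulo the relations
    [x = y] for nodes of the same circle and [x^2 = 0], with [v_+ = 1] and
    [v_- = x]; a saddle is then the multiplication by 1 (merge) or by [x + y]
    (split).  The reduced statement follows from the unreduced one by multiplication
    by the variable of the marked point. *)

From Stdlib Require Import BinInt Lia Lra Relation_Operators.
From Stdlib Require Rdefinitions Raxioms Rseries RIneq Rbasic_fun Rfunctions.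
Require Import Defs.
From HB Require Import structures.
From mathcomp Require Import all_boot all_order all_algebra all_fingroup.
From mathcomp Require Import ring zify.
From mathcomp.multinomials Require Import mpoly.
Set Implicit Arguments. Unset Strict Implicit. Unset Printing Implicit Defensive.
Import GRing.Theory.
Local Open Scope ring_scope.

(** * Orbits of a permutation composed with a transposition *)

(** On three strands every turnback involves the middle strand, so one rule orients all circles of
    all resolutions: they become the cycles of a permutation, a saddle becomes composition with a
    transposition, and the choice between merge and split is a count of cycles. Working with
    congruences modulo an ideal avoids choosing bases of the state spaces.

    No homotopy equivalence is needed. A move on words only requires a map of complexes, in the
    useful direction, which carries psi to psi. Its components are supported on a few adjacent
    letters and commute with the saddles elsewhere, so that finitely many local identities suffice.
    Since being a boundary is asked for all values of the node variables in all algebras, a solution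
    may be taken with indeterminates as values; the counit of a loop is then the extraction of a
    coefficient.

    One functional serves for every [n] because, in homological degree 0, the position in the twist
    complex equals the number of turnbacks among the five positive letters of [aabba]: at most five
    copies of [e] are ever seen. Letting several nodes share one variable makes the verification a
    finite computation with integers. *)

Section PermOrbits.
Variables (T : finType) (f : {perm T}) (a b : T).
Hypothesis ab : a != b.
Let f' := (tperm a b * f)%g.

Lemma porbit_trans (g : {perm T}) x y z :
  y \in porbit g x -> z \in porbit g y -> z \in porbit g x.
Proof. by rewrite -eq_porbit_mem => /eqP ->. Qed.

Lemma porbit_ind (g : {perm T}) (Q : T -> Prop) x :
  Q x -> (forall y, Q y -> Q (g y)) -> forall y, y \in porbit g x -> Q y.
Proof.
move=> Qx QS y /porbitP [k ->]; elim: k => [|k IH]; first by rewrite expg0 perm1.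
by rewrite expgSr permM; apply: QS.
Qed.

Lemma porbit_step (g : {perm T}) x : g x \in porbit g x.
Proof. by rewrite -{1}(expg1 g) mem_porbit. Qed.

(** An arrow of [f] is an arrow of [f'] preceded by the transposition, which only moves [a] and [b].
    As the transposition is an involution, the opposite inclusion follows by exchanging [f] and
    [f']. *)
Lemma porbit_tperm_cover x : (x \in porbit f a) || (x \in porbit f b) ->
  (x \in porbit f' a) || (x \in porbit f' b).
Proof.
pose Q x := (x \in porbit f' a) || (x \in porbit f' b).
have QS y : Q y -> Q (f y).
  have -> : f y = f' (tperm a b y) by rewrite permM tpermK.
  case: tpermP => [_|_|_ _] Qy; rewrite /Q ?porbit_step ?orbT //.
  by case/orP: Qy => H; rewrite (porbit_trans H (porbit_step _ _)) ?orbT.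
by case/orP => H; rewrite -/(Q x); move: x H; apply: porbit_ind => //;
  rewrite /Q porbit_id ?orbT.
Qed.

Lemma porbit_tperm_far x y : x \notin porbit f a -> x \notin porbit f b ->
  y \in porbit f x -> y \in porbit f' x.
Proof.
move=> xa xb; move: y.
suff: forall y, y \in porbit f x -> y \in porbit f x /\ y \in porbit f' x.
  by move=> H y /H [].
apply: porbit_ind => [|y [fy f'y]]; first by rewrite !porbit_id.
split; first exact: porbit_trans fy (porbit_step _ _).
have -> : f y = f' y; last exact: porbit_trans f'y (porbit_step _ _).
rewrite permM tpermD //; apply/eqP => E.
  by move: xa; rewrite porbit_sym E fy.
by move: xb; rewrite porbit_sym E fy.
Qed.

(** The number of cycles changes by one and returns to its value when the transposition is undone,
    so exactly one of the two steps is a split. *)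
Lemma porbit_tperm_flip : (b \in porbit f' a) = (b \notin porbit f a).
Proof.
have := porbits_mul_tperm f a b; have := porbits_mul_tperm f' a b.
rewrite /= ab /f' mulgA tperm2 mul1g -/f' !(porbit_sym _ b a).
by do 2 case: (_ \in _) => /=; lia.
Qed.

Lemma card_porbits_tperm :
  (#|porbits f'| + (b \notin porbit f a).*2 = #|porbits f|.+1)%N.
Proof.
by have := porbits_mul_tperm f a b; rewrite /= ab porbit_sym => ->; rewrite addn1.
Qed.

Lemma porbit_tperm_merge x y : b \notin porbit f a ->
  y \in porbit f x -> y \in porbit f' x.
Proof.
move=> nab xy; have ab' : b \in porbit f' a by rewrite porbit_tperm_flip.
have cov z : (z \in porbit f a) || (z \in porbit f b) -> z \in porbit f' a.
  by move/porbit_tperm_cover; case/orP => // /(porbit_trans ab').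
case: (boolP ((x \in porbit f a) || (x \in porbit f b))) => [xo|].
  have yo : (y \in porbit f a) || (y \in porbit f b).
    by case/orP: xo => /porbit_trans/(_ xy) ->; rewrite ?orbT.
  by apply: porbit_trans (cov _ yo); rewrite porbit_sym cov.
by rewrite negb_or => /andP [xa xb]; apply: porbit_tperm_far.
Qed.
End PermOrbits.

(** * State spaces and saddles *)

(* Circles are the cycles of [f]; the quotient by this ideal is the tensor power of
   [V] over the circles, with [v_+ = 1] and [v_- = xi x]. *)
Inductive cideal (P : comNzRingType) (T : finType) (xi : T -> P) (f : {perm T}) :
    P -> Prop :=
| cideal0 : cideal xi f 0
| cideal_step u x p : cideal xi f p -> cideal xi f (u * (xi x - xi (f x)) + p)
| cideal_sqr u x p : cideal xi f p -> cideal xi f (u * xi x ^+ 2 + p).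

Definition smul (P : comNzRingType) (T : finType) (xi : T -> P) (f : {perm T}) a b : P :=
  if b \in porbit f a then xi a + xi b else 1.

Section Ideal.
Variables (P : comNzRingType) (T : finType) (xi : T -> P).
Implicit Types (f : {perm T}) (p q u : P).

Lemma cidealD f p q : cideal xi f p -> cideal xi f q -> cideal xi f (p + q).
Proof.
move=> Ip Iq; elim: Ip => [|u x r _ IH|u x r _ IH]; first by rewrite add0r.
- by rewrite -addrA; apply: cideal_step.
- by rewrite -addrA; apply: cideal_sqr.
Qed.

Lemma cidealM f u p : cideal xi f p -> cideal xi f (u * p).
Proof.
elim=> [|v x r _ IH|v x r _ IH]; first by rewrite mulr0; apply: cideal0.
- by rewrite mulrDr mulrA; apply: cideal_step.
- by rewrite mulrDr mulrA; apply: cideal_sqr.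
Qed.

Lemma cidealN f p : cideal xi f p -> cideal xi f (- p).
Proof. by move=> Ip; rewrite -mulN1r; apply: cidealM. Qed.

Lemma cidealB f p q : cideal xi f p -> cideal xi f q -> cideal xi f (p - q).
Proof. by move=> Ip Iq; apply: cidealD => //; apply: cidealN. Qed.

Lemma cideal_sum f (J : Type) (r : seq J) (Q : pred J) (F : J -> P) :
  (forall j, Q j -> cideal xi f (F j)) -> cideal xi f (\sum_(j <- r | Q j) F j).
Proof. by move=> H; apply: big_ind => //; [exact: cideal0 | exact: cidealD]. Qed.

Lemma cideal_sqr1 f x : cideal xi f (xi x ^+ 2).
Proof. by rewrite -[_ ^+ 2]mul1r -[_ * _]addr0; apply: cideal_sqr (cideal0 _ _). Qed.

Lemma cideal_conn f x y : y \in porbit f x -> cideal xi f (xi x - xi y).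
Proof.
move: y; apply: porbit_ind => [|y Iy]; first by rewrite subrr; apply: cideal0.
have -> : xi x - xi (f y) = 1 * (xi y - xi (f y)) + (xi x - xi y) by ring.
exact: cideal_step.
Qed.

Lemma cideal_eqm f p q r : cideal xi f (p - q) -> cideal xi f (q - r) -> cideal xi f (p - r).
Proof. by move=> H1 H2; rewrite -(subrKA q); apply: cidealD. Qed.

Lemma cideal_sym f p q : cideal xi f (p - q) -> cideal xi f (q - p).
Proof. by move=> /cidealN; rewrite opprB. Qed.

(** Saddles are well defined on the quotients. Only the arrows out of [a] and [b] change: in a
    split, the factor [xi a + xi b] turns a lost relation into a new one plus a difference of
    squares; in a merge, every old relation persists. *)
Lemma cideal_smul f a b p : a != b -> cideal xi f p ->
  cideal xi (tperm a b * f)%g (smul xi f a b * p).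
Proof.
move=> ab; set f' := (_ * _)%g; rewrite /smul; case: ifPn => [fab|nfab] Ip.
  elim: Ip => [|u x r _ IH|u x r _ IH]; first by rewrite mulr0; apply: cideal0.
    have E : f x = f' (tperm a b x) by rewrite permM tpermK.
    rewrite mulrDr; apply: cidealD => //; rewrite E.
    have {E}sq y z : cideal xi f' (u * (xi y ^+ 2 - xi z ^+ 2)).
      by apply/cidealM/cidealB; apply: cideal_sqr1.
    have st y : cideal xi f' ((xi a + xi b) * u * (xi y - xi (f' y))).
      by apply/cidealM/cideal_conn/porbit_step.
    case: tpermP => [->|->|_ _].
    - rewrite [X in cideal _ _ X](_ : _ = u * (xi a ^+ 2 - xi b ^+ 2)
        + (xi a + xi b) * u * (xi b - xi (f' b))); first exact: cidealD.
      by ring.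
    - rewrite [X in cideal _ _ X](_ : _ = u * (xi b ^+ 2 - xi a ^+ 2)
        + (xi a + xi b) * u * (xi a - xi (f' a))); first exact: cidealD.
      by ring.
    - by rewrite mulrA.
  by rewrite mulrDr mulrA; apply: cideal_sqr.
rewrite mul1r; elim: Ip => [|u x r _ IH|u x r _ IH]; first exact: cideal0.
  apply: cidealD => //; apply/cidealM/cideal_conn.
  by apply: porbit_tperm_merge => //; apply: porbit_step.
exact: cideal_sqr.
Qed.

(** Of a saddle and its inverse exactly one is a split, and only that one contributes a factor. *)
Lemma smul_twice f a b : a != b ->
  smul xi f a b * smul xi (tperm a b * f)%g a b = xi a + xi b.
Proof.
by move=> ab; rewrite /smul porbit_tperm_flip //; case: ifP; rewrite ?mulr1 ?mul1r.
Qed.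

(** The final number of cycles does not depend on the order, so both orders contain equally many
    splits; counting discards all other combinations. Two of the remaining cases need a geometric
    argument. *)
Lemma smul_comm f a b c d : a != b -> c != d ->
  a != c -> a != d -> b != c -> b != d ->
  cideal xi (tperm c d * (tperm a b * f))%g
    (smul xi f a b * smul xi (tperm a b * f)%g c d
     - smul xi f c d * smul xi (tperm c d * f)%g a b).
Proof.
move=> ab cd ac ad bc bd.
set f1 := (tperm a b * f)%g; set f2 := (tperm c d * f)%g; set f3 := (tperm c d * f1)%g.
have E3 : f3 = (tperm a b * f2)%g.
  rewrite /f3 /f1 /f2 !mulgA; congr (_ * _)%g.
  by rewrite [RHS]conjgC tpermJ !tpermD // eq_sym.
have n1 := card_porbits_tperm f ab; have n2 := card_porbits_tperm f cd.
have n3 := card_porbits_tperm f1 cd; have n4 := card_porbits_tperm f2 ab.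
rewrite -/f1 -/f2 -/f3 -E3 in n1 n2 n3 n4.
rewrite /smul; move: n1 n2 n3 n4.
case: (boolP (b \in porbit f a)) => p; case: (boolP (d \in porbit f1 c)) => q;
case: (boolP (d \in porbit f c)) => p'; case: (boolP (b \in porbit f2 a)) => q' /=;
  move=> n1 n2 n3 n4; try lia; move=> {n1 n2 n3 n4};
  rewrite ?mulr1 ?mul1r ?subrr //; try exact: cideal0.
- by rewrite mulrC subrr; apply: cideal0.
(* Interlaced saddles on one circle: in the end a single circle passes through all four nodes. *)
- have ab3 : b \in porbit f3 a by rewrite E3 porbit_tperm_flip.
  have cd3 : d \in porbit f3 c by rewrite porbit_tperm_flip.
  have ca : (c \in porbit f a) || (c \in porbit f b).
    rewrite -[_ || _]negbK negb_or; apply/negP => /andP [H1 H2].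
    by move/negP: q; apply; apply: porbit_tperm_far p'.
  have ca3 : c \in porbit f3 a.
    case/orP: (porbit_tperm_cover ca) => H; have {}H := porbit_tperm_merge cd q H => //.
    exact: porbit_trans ab3 H.
  rewrite opprD addrACA; apply: cidealD; apply: cideal_conn => //.
  by apply: porbit_trans cd3; apply: porbit_trans ca3; rewrite porbit_sym.
(* Two saddles between the same two circles: in the end [a] and [b] lie on different circles, one
   with [c] and the other with [d]. *)
- have ab3 : b \notin porbit f3 a by rewrite E3 porbit_tperm_flip // negbK.
  have ab1 : b \in porbit f1 a by rewrite porbit_tperm_flip.
  have Ef : f = (tperm a b * f1)%g by rewrite mulgA tperm2 mul1g.
  have ca : (c \in porbit f1 a) || (c \in porbit f1 b).
    rewrite -[_ || _]negbK negb_or; apply/negP => /andP [H1 H2].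
    by move/negP: p'; apply; rewrite Ef; apply: porbit_tperm_far q.
  have {}ca : a \in porbit f1 c.
    case/orP: ca; rewrite porbit_sym // => H; apply: porbit_trans H _.
    by rewrite porbit_sym.
  have cb := porbit_trans ca ab1.
  have /orP Ha : (a \in porbit f3 c) || (a \in porbit f3 d).
    by apply: porbit_tperm_cover; rewrite ca.
  have /orP Hb : (b \in porbit f3 c) || (b \in porbit f3 d).
    by apply: porbit_tperm_cover; rewrite cb.
  have no z : a \in porbit f3 z -> b \in porbit f3 z -> False.
    rewrite porbit_sym => H1 H2; move/negP: ab3; apply; exact: porbit_trans H1 H2.
  case: Ha => Ha; case: Hb => Hb; try by case: (no _ Ha Hb).
    rewrite opprD addrACA.
    by apply: cidealD; apply: cideal_conn.
  rewrite [xi c + _]addrC opprD addrACA.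
  by apply: cidealD; apply: cideal_conn.
Qed.
End Ideal.

(* Levels are cyclic; [None] is the middle strand, [Some false] and [Some true] the
   left and right ones.  A diagram has at each level the identity ([None]) or the
   turnback between the middle strand and the strand [Some i]. *)
Definition cnode (M : nat) := ('I_M * option bool)%type.
Definition diag (M : nat) := {ffun 'I_M -> option bool}.

Section Diagram.
Variable M : nat.
Implicit Types (U : diag M) (c : 'I_M) (i : bool) (x y : cnode M).

(* Outer strands are followed upwards and the middle one downwards: since turnbacks
   join the middle strand to an outer one, this orients all circles. *)
Definition nxt U x : cnode M :=
  match x with
  | (c, Some i) => if U c == Some i then (c, None) else (ordS c, Some i)
  | (c, None) => if U (ord_pred c) is Some i then (c, Some i) else (ord_pred c, None)
  end.

Definition prv U x : cnode M :=
  match x with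
  | (c, Some i) =>
      if U (ord_pred c) == Some i then (c, None) else (ord_pred c, Some i)
  | (c, None) => if U c is Some i then (c, Some i) else (ordS c, None)
  end.

Lemma nxtK U : cancel (nxt U) (prv U).
Proof.
case=> c [i|] /=; first by case: eqP => [E|/eqP/negPf nE] /=; rewrite ?E // ordSK nE.
by case E: (U (ord_pred c)) => [i|] /=; rewrite E ?eqxx // ord_predK.
Qed.

Definition dperm U : {perm cnode M} := perm (can_inj (nxtK U)).

Lemma dpermE U x : dperm U x = nxt U x. Proof. exact: permE. Qed.

Definition conn U x y := y \in porbit (dperm U) x.

Lemma conn_refl U x : conn U x x. Proof. exact: porbit_id. Qed.
Lemma conn_sym U x y : conn U x y = conn U y x. Proof. exact: porbit_sym. Qed.
Lemma conn_trans U x y z : conn U x y -> conn U y z -> conn U x z.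
Proof. exact: porbit_trans. Qed.

Lemma conn_nxt U x y : conn U (nxt U x) y -> conn U x y.
Proof. by apply: conn_trans; rewrite /conn -dpermE porbit_step. Qed.

(* The three arcs contributed by the letter at level [c], as instances of [R]. *)
Definition link U (R : cnode M -> cnode M -> Prop) c : Prop :=
  match U c with
  | None => [/\ R (c, Some false) (ordS c, Some false),
                R (c, Some true) (ordS c, Some true) & R (ordS c, None) (c, None)]
  | Some i => [/\ R (c, Some i) (c, None), R (ordS c, None) (ordS c, Some i)
                & R (c, Some (~~ i)) (ordS c, Some (~~ i))]
  end.

(** Passes from nodes to letters: a local change of a diagram is checked at the changed letters
    only. *)
Lemma link_nxt U R : (forall c, link U R c) -> forall x, R x (nxt U x).
Proof.
move=> H [c [i|]] /=.
  move: (H c); rewrite /link; case: (U c) => [k|] [H1 H2 H3].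
    by case: i; case: k H1 H2 H3.
  by case: i.
move: (H (ord_pred c)); rewrite /link ord_predK.
by case: (U _) => [k|] [].
Qed.

Lemma nxt_link U (R : cnode M -> cnode M -> Prop) :
  (forall x, R x (nxt U x)) -> forall c, link U R c.
Proof.
move=> H c; have H1 := H (c, Some false); have H2 := H (c, Some true).
have := H (ordS c, None); move: H1 H2; rewrite /link /= ordSK.
by case: (U c) => [[]|] /=; split.
Qed.

Lemma link_conn U c : link U (conn U) c.
Proof. by apply: nxt_link => x; apply: conn_nxt; apply: conn_refl. Qed.

Definition upd (A : Type) (U : {ffun 'I_M -> A}) c (v : A) : {ffun 'I_M -> A} :=
  [ffun k => if k == c then v else U k].

Definition togglable U c i := (U c == None) || (U c == Some i).
Definition tog U c i : diag M := upd U c (if U c == Some i then None else Some i).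

(** The two nodes are the sources of the two oriented arcs which the saddle reconnects: it exchanges
    their targets. *)
Lemma dperm_tog U c i : togglable U c i ->
  dperm (tog U c i) = (tperm (c, Some i) (ordS c, None) * dperm U)%g.
Proof.
move=> H; apply/permP => x; rewrite permM dpermE.
case: (tpermP (c, Some i) (ordS c, None) x) => [->|->|]; rewrite dpermE /=.
- by rewrite ordSK !ffunE eqxx; case/orP: H => /eqP -> //=; rewrite !eqxx.
- by rewrite ordSK !ffunE eqxx; case/orP: H => /eqP -> //=; rewrite !eqxx.
case: x => k [j|] /=; rewrite !ffunE.
  case: (eqVneq k c) => // ->; case: (eqVneq j i) => [-> //|ji _ _].
  have nji : (Some j == Some i) = false by apply/eqP => -[] E; rewrite E eqxx in ji.
  by case/orP: H => /eqP ->; rewrite ?eqxx //= (eq_sym (Some i)) nji.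
by case: (eqVneq (ord_pred k) c) => // <- _; rewrite ord_predK.
Qed.

Lemma side_neq_mid (c c' : 'I_M) i : (c, Some i) != (c', None) :> cnode M.
Proof. by rewrite xpair_eqE andbF. Qed.
Hint Resolve side_neq_mid : core.

Section Saddle.
Variables (P : comNzRingType) (xi : cnode M -> P).

Definition cid U : P -> Prop := cideal xi (dperm U).
Definition mu U c i : P := smul xi (dperm U) (c, Some i) (ordS c, None).

Lemma muE U c i :
  mu U c i = if conn U (c, Some i) (ordS c, None)
             then xi (c, Some i) + xi (ordS c, None) else 1.
Proof. by []. Qed.

Lemma cid_conn U x y : conn U x y -> cid U (xi x - xi y).
Proof. exact: cideal_conn. Qed.

Lemma mu_cid U c i p : togglable U c i -> cid U p -> cid (tog U c i) (mu U c i * p).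
Proof. by move=> H Ip; rewrite /cid dperm_tog //; apply: cideal_smul. Qed.

Lemma mu_twice U c i : togglable U c i ->
  mu U c i * mu (tog U c i) c i = xi (c, Some i) + xi (ordS c, None).
Proof. by move=> H; rewrite /mu dperm_tog // smul_twice. Qed.

Lemma conn_tog U c i : togglable U c i ->
  conn (tog U c i) (c, Some i) (ordS c, None) = ~~ conn U (c, Some i) (ordS c, None).
Proof. by move=> H; rewrite /conn dperm_tog // porbit_tperm_flip. Qed.

Lemma togglable_tog U c i c' i' : c' != c -> togglable U c' i' ->
  togglable (tog U c i) c' i'.
Proof. by move=> ne; rewrite /togglable !ffunE (negPf ne). Qed.

Lemma mu_comm U c i c' i' : c != c' -> togglable U c i -> togglable U c' i' ->
  cid (tog (tog U c i) c' i')
    (mu U c i * mu (tog U c i) c' i' - mu U c' i' * mu (tog U c' i') c i).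
Proof.
move=> ne H H'; have ne' : c' != c by rewrite eq_sym.
rewrite /cid /mu !dperm_tog ?togglable_tog //.
by apply: smul_comm; rewrite ?xpair_eqE ?(inj_eq (can_inj (@ordSK M))) ?(negPf ne) ?andbF.
Qed.
End Saddle.
End Diagram.

Lemma conn_map (M M' : nat) (U : diag M) (V : diag M') (phi : cnode M -> cnode M') :
  (forall c, link U (fun x y => conn V (phi x) (phi y)) c) ->
  forall x y, conn U x y -> conn V (phi x) (phi y).
Proof.
move/link_nxt => H x; apply: porbit_ind; first exact: conn_refl.
by move=> y Hy; apply: conn_trans Hy _; rewrite dpermE; apply: H.
Qed.

(** * Cyclic words and families commuting with saddles *)

Definition ovr (M : nat) (X : seq 'I_M) (be : 'I_M -> option bool) (U : diag M) : diag M :=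
  [ffun c => if c \in X then be c else U c].

(* Components, for all diagrams outside of the levels [X], of a map which replaces the
   pattern [al] on [X] by [be] and commutes with the saddles outside of [X]; [Y] are
   the levels interior to [X]. *)
Record natural (M : nat) (X Y : seq 'I_M) (al be : 'I_M -> option bool)
    (P1 P : comNzRingType) (xi1 : cnode M -> P1) (xi : cnode M -> P)
    (f : diag M -> P1 -> P) : Prop := Natural {
  natB : forall U p q, f U (p - q) = f U p - f U q;
  nat_cid : forall U p, cid xi1 (ovr X al U) p -> cid xi (ovr X be U) (f U p);
  nat_tog : forall U c i p, c \notin X -> togglable U c i ->
    cid xi (ovr X be (tog U c i))
      (mu xi (ovr X be U) c i * f U p - f (tog U c i) (mu xi1 (ovr X al U) c i * p));
  nat_lin : forall U v p, v.1 \notin Y -> f U (xi1 v * p) = xi v * f U p }.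

Section Natural.
Variable M : nat.
Variables (X Y : seq 'I_M).
Hypothesis XY : forall c, c \notin X -> c \notin Y /\ ordS c \notin Y.
Implicit Types (U : diag M) (c : 'I_M) (al be ga : 'I_M -> option bool).

Lemma ovr_tog be U c i : c \notin X -> ovr X be (tog U c i) = tog (ovr X be U) c i.
Proof.
move=> nX; apply/ffunP => k; rewrite !ffunE (negPf nX).
by case: (eqVneq k c) => [->|_]; rewrite ?(negPf nX) // if_same.
Qed.

Lemma togglable_ovr be U c i : c \notin X -> togglable (ovr X be U) c i = togglable U c i.
Proof. by move=> nX; rewrite /togglable !ffunE (negPf nX). Qed.

Section Gen.
Variables (P1 P2 P : comNzRingType).
Variables (xi1 : cnode M -> P1) (xi2 : cnode M -> P2) (xi : cnode M -> P).

Lemma nat0 al be f : natural X Y al be xi1 xi f -> forall U, f U 0 = 0.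
Proof. by move=> nf U; rewrite -(subrr 0) (natB nf) subrr. Qed.

Lemma natN al be f : natural X Y al be xi1 xi f -> forall U p, f U (- p) = - f U p.
Proof. by move=> nf U p; rewrite -[- p]add0r (natB nf) (nat0 nf) add0r. Qed.

Lemma natD al be f : natural X Y al be xi1 xi f ->
  forall U p q, f U (p + q) = f U p + f U q.
Proof. by move=> nf U p q; rewrite -[q]opprK (natB nf) (natN nf) !opprK. Qed.

Lemma nat_sign al be f : natural X Y al be xi1 xi f ->
  forall U n p, f U ((-1) ^+ n * p) = (-1) ^+ n * f U p.
Proof.
move=> nf U n; elim: n => [|n IH] p; first by rewrite !mul1r.
by rewrite !exprS -!mulrA !mulN1r (natN nf) IH.
Qed.

(** For a map that does not depend on the diagram, commuting with outer saddles only requires that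
    both patterns connect the same nodes outside of [Y]: this decides between merge and split, and
    the factors are variables over which the map is linear. *)
Lemma natural_lin al be (F : P1 -> P) :
  {morph F : p q / p - q} ->
  (forall v p, v.1 \notin Y -> F (xi1 v * p) = xi v * F p) ->
  (forall U p, cid xi1 (ovr X al U) p -> cid xi (ovr X be U) (F p)) ->
  (forall U x y, x.1 \notin Y -> y.1 \notin Y ->
     conn (ovr X al U) x y = conn (ovr X be U) x y) ->
  natural X Y al be xi1 xi (fun _ => F).
Proof.
move=> FB Flin FI Fc; split=> // U c i p nX _.
have [nc nSc] := XY nX; rewrite !muE Fc //.
case: ifP => _; last by rewrite !mul1r subrr; apply: cideal0.
have FD p' q' : F (p' + q') = F p' + F q'.
  have F0 : F 0 = 0 by rewrite -(subrr 0) FB subrr.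
  by rewrite -[q']opprK FB -[- q']add0r FB F0 !add0r !opprK.
by rewrite !mulrDl FD !Flin // subrr; apply: cideal0.
Qed.

Lemma natural_comp al be ga f g :
  natural X Y al be xi1 xi2 f -> natural X Y be ga xi2 xi g ->
  natural X Y al ga xi1 xi (fun U p => g U (f U p)).
Proof.
move=> nf ng; split=> [U p q|U p Ip|U c i p nX tg|U v p nY].
- by rewrite (natB nf) (natB ng).
- exact/(nat_cid ng)/(nat_cid nf).
- apply: cideal_eqm (nat_tog ng _ nX tg) _.
  rewrite -(natB ng); apply: (nat_cid ng); exact: (nat_tog nf).
- by rewrite (nat_lin nf) // (nat_lin ng).
Qed.

Lemma natural_opp al be f : natural X Y al be xi1 xi f ->
  natural X Y al be xi1 xi (fun U p => - f U p).
Proof.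
move=> nf; split=> [U p q|U p Ip|U c i p nX tg|U v p nY].
- by rewrite (natB nf) opprD.
- exact/cidealN/(nat_cid nf).
- by rewrite mulrN -opprD; apply/cidealN/(nat_tog nf).
- by rewrite (nat_lin nf) // mulrN.
Qed.

(** A saddle inside of [X] is itself such a family; this is the commutation of saddles at distinct
    levels. *)
Lemma natural_saddle be c i : c \in X -> (be c == None) || (be c == Some i) ->
  natural X Y be (fun k => if k == c then (if be c == Some i then None else Some i) else be k)
    xi xi (fun U p => mu xi (ovr X be U) c i * p).
Proof.
move=> cX tg; set be' := (fun k => _).
have tgU U : togglable (ovr X be U) c i by rewrite /togglable !ffunE cX.
have E U : ovr X be' U = tog (ovr X be U) c i.
  apply/ffunP => k; rewrite !ffunE cX /be'.
  by case: (eqVneq k c) => [->|_]; rewrite ?cX.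
split=> [U p q|U p Ip|U k j p nX tgk|U v p nY].
- by rewrite mulrBr.
- by rewrite E; apply: mu_cid.
- have ck : c != k by apply: contraNneq nX => <-.
  rewrite E !ovr_tog // E.
  have tgk' : togglable (ovr X be U) k j by rewrite togglable_ovr.
  have := mu_comm xi ck (tgU U) tgk'.
  have -> : tog (tog (ovr X be U) c i) k j = tog (tog (ovr X be U) k j) c i.
    have kc : (k == c) = false by rewrite eq_sym (negPf ck).
    apply/ffunP => l; rewrite !ffunE kc (negPf ck).
    by case: (eqVneq l k) => [->|//]; rewrite ?kc ?(negPf ck).
  move=> /(cidealM p); rewrite mulrBr => H.
  by rewrite [X in cid _ _ X](_ : _ = p * (mu xi (ovr X be U) c i *
    mu xi (tog (ovr X be U) c i) k j) - p * (mu xi (ovr X be U) k j *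
    mu xi (tog (ovr X be U) k j) c i)) //; ring.
- by ring.
Qed.
End Gen.

(** [phi] and [psi] push the interior nodes of one pattern along their arcs to places which make
    sense in the other; each gives one implication. *)
Lemma conn_ovr al be (phi psi : cnode M -> cnode M) U x y :
  (forall v, v.1 \notin Y -> phi v = v) -> (forall v, v.1 \notin Y -> psi v = v) ->
  (forall c, c \in X ->
     link (ovr X al U) (fun x y => conn (ovr X be U) (phi x) (phi y)) c) ->
  (forall c, c \in X ->
     link (ovr X be U) (fun x y => conn (ovr X al U) (psi x) (psi y)) c) ->
  x.1 \notin Y -> y.1 \notin Y ->
  conn (ovr X al U) x y = conn (ovr X be U) x y.
Proof.
move=> phiE psiE H1 H2 nx ny.
have out (f : cnode M -> cnode M) (g h : 'I_M -> option bool) :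
    (forall v, v.1 \notin Y -> f v = v) -> (forall c, c \in X ->
     link (ovr X g U) (fun x y => conn (ovr X h U) (f x) (f y)) c) ->
    forall c, link (ovr X g U) (fun x y => conn (ovr X h U) (f x) (f y)) c.
  move=> fE H c; have [/H //|nX] := boolP (c \in X).
  have [nc nSc] := XY nX; have := link_conn (ovr X h U) c.
  rewrite /link !ffunE (negPf nX).
  by case: (U c) => [i|]; rewrite !fE.
apply/idP/idP => H.
  by rewrite -(phiE x) // -(phiE y) //; apply: conn_map H; apply: out.
by rewrite -(psiE x) // -(psiE y) //; apply: conn_map H; apply: out.
Qed.

Lemma natural_hom al be (P1 P : comNzRingType) (th : {rmorphism P1 -> P})
    (xi1 : cnode M -> P1) (xi : cnode M -> P) (phi psi : cnode M -> cnode M) :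
  (forall v, th (xi1 v) = xi (phi v)) ->
  (forall v, v.1 \notin Y -> phi v = v) -> (forall v, v.1 \notin Y -> psi v = v) ->
  (forall U c, c \in X ->
     link (ovr X al U) (fun x y => conn (ovr X be U) (phi x) (phi y)) c) ->
  (forall U c, c \in X ->
     link (ovr X be U) (fun x y => conn (ovr X al U) (psi x) (psi y)) c) ->
  natural X Y al be xi1 xi (fun _ => th).
Proof.
move=> thE phiE psiE H1 H2.
have out (f : cnode M -> cnode M) (g h : 'I_M -> option bool) U :
    (forall v, v.1 \notin Y -> f v = v) -> (forall c, c \in X ->
     link (ovr X g U) (fun x y => conn (ovr X h U) (f x) (f y)) c) ->
    forall c, link (ovr X g U) (fun x y => conn (ovr X h U) (f x) (f y)) c.
  move=> fE H c; have [/H //|nX] := boolP (c \in X).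
  have [nc nSc] := XY nX; have := link_conn (ovr X h U) c.
  rewrite /link !ffunE (negPf nX).
  by case: (U c) => [i|]; rewrite !fE.
apply: natural_lin => [p q|v p nY|U p|U x y nx ny].
- by rewrite rmorphB.
- by rewrite rmorphM thE phiE.
- elim=> [|u x r _ IH|u x r _ IH]; first by rewrite rmorph0; apply: cideal0.
    rewrite rmorphD rmorphM rmorphB !thE; apply: cidealD IH; apply/cidealM/cid_conn.
    rewrite dpermE; apply: (link_nxt (R := fun x y => conn (ovr X be U) (phi x) (phi y))).
    by apply: out => // c; apply: H1.
  rewrite rmorphD rmorphM rmorphXn thE; apply: cidealD IH; apply/cidealM/cideal_sqr1.
- by apply: (conn_ovr phiE psiE) => //; [apply: H1|apply: H2].
Qed.
End Natural.

(* [Pos i] has the states 0 (oriented) and 1 (turnback).  [Neg i k] stands for [k]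
   negative crossings: state 0 is oriented, states 1..k are copies of the turnback,
   and the differential goes from state [j.+1] to state [j].  [Neg i 0] is trivial. *)
Inductive gletter := Pos of bool | Neg of bool & nat.
Definition side l := match l with Pos i => i | Neg i _ => i end.
Definition jmax l := match l with Pos _ => 1%N | Neg _ k => k end.
Definition tl l (j : nat) : option bool := if j == 0%N then None else Some (side l).
(** The state of the letter from which the differential arrives at state [j]. *)
Definition pre l (j : nat) : option nat :=
  match l with
  | Pos _ => if j == 1%N then Some 0%N else None
  | Neg _ k => if (j < k)%N then Some j.+1 else None
  end.

(** * Complexes of cyclic words and transfer of solutions *)

Section Words.
Variable M : nat.
Definition state := {ffun 'I_M -> nat}.
Implicit Types (W : nat -> gletter) (s : state) (c : 'I_M).

Definition vst W s := forall c, (s c <= jmax (W c))%N.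
Definition dg W s : diag M := [ffun c : 'I_M => tl (W c) (s c)].
Definition st0 : state := [ffun _ => 0%N].

Section Complex.
Variables (P : comNzRingType) (xi : cnode M -> P).

Definition sg s c : P := (-1) ^+ (\sum_(k < M | (k < c)%N) s k).
(** Here [s] is the target of the arrow, so [s c = j'.+1] means an arrow between two copies of a
    turnback. Differences and sums of the same two variables alternate and their product is a
    difference of squares; the arrow into state 1 is a difference, which the next saddle kills by
    joining the two nodes. *)
Definition em W s c j : P :=
  match W c, s c with
  | Neg _ _, j'.+1 => xi (c, None) + (-1) ^+ j'.+1 * xi (ordS c, None)
  | _, _ => mu xi (dg W (upd s c j)) c (side (W c))
  end.
Definition Dc W (Z : state -> P) s c : P :=
  if pre (W c) (s c) is Some j then sg s c * em W s c j * Z (upd s c j) else 0.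
Definition psiv s c : P :=
  if s == st0 then xi (c, None) * xi (c, Some false) * xi (c, Some true) else 0.
(** Asking the congruence at every level avoids singling one out when [M] is arbitrary; by
    [psiv_level] the expressions for psi at different levels are congruent. *)
Definition Sol W Z := forall s, vst W s -> forall c,
  cid xi (dg W s) (\sum_k Dc W Z s k - psiv s c).
End Complex.

(* psi is a boundary, for any values of the node variables. *)
Definition Bound (R : comNzRingType) W := forall (P : comNzRingType) (rho : {rmorphism R -> P})
  (xi : cnode M -> P), exists Z, Sol xi W Z.

Lemma conn_level (U : diag M) p c c' : (forall k, U k = None) -> conn U (c, p) (c', p).
Proof.
move=> U0; have step k : conn U (k, p) (ordS k, p).
  have := link_conn U k; rewrite /link U0 => -[H1 H2 H3].
  by case: p => [[]|] //; rewrite conn_sym.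
wlog lec : c c' / (c <= c')%N.
  by move=> H; case/orP: (leq_total c c') => /H //; rewrite conn_sym.
have [n En] : exists n, (c' = c + n :> nat)%N by exists (c' - c)%N; rewrite subnKC.
elim: n c' En {lec} => [|n IH] c' En.
  by rewrite (_ : c' = c) ?conn_refl //; apply: val_inj; rewrite /= En addn0.
have lt : (c + n < M)%N by apply: leq_trans (ltn_ord c'); rewrite En addnS.
rewrite (_ : c' = ordS (Ordinal lt)); first exact: conn_trans (IH (Ordinal lt) erefl) (step _).
by apply: val_inj; rewrite /= modn_small ?En ?addnS // -addnS -En.
Qed.

Lemma cid_prod3 (P : comNzRingType) (xi : cnode M -> P) (U : diag M) c c' :
  (forall p, conn U (c, p) (c', p)) ->
  cid xi U (xi (c, None) * xi (c, Some false) * xi (c, Some true)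
            - xi (c', None) * xi (c', Some false) * xi (c', Some true)).
Proof.
move=> H; have e p := cid_conn xi (H p).
rewrite [X in cid _ _ X](_ : _ = xi (c, Some false) * xi (c, Some true) *
  (xi (c, None) - xi (c', None)) + xi (c', None) * xi (c, Some true) *
  (xi (c, Some false) - xi (c', Some false)) + xi (c', None) * xi (c', Some false) *
  (xi (c, Some true) - xi (c', Some true))); last by ring.
by apply: cidealD; [apply: cidealD|]; apply/cidealM/e.
Qed.

Lemma psiv_level (P : comNzRingType) (xi : cnode M -> P) W s c c' :
  cid xi (dg W s) (psiv xi s c - psiv xi s c').
Proof.
rewrite /psiv; case: eqP => [->|_]; last by rewrite subrr; apply: cideal0.
by apply: cid_prod3 => p; apply: conn_level => k; rewrite !ffunE.
Qed.

Lemma pre_valid l j j' : pre l j = Some j' -> (j <= jmax l)%N -> (j' <= jmax l)%N.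
Proof.
case: l => [i|i k] /=; first by case: ifP => // _ [<-].
by case: ifP => // H [<-].
Qed.

Section Transfer.
Variables (X Y : seq 'I_M) (W1 W0 : nat -> gletter).
Hypothesis uX : uniq X.
Hypothesis XY : forall c, c \notin X -> c \notin Y /\ ordS c \notin Y.
Hypothesis W10 : forall c, c \notin X -> W1 c = W0 c.
Variables (P1 P : comNzRingType) (xi1 : cnode M -> P1) (xi : cnode M -> P).
Variables (K : eqType) (J : state -> seq K) (ov : K -> state -> state)
  (f : K -> diag M -> P1 -> P).
Variable Z1 : state -> P1.
Hypothesis S1 : Sol xi1 W1 Z1.
Definition transferred s : P := \sum_(k <- J s) f k (dg W0 s) (Z1 (ov k s)).
Hypothesis Jout : forall s c j, c \notin X -> J (upd s c j) = J s.
Hypothesis ovout : forall k s c j, c \notin X -> ov k (upd s c j) = upd (ov k s) c j.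
Hypothesis ovE : forall k s c, c \notin X -> ov k s c = s c.
Hypothesis ov_sg : forall k s c, vst W0 s -> k \in J s -> c \notin X ->
  sg P1 (ov k s) c = sg P1 s c.
Hypothesis ov_vst : forall k s c, vst W0 s -> k \in J s -> c \in X ->
  (ov k s c <= jmax (W1 c))%N.
Hypothesis fnat : forall k s, vst W0 s -> k \in J s ->
  natural X Y (dg W1 (ov k s)) (dg W0 s) xi1 xi (f k).
Variable cr : 'I_M.
Hypothesis local : forall s, vst W0 s ->
  cid xi (dg W0 s)
   (\sum_(k <- X) Dc xi W0 transferred s k
    - \sum_(k <- J s) f k (dg W0 s) (\sum_(l <- X) Dc xi1 W1 Z1 (ov k s) l)
    + (\sum_(k <- J s) f k (dg W0 s) (psiv xi1 (ov k s) cr) - psiv xi s cr)).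

Lemma ovr_dg W s (t : state) : (forall c, c \in X -> tl (W c) (t c) = tl (W c) (s c)) ->
  ovr X (dg W t) (dg W s) = dg W s.
Proof. by move=> H; apply/ffunP => c; rewrite !ffunE; case: ifP => // /H. Qed.

Lemma dg_ov k s : dg W1 (ov k s) = ovr X (dg W1 (ov k s)) (dg W0 s).
Proof.
apply/ffunP => c; rewrite !ffunE; case: ifPn => // nX.
by rewrite ovE // W10.
Qed.

Lemma natural_sum al be (F : diag M -> P1 -> P) U (r : seq 'I_M) Q (G : 'I_M -> P1) :
  natural X Y al be xi1 xi F ->
  F U (\sum_(c <- r | Q c) G c) = \sum_(c <- r | Q c) F U (G c).
Proof. by move=> nF; apply: (big_morph _ (natD nF U) (nat0 nF U)). Qed.

(** Outside of [X] the words agree: saddles commute with the family by [nat_tog], arrows between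
    copies of a turnback by [nat_lin], and [ov_sg] identifies the Koszul signs. *)
Lemma transfer_outer s c : vst W0 s -> c \notin X ->
  cid xi (dg W0 s) (Dc xi W0 transferred s c
    - \sum_(k <- J s) f k (dg W0 s) (Dc xi1 W1 Z1 (ov k s) c)).
Proof.
move=> vs nX; have [nc nSc] := XY nX.
rewrite /Dc; case Ep: (pre (W0 c) (s c)) => [j|]; last first.
  rewrite sub0r; apply: cidealN; rewrite big_seq; apply: cideal_sum => k kJ.
  by rewrite W10 // ovE // Ep (nat0 (fnat vs kJ)); apply: cideal0.
set t := upd s c j.
have vt : vst W0 t.
  move=> l; rewrite ffunE; case: eqP => [->|_] //.
  by apply: pre_valid Ep _.
rewrite /transferred Jout // -/t mulr_sumr -sumrB big_seq; apply: cideal_sum => k kJ.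
have nf := fnat vs kJ.
rewrite W10 // ovE // Ep ov_sg // -!mulrA -ovout // -/t.
have fsg p : f k (dg W0 s) (sg P1 s c * p) = sg P s c * f k (dg W0 s) p.
  exact: (nat_sign nf).
rewrite fsg -mulrBr; apply: cidealM.
have Es : dg W0 s = ovr X (dg W0 s) (dg W0 s) by rewrite ovr_dg.
have Et : dg W0 t = ovr X (dg W0 s) (dg W0 t).
  apply/ffunP => l; rewrite !ffunE; case: (eqVneq l c) => [->|_]; first by rewrite (negPf nX).
  by rewrite if_same.
have E1 : dg W1 (ov k t) = ovr X (dg W1 (ov k s)) (dg W0 t).
  rewrite ovout //; apply/ffunP => l; rewrite !ffunE.
  case: (eqVneq l c) => [->|nl]; first by rewrite (negPf nX) W10.
  by case: ifPn => // lX; rewrite ovE // W10.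
have tog_case : dg W0 s = tog (dg W0 t) c (side (W0 c)) ->
    togglable (dg W0 t) c (side (W0 c)) ->
    cid xi (dg W0 s) (mu xi (dg W0 t) c (side (W0 c)) * f k (dg W0 t) (Z1 (ov k t))
     - f k (dg W0 s) (mu xi1 (dg W1 (ov k t)) c (side (W0 c)) * Z1 (ov k t))).
  move=> Est tg; have := nat_tog nf (Z1 (ov k t)) nX tg.
  by rewrite -Est -Es -Et -E1.
rewrite /em W10 // ovE //.
case EW: (W0 c) Ep vs => [i|i m] /= => Ep vs.
  rewrite -/t -ovout // -/t.
  move: Ep; case: eqP => // sc [ej]; rewrite EW /= in tog_case; apply: tog_case.
    apply/ffunP => l; rewrite !ffunE; case: eqP => // ->.
    by rewrite EW sc -ej eqxx /tl /=.
  by rewrite /togglable !ffunE eqxx -ej.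
move: Ep; case: ltnP => // sm [ej].
case Esc: (s c) sm ej => [|j'] sm ej.
  rewrite -/t -ovout // -/t; rewrite EW /= in tog_case; apply: tog_case.
    apply/ffunP => l; rewrite !ffunE; case: eqP => // ->.
    by rewrite EW Esc -ej eqxx /tl /= eqxx.
  by rewrite /togglable !ffunE eqxx -ej EW /tl /= eqxx.
(* An arrow between two copies of a turnback leaves the diagram unchanged and multiplies by
   variables outside of [Y]. *)
have -> : dg W0 t = dg W0 s.
  apply/ffunP => l; rewrite !ffunE; case: eqP => // ->.
  by rewrite EW Esc -ej.
rewrite !mulrDl (natD nf) (nat_lin nf) //.
by rewrite -!mulrA (nat_sign nf) (nat_lin nf) // subrr; apply: cideal0.
Qed.

(** The image of a solution under a map of complexes carrying psi to psi. The defect of the chain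
    map identity at the levels of [X], together with the defect on psi, is [local]; the other levels
    are covered by [transfer_outer], and the rest is the image of the equation solved by [Z1]. *)
Lemma transfer : Sol xi W0 transferred.
Proof.
move=> s vs c'; suff: cid xi (dg W0 s) (\sum_k Dc xi W0 transferred s k - psiv xi s cr).
  by move=> H; apply: cideal_eqm H _; apply: psiv_level.
move: cr local => c loc; rewrite (bigID (mem X)) /= [X in X + _ - _](_ : _ =
  \sum_(k <- X) Dc xi W0 transferred s k); last first.
  by rewrite [RHS]big_uniq.
have outer : cid xi (dg W0 s) (\sum_(k | k \notin X) Dc xi W0 transferred s k
   - \sum_(k <- J s) f k (dg W0 s) (\sum_(l | l \notin X) Dc xi1 W1 Z1 (ov k s) l)).
  rewrite [X in _ - X](_ : _ = \sum_(l | l \notin X)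
    \sum_(k <- J s) f k (dg W0 s) (Dc xi1 W1 Z1 (ov k s) l)).
    rewrite -sumrB; apply: cideal_sum => l lX; exact: transfer_outer.
  rewrite exchange_big /= !big_seq; apply: eq_bigr => k kJ.
  by rewrite (natural_sum _ _ _ _ (fnat vs kJ)).
have eqs : cid xi (dg W0 s) (\sum_(k <- J s) f k (dg W0 s)
   (\sum_l Dc xi1 W1 Z1 (ov k s) l - psiv xi1 (ov k s) c)).
  rewrite big_seq; apply: cideal_sum => k kJ.
  have Es : dg W0 s = ovr X (dg W0 s) (dg W0 s) by rewrite ovr_dg.
  rewrite {1}Es; apply: (nat_cid (fnat vs kJ)); rewrite -dg_ov; apply: S1 => l.
  have [lX|lX] := boolP (l \in X); first exact: ov_vst.
  by rewrite ovE // W10.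
have E : \sum_(k <- J s) f k (dg W0 s)
   (\sum_l Dc xi1 W1 Z1 (ov k s) l - psiv xi1 (ov k s) c) =
   \sum_(k <- J s) f k (dg W0 s) (\sum_(l <- X) Dc xi1 W1 Z1 (ov k s) l)
   + \sum_(k <- J s) f k (dg W0 s) (\sum_(l | l \notin X) Dc xi1 W1 Z1 (ov k s) l)
   - \sum_(k <- J s) f k (dg W0 s) (psiv xi1 (ov k s) c).
  rewrite -big_split /= -sumrB !big_seq; apply: eq_bigr => k kJ.
  have nf := fnat vs kJ.
  rewrite (natB nf) -(natD nf) (bigID (mem X)) /=.
  by congr (f k _ (_ + _) - _); rewrite [RHS]big_uniq.
rewrite E in eqs; have := cidealD (cidealD (loc s vs) outer) eqs.
set e := (X in cideal _ _ X); set g := (X in cid _ _ X).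
suff -> : g = e by [].
rewrite /e /g; ring.
Qed.
End Transfer.
End Words.

(** * Removal of a circle *)

Lemma natural_ext M (X Y : seq 'I_M) al al' be be' (P1 P : comNzRingType)
    (xi1 : cnode M -> P1) (xi : cnode M -> P) f :
  {in X, al =1 al'} -> {in X, be =1 be'} ->
  natural X Y al be xi1 xi f -> natural X Y al' be' xi1 xi f.
Proof.
move=> Ea Eb nf.
have O g g' U : {in X, g =1 g'} -> ovr X g' U = ovr X g U.
  by move=> E; apply/ffunP => c; rewrite !ffunE; case: ifP => // /E.
split=> [|U p|U c i p|].
- exact: (natB nf).
- by rewrite (O _ _ _ Ea) (O _ _ _ Eb); apply: (nat_cid nf).
- by rewrite (O _ _ _ Ea) !(O _ _ _ Eb); apply: (nat_tog nf).
- exact: (nat_lin nf).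
Qed.

(** * Node variables as indeterminates, and their evaluation *)

Section Universal.
Variables (M : nat) (P : comNzRingType).
Definition xiU (v : cnode M) : {mpoly P[#|{: cnode M}|]} := 'X_(enum_rank v).

(** With indeterminates as node values, a coefficient can be extracted, or interior nodes renamed,
    before evaluating back in [P]. *)
Lemma Bound_univ (R : comNzRingType) (rho : {rmorphism R -> P}) W :
  Bound M R W -> exists Z, Sol xiU W Z.
Proof.
move=> /(_ _ (@mpolyC #|{: cnode M}| P \o rho : {rmorphism R -> {mpoly P[#|{: cnode M}|]}}) xiU).
exact.
Qed.

Section Eval.
Variables (Q : comNzRingType) (h : {rmorphism P -> Q}) (ze : cnode M -> Q).
Definition evm : {rmorphism {mpoly P[#|{: cnode M}|]} -> Q} := mmap h (fun k => ze (enum_val k)).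
Lemma evm_xi v : evm (xiU v) = ze v.
Proof. by rewrite /evm /xiU /= mmapX mmap1U enum_rankK. Qed.
End Eval.

Arguments evm : simpl never.

Lemma evm_comp (Q Q' : comNzRingType) (h : {rmorphism P -> Q}) (ze : cnode M -> Q)
    (g : {rmorphism Q -> Q'}) (h' : {rmorphism P -> Q'}) (ze' : cnode M -> Q') p :
  (forall a, g (h a) = h' a) -> (forall v, g (ze v) = ze' v) ->
  g (evm h ze p) = evm h' ze' p.
Proof.
move=> Eh Ez; rewrite /evm /= /mmap rmorph_sum; apply: eq_bigr => m _.
rewrite rmorphM Eh rmorph_prod; congr (_ * _); apply: eq_bigr => k _.
by rewrite rmorphXn Ez.
Qed.

Lemma evm_cid (Q : comNzRingType) (h : {rmorphism P -> Q}) (z1 z2 : cnode M -> Q)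
    (xi : cnode M -> Q) U p :
  (forall v, cid xi U (z1 v - z2 v)) -> cid xi U (evm h z1 p - evm h z2 p).
Proof.
move=> H; rewrite /evm /= /mmap -sumrB; apply: cideal_sum => m _.
rewrite -mulrBr; apply: cidealM; rewrite /mmap1.
pose K x y := cid xi U (x - y); rewrite -/(K _ _).
have KM x y x' y' : K x y -> K x' y' -> K (x * x') (y * y').
  move=> H1 H2; rewrite /K (_ : _ - _ = x' * (x - y) + y * (x' - y')); last by ring.
  by apply: cidealD; apply: cidealM.
have K1 : K 1 1 by rewrite /K subrr; apply: cideal0.
apply: (big_ind2 K) => // k _; elim: (m k) => [|n IH]; first by rewrite !expr0.
by rewrite !exprS; apply: KM => //; apply: H.
Qed.
End Universal.

Lemma rmorph_mu M (P1 P : comNzRingType) (th : {rmorphism P1 -> P})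
    (xi1 : cnode M -> P1) (xi : cnode M -> P) U c i :
  (forall v, th (xi1 v) = xi v) -> th (mu xi1 U c i) = mu xi U c i.
Proof.
by move=> E; rewrite !muE; case: ifP => _; rewrite ?rmorph1 // rmorphD !E.
Qed.

Section Death.
Variables (M : nat) (X Y : seq 'I_M).
Hypothesis XY : forall c, c \notin X -> c \notin Y /\ ordS c \notin Y.
Variables (P : comNzRingType) (xi : cnode M -> P) (Wd : pred (cnode M)).
Variables (phi psi : cnode M -> cnode M).
Definition zeW v : {poly P} := if Wd v then 'X else (xi (phi v))%:P.
Definition zW (p : {mpoly P[#|{: cnode M}|]}) : {poly P} := evm (@polyC P) zeW p.
(* The counit of the circle [Wd]: the coefficient of its variable. *)
Definition death (p : {mpoly P[#|{: cnode M}|]}) : P := (zW p)`_1.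

Lemma zWM p q : zW (p * q) = zW p * zW q. Proof. exact: rmorphM. Qed.
Lemma zWD p q : zW (p + q) = zW p + zW q. Proof. exact: rmorphD. Qed.
Lemma zWB p q : zW (p - q) = zW p - zW q. Proof. exact: rmorphB. Qed.
Lemma zWXn p n : zW (p ^+ n) = zW p ^+ n. Proof. exact: rmorphXn. Qed.
Lemma zW_in v : Wd v -> zW (xiU P v) = 'X. Proof. by rewrite /zW evm_xi /zeW => ->. Qed.
Lemma zW_out v : ~~ Wd v -> zW (xiU P v) = (xi (phi v))%:P.
Proof. by rewrite /zW evm_xi /zeW => /negPf ->. Qed.

(** No relation mixes the nodes of [Wd] with the others. Hence a relation becomes 0 or a relation
    between the remaining nodes, and the square of the loop variable has no linear coefficient. *)
Lemma natural_death al be :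
  (forall v, Wd v -> v.1 \in Y) ->
  (forall v, v.1 \notin Y -> phi v = v) -> (forall v, v.1 \notin Y -> psi v = v) ->
  (forall U c, c \in X -> link (ovr X al U)
     (fun x y => conn (ovr X be U) (phi x) (phi y) /\ (Wd x = Wd y)) c) ->
  (forall U c, c \in X ->
     link (ovr X be U) (fun x y => conn (ovr X al U) (psi x) (psi y)) c) ->
  natural X Y al be (xiU P) xi (fun _ => death).
Proof.
move=> WY phiE psiE H1 H2.
have W0 v : v.1 \notin Y -> Wd v = false by move=> nY; apply: contraNF nY; apply: WY.
have Hphi U c : link (ovr X al U)
     (fun x y => conn (ovr X be U) (phi x) (phi y) /\ (Wd x = Wd y)) c.
  have [/H1 //|nX] := boolP (c \in X).
  have [nc nSc] := XY nX; have := link_conn (ovr X be U) c.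
  rewrite /link !ffunE (negPf nX).
  by case: (U c) => [i|] []; rewrite !phiE ?W0.
have Hpsi U c : link (ovr X be U) (fun x y => conn (ovr X al U) (psi x) (psi y)) c.
  have [/H2 //|nX] := boolP (c \in X).
  have [nc nSc] := XY nX; have := link_conn (ovr X al U) c.
  rewrite /link !ffunE (negPf nX).
  by case: (U c) => [i|]; rewrite !psiE.
apply: natural_lin => // [p q|v p nY|U p|U x y nx ny].
- by rewrite /death /zW rmorphB coefB.
- by rewrite /death zWM zW_out ?W0 // phiE // coefCM.
- have st := link_nxt (Hphi U).
  elim=> [|u x r _ IH|u x r _ IH]; first by rewrite /death /zW rmorph0 coef0; apply: cideal0.
    rewrite /death zWD coefD; apply: cidealD IH; rewrite zWM zWB.
    have [cxy wxy] := st x; rewrite dpermE.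
    case: (boolP (Wd x)) => wx.
      by rewrite !zW_in -?wxy // subrr mulr0 coef0; apply: cideal0.
    rewrite !zW_out -?wxy // -polyCB coefMC; apply: cidealM.
    exact: cid_conn.
  rewrite /death zWD coefD; apply: cidealD IH; rewrite zWM zWXn.
  case: (boolP (Wd x)) => wx; first by rewrite zW_in // coefMXn; apply: cideal0.
  by rewrite zW_out // -rmorphXn coefMC; apply/cidealM/cideal_sqr1.
- apply/idP/idP => H.
    rewrite -(phiE x) // -(phiE y) //; apply: conn_map H => c.
    by have := Hphi U c; rewrite /link; case: (ovr _ _ _ _) => [i|] [[? _] [? _] [? _]].
  by rewrite -(psiE x) // -(psiE y) //; apply: conn_map H.
Qed.

(** Modulo squares only the constant and the linear coefficient in the loop variable survive, so
    placing the loop on the circle of [w] gives [p_0 + x_w p_1]. This expresses that the counit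
    after a split is the identity. *)
Lemma death_subst U w p (ze : cnode M -> P) :
  (forall v, cid xi U (ze v - (if Wd v then xi w else xi (phi v)))) ->
  cid xi U (evm idfun ze p - ((zW p)`_0 + xi w * (zW p)`_1)).
Proof.
move=> Hw.
have E1 : cid xi U (evm idfun ze p - (zW p).[xi w]).
  rewrite (_ : (zW p).[xi w] = evm idfun (fun v => (zeW v).[xi w]) p).
    by apply: evm_cid => v; rewrite /zeW; move: (Hw v); case: ifP; rewrite ?hornerX ?hornerC.
  rewrite /zW -(@evm_comp _ _ _ _ (@polyC P) zeW (horner_eval (xi w)) idfun) //.
  by move=> a; rewrite /= /horner_eval hornerC.
(* Peeling off the two lowest coefficients leaves a multiple of [xi w ^+ 2]. *)
apply: cideal_eqm E1 _; move: (zW p); apply: poly_ind => [|q a _].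
  by rewrite horner0 !coef0 mulr0 addr0 subrr; apply: cideal0.
rewrite hornerMXaddC !coefD !coefMX !coefC /= addr0 add0r.
move: q; apply: poly_ind => [|r b _].
  by rewrite horner0 !coef0 mulr0 mul0r addr0 add0r subrr; apply: cideal0.
rewrite hornerMXaddC !coefD !coefMX !coefC /= add0r.
rewrite [X in cideal _ _ X](_ : _ = r.[xi w] * xi w ^+ 2); last by ring.
exact/cidealM/cideal_sqr1.
Qed.
End Death.

(** * Second Reidemeister move *)

Section Pair.
Variables (M : nat) (c : 'I_M).
Hypothesis hc : (c.+1 < M)%N.
Notation c1 := (ordS c).
Notation c2 := (ordS (ordS c)).

Lemma val_ordS : c1 = c.+1 :> nat.
Proof. by rewrite /= modn_small. Qed.

Lemma ordS_neq : (c1 == c) = false.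
Proof. by apply/eqP => /(congr1 val) /=; rewrite modn_small //; lia. Qed.

Lemma ordS_neq' : (c == c1) = false.
Proof. by rewrite eq_sym ordS_neq. Qed.

Lemma ordSS_neq : (c2 == c1) = false.
Proof. by rewrite (inj_eq (can_inj (@ordSK M))) ordS_neq. Qed.

Definition X2 := [:: c; c1].
Definition Y2 := [:: c1].

Lemma uX2 : uniq X2.
Proof. by rewrite /= inE ordS_neq'. Qed.

Lemma XY2 k : k \notin X2 -> k \notin Y2 /\ ordS k \notin Y2.
Proof.
rewrite /X2 /Y2 !inE negb_or => /andP [k0 k1]; split=> //.
by rewrite (inj_eq (can_inj (@ordSK M))).
Qed.

Definition pat2 (a b : option bool) : 'I_M -> option bool := fun k => if k == c then a else b.

Lemma ovr2_0 a b U : ovr X2 (pat2 a b) U c = a.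
Proof. by rewrite ffunE /pat2 inE eqxx. Qed.
Lemma ovr2_1 a b U : ovr X2 (pat2 a b) U c1 = b.
Proof. by rewrite ffunE /pat2 !inE eqxx orbT ordS_neq. Qed.

Definition phiT (x : cnode M) : cnode M := if x.1 == c1 then (c, x.2) else x.
Definition phiB (x : cnode M) : cnode M := if x.1 == c1 then (c2, x.2) else x.

Lemma phiT_out v : v.1 \notin Y2 -> phiT v = v.
Proof. by rewrite inE /phiT => /negPf ->. Qed.
Lemma phiB_out v : v.1 \notin Y2 -> phiB v = v.
Proof. by rewrite inE /phiB => /negPf ->. Qed.

Definition st2 (s : state M) a b : state M := upd (upd s c a) c1 b.

Lemma st2_0 s a b : st2 s a b c = a.
Proof. by rewrite !ffunE ordS_neq' eqxx. Qed.
Lemma st2_1 s a b : st2 s a b c1 = b.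
Proof. by rewrite !ffunE eqxx. Qed.
Lemma st2_out s a b k : k \notin X2 -> st2 s a b k = s k.
Proof. by rewrite !inE negb_or !ffunE => /andP [/negPf -> /negPf ->]. Qed.
Lemma st2_upd s a b k j : k \notin X2 -> st2 (upd s k j) a b = upd (st2 s a b) k j.
Proof.
rewrite !inE negb_or => /andP [n0 n1]; apply/ffunP => l; rewrite !ffunE.
case: (eqVneq l c1) => [->|_]; first by rewrite (eq_sym _ k) (negPf n1).
by case: (eqVneq l c) => [->|_]; first by rewrite (eq_sym _ k) (negPf n0).
Qed.
Lemma st2_upd0 s a b a' : upd (st2 s a b) c a' = st2 s a' b.
Proof.
apply/ffunP => l; rewrite !ffunE; case: (eqVneq l c) => [->|//].
by rewrite ordS_neq'.
Qed.
Lemma st2_upd1 s a b b' : upd (st2 s a b) c1 b' = st2 s a b'.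
Proof. by apply/ffunP => l; rewrite !ffunE; case: eqP. Qed.
Lemma st2_id s : st2 s (s c) (s c1) = s.
Proof.
apply/ffunP => l; rewrite !ffunE; case: (eqVneq l c1) => [->//|_].
by case: eqP => // ->.
Qed.
Lemma st2_st2 s a b a' b' : st2 (st2 s a b) a' b' = st2 s a' b'.
Proof. by apply/ffunP => l; rewrite !ffunE; do 2 case: eqP => //. Qed.

Lemma dg_st2 W s a b :
  dg W (st2 s a b) = ovr X2 (pat2 (tl (W c) a) (tl (W c1) b)) (dg W s).
Proof.
apply/ffunP => l; rewrite !ffunE !inE /pat2.
case: (eqVneq l c1) => [->|_]; first by rewrite orbT ordS_neq.
by case: (eqVneq l c) => [->|].
Qed.

Section Sg.
Variable P : comNzRingType.

Lemma sg_st2_0 s a b : sg P (st2 s a b) c = sg P s c.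
Proof.
rewrite /sg; congr (_ ^+ _); apply: eq_bigr => k kc; rewrite !ffunE.
by case: eqP => [E|_]; [move: kc; rewrite E val_ordS|case: eqP => // E; move: kc; rewrite E]; lia.
Qed.

Lemma sg_st2_1 s a b : sg P (st2 s a b) c1 = sg P s c * (-1) ^+ a.
Proof.
rewrite /sg (bigD1 c) /=; last by rewrite modn_small.
rewrite st2_0 -exprD addnC; congr (_ ^+ (_ + _)).
rewrite modn_small //; apply: eq_big => k; first by rewrite -(inj_eq val_inj) /=; lia.
by move=> /andP [k1 k0]; rewrite !ffunE (negPf k0); case: eqP => // E;
   move: k1; rewrite E val_ordS; lia.
Qed.

Lemma sg_st2_out (s : state M) a b k : k \notin X2 -> odd (a + b) = odd (s c + s c1) ->
  sg P (st2 s a b) k = sg P s k.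
Proof.
rewrite !inE negb_or -!(inj_eq val_inj) /= modn_small // => /andP [k0 k1] od.
rewrite /sg; case: (ltnP k c) => kc.
  congr (_ ^+ _); apply: eq_bigr => l lk; rewrite !ffunE.
  by case: eqP => [E|_]; [move: lk; rewrite E val_ordS|case: eqP => // E; move: lk; rewrite E]; lia.
have spl (t : state M) : (\sum_(l < M | (l < k)%N) t l =
    t c + t c1 + \sum_(l < M | (l < k)%N && (l != c) && (l != c1)) t l)%N.
  rewrite (bigD1 c) /=; last by lia.
  by rewrite (bigD1 c1) /= ?addnA // modn_small //; apply/andP; split; [lia|rewrite ordS_neq].
rewrite -signr_odd -[RHS]signr_odd (spl s) (spl (st2 s a b)) st2_0 st2_1.
rewrite (eq_bigr (fun l => s l)) => [|l /andP [/andP [_ l0] l1]].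
  by rewrite oddD od -oddD.
by rewrite !ffunE (negPf l0) (negPf l1).
Qed.
End Sg.
End Pair.

Ltac conn_simp hc :=
  rewrite /phiT /phiB /= ?eqxx ?(ordS_neq hc) ?(ordS_neq' hc) ?(ordSS_neq hc) //=.
Ltac conn_walk hc n :=
  lazymatch n with
  | O => fail
  | S ?m => first [ exact: conn_refl
    | apply: conn_nxt; rewrite /nxt ?ordSK ?ovr2_0 ?(ovr2_1 hc) //=; conn_walk hc m ]
  end.
Ltac conn_tac hc := solve [conn_walk hc 8%nat | rewrite conn_sym; conn_walk hc 8%nat].
Ltac link2 hc :=
  let U := fresh "U" in let k := fresh "k" in
  move=> U k; rewrite /= [_ \in _]inE [_ \in [:: _]]inE => /orP [] /eqP ->;
  rewrite /link ?ovr2_0 ?(ovr2_1 hc) /=; split; conn_simp hc; conn_tac hc.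

Lemma link_id M (X : seq 'I_M) al U c :
  link (ovr X al U) (fun x y => conn (ovr X al U) (id x) (id y)) c.
Proof. exact: link_conn. Qed.

Lemma natural_id M (X Y : seq 'I_M) al (P : comNzRingType) (xi : cnode M -> P) :
  (forall c, c \notin X -> c \notin Y /\ ordS c \notin Y) ->
  natural X Y al al xi xi (fun _ => idfun).
Proof.
move=> XY; apply: (natural_hom XY (phi := id) (psi := id)) => // U c _; exact: link_id.
Qed.

(** No arrow of a positive letter enters its oriented state. The states in which this letter is
    oriented thus form a quotient complex, to which a solution restricts and in which psi is the psi
    of the shorter word. *)
Lemma drop_pos M (R : comNzRingType) (W W' : nat -> gletter) (c : 'I_M) i j :
  W c = Pos i -> W' c = Neg j 0 -> (forall k : 'I_M, k != c -> W k = W' k) ->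
  Bound M R W -> Bound M R W'.
Proof.
move=> Wc W'c WW' B P rho xi; have [Z1 S1] := B P rho xi.
have s0 s : vst W' s -> upd s c 0%N = s.
  move=> /(_ c); rewrite W'c /= leqn0 => /eqP sc.
  by apply/ffunP => k; rewrite ffunE; case: eqP => // ->.
have XY (k : 'I_M) : k \notin [:: c] -> k \notin [::] /\ ordS k \notin [::] by [].
exists (transferred W' (fun _ => [:: tt]) (fun _ s => upd s c 0%N) (fun _ _ => idfun) Z1).
apply: (transfer (X := [:: c]) (Y := [::]) _ XY _ S1 _ _ _ _ _ _ (cr := c)) => //.
- by move=> k; rewrite inE; apply: WW'.
- move=> [] s k l; rewrite inE => kc; apply/ffunP => m; rewrite !ffunE.
  by case: (eqVneq m c) => // ->; rewrite eq_sym (negPf kc).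
- by move=> [] s k; rewrite inE ffunE => /negPf ->.
- by move=> [] s k vs; rewrite s0.
- by move=> [] s k _ _; rewrite inE => /eqP ->; rewrite ffunE eqxx.
- move=> [] s vs _; rewrite s0 //; apply: natural_ext (natural_id _ _ XY) => // k.
  by rewrite inE => /eqP ->; rewrite !ffunE Wc W'c; have := vs c; rewrite W'c leqn0 => /eqP ->.
- move=> s vs; have sc : s c = 0%N by have := vs c; rewrite W'c leqn0 => /eqP.
  rewrite !big_cons !big_nil /= s0 // /Dc W'c Wc sc /= !addr0 subrr add0r subrr.
  exact: cideal0.
Qed.

Section R2.
Variables (M : nat) (c : 'I_M).
Hypothesis hc : (c.+1 < M)%N.
Notation c1 := (ordS c).
Notation c2 := (ordS (ordS c)).
Variables (R : comNzRingType) (W W' : nat -> gletter) (d i j0 j1 : bool).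
Hypothesis Wc : W c = if d then Pos i else Neg i 1.
Hypothesis Wc1 : W c1 = if d then Neg i 1 else Pos i.
Hypothesis W'c : W' c = Neg j0 0.
Hypothesis W'c1 : W' c1 = Neg j1 0.
Hypothesis WW' : forall k : 'I_M, k \notin X2 c -> W k = W' k.

(** [n] and [q] are the levels of the negative and of the positive letter; [d] says that the
    positive one comes first. *)
Let n := if d then c1 else c.
Let q := if d then c else c1.
(** The state of degree -1, with a turnback at the negative letter only. [phid] pushes interior
    nodes across the straight letter, and [loopd] is the loop closed up when both letters are
    turnbacks. *)
Definition negp := pat2 c (if d then None else Some i) (if d then Some i else None).
Definition phid := if d then phiT c else phiB c.
Definition loopd (v : cnode M) := (v.1 == c1) && (v.2 != Some (~~ i)).

Lemma phid_out v : v.1 \notin Y2 c -> phid v = v.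
Proof. by rewrite /phid; case: d => nY; [apply: phiT_out|apply: phiB_out]. Qed.

Section Fam.
Variables (P : comNzRingType) (xi : cnode M -> P).
Let xf v := xi (phid v).

Lemma nat_death2 : natural (X2 c) (Y2 c) (pat2 c (Some i) (Some i)) negp
  (xiU P) xf (fun _ => death xf loopd id).
Proof.
apply: (@natural_death M (X2 c) (Y2 c) (@XY2 M c) P xf loopd id phid) => //.
- by move=> v /andP [/eqP -> _]; rewrite inE.
- exact: phid_out.
- rewrite /negp /loopd; case: d; case: i => U k; rewrite [_ \in _]inE [_ \in [:: _]]inE => /orP [] /eqP ->;
  rewrite /link ?ovr2_0 ?(ovr2_1 hc) /=; do !split; conn_simp hc; conn_tac hc.
- by rewrite /phid /negp; case: d; case: i; link2 hc.
Qed.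

Lemma nat_sad2 : natural (X2 c) (Y2 c) negp (pat2 c None None) xf xf
   (fun U p => mu xf (ovr (X2 c) negp U) n i * p).
Proof.
apply: natural_ext (natural_saddle (Y2 c) xf (c := n) (i := i) _ _) => //.
- move=> k; rewrite [_ \in _]inE [_ \in [:: _]]inE /n /negp /pat2.
  by case/orP => /eqP ->; case: d; rewrite /= ?eqxx ?(ordS_neq hc) ?(ordS_neq' hc) ?eqxx.
- by rewrite /n /X2; case: d; rewrite !inE eqxx ?orbT.
- by rewrite /n /negp /pat2; case: d; rewrite ?eqxx ?(ordS_neq hc) ?eqxx orbT.
Qed.

Lemma nat_straight (al : 'I_M -> option bool) : al =1 pat2 c None None ->
  natural (X2 c) (Y2 c) al al xf xi (fun _ => idfun).
Proof.
move=> E; apply: natural_ext (_ : natural _ _ (pat2 c None None) (pat2 c None None) _ _ _) => //.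
apply: (natural_hom (@XY2 M c) (phi := phid) (psi := id)) => //.
- exact: phid_out.
- by rewrite /phid; case: d; link2 hc.
by move=> U k _; apply: link_id.
Qed.

Lemma nat_ev2 : natural (X2 c) (Y2 c) (pat2 c None None) (pat2 c None None)
  (xiU P) xi (fun _ => evm idfun xf).
Proof.
apply: (natural_hom (@XY2 M c) (phi := phid) (psi := id)) => //.
- by move=> v; rewrite evm_xi.
- exact: phid_out.
- by rewrite /phid; case: d; link2 hc.
by move=> U k _; apply: link_id.
Qed.
End Fam.

Lemma conn_negp U v : loopd v -> conn (ovr (X2 c) negp U) v (if d then (c, Some i) else (c2, None)).
Proof.
case: v => k p /andP [/eqP /= -> ip]; rewrite /negp.
by case: d; case: i ip; case: p => [[]|] // _; conn_simp hc; conn_tac hc.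
Qed.

(** The map is the identity when both letters are oriented, and the counit of the loop followed by
    the saddle at [n] when both are turnbacks. It vanishes on the image of the state [negp]: the
    split at [q] followed by the counit is the identity, so the two contributions cancel. *)
Lemma r2_delete : Bound M R W -> Bound M R W'.
Proof.
move=> B P rho xi; have [Z1 S1] := Bound_univ rho B.
pose xf v := xi (phid v).
pose fE (U : diag M) p := mu xf (ovr (X2 c) negp U) n i * death xf loopd id p.
(* The two arrows out of [negp] have equal Koszul signs when [d] holds and opposite ones
   otherwise. *)
pose f (k : bool) (U : diag M) p := if k then (if d then - fE U p else fE U p) else evm idfun xf p.
pose ov (k : bool) s := if k then st2 c s 1 1 else st2 c s 0 0.
have v0 s : vst W' s -> s c = 0%N /\ s c1 = 0%N.
  move=> vs; have := vs c; have := vs c1; rewrite W'c W'c1 /= !leqn0.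
  by move=> /eqP -> /eqP ->.
have dg0 s : vst W' s -> dg W' s =1 ovr (X2 c) (pat2 c None None) (dg W' s).
  move=> vs; have [s0 s1] := v0 s vs; move=> k; rewrite !ffunE !inE /pat2.
  case: (eqVneq k c) => [->|_] /=; first by rewrite s0.
  by case: (eqVneq k c1) => [->|//]; rewrite s1.
have nE : natural (X2 c) (Y2 c) (pat2 c (Some i) (Some i)) (pat2 c None None) (xiU P) xi fE.
  have nn := natural_comp (natural_comp (nat_death2 xi) (nat_sad2 xi)) (nat_straight xi (frefl _)).
  exact: nn.
have W1 s a b : dg W (st2 c s a b) = ovr (X2 c) (pat2 c (tl (Pos i) a) (tl (Pos i) b)) (dg W' s).
  rewrite (dg_st2 hc) Wc Wc1 /tl; case: d => /=; apply/ffunP => k; rewrite !ffunE;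
  by case: ifPn => // nX; rewrite ?ffunE WW'.
exists (transferred W' (fun _ => [:: false; true]) ov f Z1).
apply: (transfer (uX2 hc) (@XY2 M c) WW' S1 _ _ _ _ _ _ (cr := c)) => //.
- by move=> [] s k j nX; rewrite /ov st2_upd.
- by move=> [] s k nX; rewrite /ov st2_out.
- move=> k s l vs _ nX; have [s0 s1] := v0 s vs.
  by case: k; rewrite /ov sg_st2_out // s0 s1.
- move=> k s l vs _; rewrite [_ \in _]inE [_ \in [:: _]]inE => /orP [] /eqP ->;
  by case: k; rewrite /ov ?(st2_0 hc) ?st2_1 ?Wc ?Wc1; case: d.
- move=> k s vs _; have D0 := dg0 s vs.
  have eb : {in X2 c, pat2 c None None =1 dg W' s}.
    by move=> l lX; rewrite D0 ffunE lX.
  case: k; rewrite /ov W1.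
    apply: natural_ext (_ : natural _ _ (pat2 c (Some i) (Some i)) (pat2 c None None) _ _ _) => //.
      by move=> l lX; rewrite ffunE lX.
    by rewrite /f; case: d => //; apply: natural_opp.
  apply: natural_ext (nat_ev2 xi) => //.
  by move=> l lX; rewrite ffunE lX.
move=> s vs; have [s0 s1] := v0 s vs; set U := dg W' s.
have EU : U = ovr (X2 c) (pat2 c None None) U by apply/ffunP/dg0.
have st00 : st2 c s 0 0 = s by rewrite -{1}s0 -{1}s1 (st2_id c).
pose t := st2 c s (if d then 0%N else 1%N) (if d then 1%N else 0%N).
have dt : dg W t = ovr (X2 c) negp U.
  by rewrite W1 /negp; case: d.
pose Zt := Z1 t; pose eps := sg P s c; pose epsU := sg {mpoly P[#|{: cnode M}|]} s c.
have D00 : \sum_(l <- X2 c) Dc (xiU P) W Z1 (ov false s) l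
    = epsU * (mu (xiU P) (ovr (X2 c) negp U) n i * Zt).
  rewrite !big_cons big_nil addr0 /ov /Dc Wc Wc1 st2_1 (st2_0 hc) /em Wc Wc1 st2_1 (st2_0 hc).
  rewrite /Zt /epsU /n -dt /t; case: d => /=.
    by rewrite add0r (sg_st2_1 hc) expr0 mulr1 st2_upd1 -mulrA.
  by rewrite addr0 (sg_st2_0 hc) (st2_upd0 hc) -mulrA.
have D11 : \sum_(l <- X2 c) Dc (xiU P) W Z1 (ov true s) l
    = (if d then epsU else - epsU) * (mu (xiU P) (ovr (X2 c) negp U) q i * Zt).
  rewrite !big_cons big_nil addr0 /ov /Dc Wc Wc1 st2_1 (st2_0 hc) /em Wc Wc1 st2_1 (st2_0 hc).
  rewrite /Zt /epsU /q -dt /t; case: d => /=.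
    by rewrite addr0 (sg_st2_0 hc) (st2_upd0 hc) -mulrA.
  by rewrite add0r (sg_st2_1 hc) expr1 mulrN1 st2_upd1 -mulrA.
have psi1 : f false U (psiv (xiU P) (ov false s) c) = psiv xi s c.
  rewrite /f /ov st00 /psiv; case: eqP => _; last by rewrite rmorph0.
  rewrite !rmorphM /= !evm_xi /xf !phid_out // inE /= (ordS_neq' hc) //.
have psi2 : psiv (xiU P) (ov true s) c = 0.
  rewrite /psiv /ov; case: eqP => // /ffunP /(_ c); by rewrite (st2_0 hc) ffunE.
have Ef1 p : f true U p = if d then - fE U p else fE U p by [].
have E1 : f false U (epsU * (mu (xiU P) (ovr (X2 c) negp U) n i * Zt)) =
    eps * (mu xf (ovr (X2 c) negp U) n i * evm idfun xf Zt).
  by rewrite /f !rmorphM /= (rmorph_mu (xi := xf)) ?rmorph_sign // => v; rewrite evm_xi.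
have qconn : conn (ovr (X2 c) negp U) (q, Some i) (ordS q, None).
  by rewrite /negp /q; case: d; case: i; conn_simp hc; conn_tac hc.
pose w : cnode M := if d then (c, Some i) else (c2, None).
have E2 : death xf loopd id (mu (xiU P) (ovr (X2 c) negp U) q i * Zt) =
    (zW xf loopd id Zt)`_0 + xf w * (zW xf loopd id Zt)`_1.
  rewrite muE qconn /death zWM zWD /q /w; case: d.
    rewrite zW_out; last by rewrite /loopd /= (ordS_neq' hc).
    by rewrite zW_in ?/loopd /= ?eqxx // mulrDl coefD coefCM coefXM addrC.
  rewrite zW_in; last by rewrite /loopd /= eqxx; case: i.
  rewrite zW_out; last by rewrite /loopd /= (ordSS_neq hc).
  by rewrite mulrDl coefD coefCM coefXM.
have E3 : f true U ((if d then epsU else - epsU) * (mu (xiU P) (ovr (X2 c) negp U) q i * Zt)) =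
    - eps * (mu xf (ovr (X2 c) negp U) n i *
      ((zW xf loopd id Zt)`_0 + xf w * (zW xf loopd id Zt)`_1)).
  have sE p : fE U (epsU * p) = eps * fE U p by rewrite (nat_sign nE).
  rewrite Ef1; case: d => /=; rewrite ?mulNr ?(natN nE) sE /fE E2 //.
have sum2 (A : zmodType) (F : bool -> A) : \sum_(k <- [:: false; true]) F k = F false + F true.
  by rewrite !big_cons big_nil addr0.
rewrite !sum2 D00 D11 psi1 psi2 E1 E3.
have -> : f true U 0 = 0 by rewrite Ef1 (nat0 nE) oppr0 if_same.
have -> : \sum_(k <- X2 c) Dc xi W' (transferred W' (fun=> [:: false; true]) ov f Z1) s k = 0.
  by rewrite !big_cons big_nil /Dc W'c W'c1 s0 s1 /= !addr0.
have key : cid xf (ovr (X2 c) negp U) (evm idfun xf Zt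
    - ((zW xf loopd id Zt)`_0 + xf w * (zW xf loopd id Zt)`_1)).
  apply: death_subst => v; case: ifPn => [lv|_]; last by rewrite subrr; apply: cideal0.
  exact/cid_conn/conn_negp.
have := nat_cid (natural_comp (nat_sad2 xi) (nat_straight xi (frefl _))) key.
rewrite -EU => /(cidealM (- eps)).
set A := (X in cideal _ _ X) => HA; set B' := (X in cid _ _ X).
by suff -> : B' = A by []; rewrite /A /B' /xf /=; ring.
Qed.
End R2.

Section R2i.
Variables (M : nat) (c : 'I_M).
Hypothesis hc : (c.+1 < M)%N.
Notation c1 := (ordS c).
Notation c2 := (ordS (ordS c)).
Variables (R : comNzRingType) (W W' : nat -> gletter) (d i j0 j1 : bool).
Hypothesis Wc : W c = if d then Pos i else Neg i 1.
Hypothesis Wc1 : W c1 = if d then Neg i 1 else Pos i.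
Hypothesis W'c : W' c = Neg j0 0.
Hypothesis W'c1 : W' c1 = Neg j1 0.
Hypothesis WW' : forall k : 'I_M, k \notin X2 c -> W k = W' k.

Let n := if d then c1 else c.
Let q := if d then c else c1.
Let posp := negp c (~~ d) i.
Let phi := phid c (~~ d).

Lemma nat_sad2' (P : comNzRingType) (xf : cnode M -> P) :
  natural (X2 c) (Y2 c) (pat2 c None None) posp xf xf
   (fun U p => mu xf (ovr (X2 c) (pat2 c None None) U) q i * p).
Proof.
apply: natural_ext (natural_saddle (Y2 c) xf (c := q) (i := i) _ _) => //.
- move=> k; rewrite [_ \in _]inE [_ \in [:: _]]inE /q /posp /negp /pat2.
  by case/orP => /eqP ->; case: d; rewrite /= ?eqxx ?(ordS_neq hc) ?(ordS_neq' hc) ?eqxx.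
- by rewrite /q /X2; case: d; rewrite !inE eqxx ?orbT.
- by rewrite /q /pat2; case: ifP.
Qed.

Lemma nat_birth2 (P : comNzRingType) (xi : cnode M -> P) :
  natural (X2 c) (Y2 c) posp (pat2 c (Some i) (Some i)) (fun v => xi (phi v)) xi (fun _ => idfun).
Proof.
apply: (natural_hom (@XY2 M c) (phi := phi) (psi := id)) => //.
- exact: phid_out.
- by rewrite /phi /phid /posp /negp; case: d; case: i; link2 hc.
- by rewrite /posp /negp; case: d; case: i; link2 hc.
Qed.

Lemma conn_posp_phi U v : conn (ovr (X2 c) posp U) v (phi v).
Proof.
case: v => k p; rewrite /phi /phid; case: (eqVneq k c1) => [->|nk]; last first.
  by case: d; rewrite /phiT /phiB /= (negPf nk); apply: conn_refl.
by rewrite /posp /negp; case: d; case: i; case: p => [[]|]; conn_simp hc; conn_tac hc.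
Qed.

(** This saddle merges the loop into its neighbour: its two nodes are connected afterwards, hence
    not before. *)
Lemma mu_ee (P : comNzRingType) (xi : cnode M -> P) U :
  mu xi (ovr (X2 c) (pat2 c (Some i) (Some i)) U) n i = 1.
Proof.
have tg : togglable (ovr (X2 c) posp U) n i.
  by rewrite /togglable /posp /negp /n; case: d; rewrite ?ovr2_0 ?(ovr2_1 hc).
have E : ovr (X2 c) (pat2 c (Some i) (Some i)) U = tog (ovr (X2 c) posp U) n i.
  apply/ffunP => k; rewrite /tog /posp /negp /n; case: d; rewrite ?ovr2_0 ?(ovr2_1 hc);
  rewrite !ffunE !inE /pat2 /=; case: (eqVneq k c) => [->|nc] //=;
  rewrite ?(ordS_neq' hc) //; by case: eqP.
rewrite muE E conn_tog // (_ : conn _ _ _ = true) //.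
by rewrite /posp /negp /n; case: d; case: i; conn_simp hc; conn_tac hc.
Qed.

(** The map in the other direction: the identity, and the saddle at [q] followed by the birth of a
    loop labelled [v_+]. At the state with a turnback at the positive letter only, the two
    contributions cancel, because the saddle at [n] merges the newborn loop. *)
Lemma r2_insert : Bound M R W' -> Bound M R W.
Proof.
move=> B P rho xi; pose xf v := xi (phi v); have [Z1 S1] := B P rho xf.
pose fS (U : diag M) p := mu xf (ovr (X2 c) (pat2 c None None) U) q i * p.
pose f (k : bool) (U : diag M) p := if k then (if d then fS U p else - fS U p) else p.
pose ov (k : bool) s := st2 c s 0 0.
pose J (s : state M) := match s c, s c1 with 0%N, 0%N => [:: false] | 1%N, 1%N => [:: true] | _, _ => [::] end.
have nS : natural (X2 c) (Y2 c) (pat2 c None None) (pat2 c (Some i) (Some i)) xf xi fS.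
  exact: (natural_comp (nat_sad2' xf) (nat_birth2 xi)).
have W1 s : dg W' (st2 c s 0 0) = ovr (X2 c) (pat2 c None None) (dg W s).
  rewrite (dg_st2 hc) W'c W'c1 /tl /=; apply/ffunP => k; rewrite !ffunE.
  by case: ifPn => // nX; rewrite ?ffunE WW'.
have WU s : dg W s = ovr (X2 c) (pat2 c (tl (Pos i) (s c)) (tl (Pos i) (s c1))) (dg W s).
  rewrite -{1}(st2_id c s) (dg_st2 hc) Wc Wc1 /tl; by case: d.
have v1 s : vst W s -> (s c <= 1)%N /\ (s c1 <= 1)%N.
  by move=> vs; have := vs c; have := vs c1; rewrite Wc Wc1; case: d.
have WW k : k \notin X2 c -> W' k = W k by move=> /WW'.
exists (transferred W J ov f Z1).
apply: (transfer (uX2 hc) (@XY2 M c) WW S1 _ _ _ _ _ _ (cr := c)) => //.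
- move=> s k j; rewrite [_ \in _]inE [_ \in [:: _]]inE negb_or => /andP [k0 k1].
  by rewrite /J !ffunE eq_sym (negPf k0) eq_sym (negPf k1).
- by move=> k s l j nX; rewrite /ov st2_upd.
- by move=> k s l nX; rewrite /ov st2_out.
- move=> k s l vs kJ nX; rewrite /ov sg_st2_out //.
  by move: kJ; rewrite /J; case: (s c) => [|[]]; case: (s c1) => [|[]].
- by move=> k s l vs _; rewrite [_ \in _]inE [_ \in [:: _]]inE => /orP [] /eqP ->;
  rewrite /ov ?(st2_0 hc) ?st2_1.
- move=> k s vs kJ; rewrite /ov W1.
  have ea : {in X2 c, pat2 c None None =1 ovr (X2 c) (pat2 c None None) (dg W s)}.
    by move=> l lX; rewrite ffunE lX.
  have eb : {in X2 c, pat2 c (tl (Pos i) (s c)) (tl (Pos i) (s c1)) =1 dg W s}.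
    by move=> l lX; rewrite WU ffunE lX.
  move: kJ eb; rewrite /J; case: (s c) => [|[]]; case: (s c1) => [|[|l]] //;
  rewrite !inE => /eqP -> eb; apply: natural_ext (ea) (eb) _.
    exact: (nat_straight hc (~~ d) xi (frefl _)).
  by rewrite /f /tl /=; case: d => //; apply: natural_opp.
move=> s vs; have [s0 s1] := v1 s vs; set T := transferred _ _ _ _ _.
have Tbad u a b : (a + b = 1)%N -> T (st2 c u a b) = 0.
  by rewrite /T /transferred /J st2_1 (st2_0 hc); case: a => [|[]] //; case: b => [|[]] //; rewrite big_nil.
have src : \sum_(l <- X2 c) Dc xf W' Z1 (st2 c s 0 0) l = 0.
  by rewrite !big_cons big_nil /Dc W'c W'c1 (st2_0 hc) st2_1 /= !addr0.
have dgt a b : dg W (st2 c s a b) = ovr (X2 c) (pat2 c (tl (Pos i) a) (tl (Pos i) b)) (dg W s).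
  by rewrite (dg_st2 hc) Wc Wc1 /tl; case: d.
have ovt a b be : ovr (X2 c) be (dg W (st2 c s a b)) = ovr (X2 c) be (dg W s).
  by rewrite dgt; apply/ffunP => k; rewrite !ffunE; case: (k \in _).
have T00 : T (st2 c s 0 0) = Z1 (st2 c s 0 0).
  by rewrite /T /transferred /J (st2_0 hc) st2_1 big_seq1 /f /ov st2_st2.
pose m := mu xf (ovr (X2 c) (pat2 c None None) (dg W s)) q i.
have T11 : T (st2 c s 1 1) = (if d then 1 else -1) * (m * Z1 (st2 c s 0 0)).
  rewrite /T /transferred /J (st2_0 hc) st2_1 big_seq1 /f /ov st2_st2 /fS ovt.
  by case: d; rewrite ?mul1r ?mulN1r.
have psi0 a b : (0 < a + b)%N -> psiv xi (st2 c s a b) c = 0.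
  rewrite /psiv; case: eqP => // E; have := congr1 (fun t : state M => t c) E.
  have := congr1 (fun t : state M => t c1) E; rewrite (st2_0 hc) st2_1 !ffunE.
  by move=> -> ->.
have mixed1 : mu xi (ovr (X2 c) (pat2 c (Some i) (Some i)) (dg W s)) n i = 1 by exact: mu_ee.
have mixed2 : cid xi (ovr (X2 c) posp (dg W s))
    (mu xi (ovr (X2 c) (pat2 c None None) (dg W s)) q i - m).
  rewrite /m !muE; case: ifP => _; last by rewrite subrr; apply: cideal0.
  by rewrite opprD addrACA; apply: cidealD; apply/cid_conn/conn_posp_phi.
have wrap U e a g : cid xi U a -> e = g * a -> cid xi U e by move=> H ->; apply: cidealM.
rewrite -(st2_id c s); move: T00 T11 psi0 src mixed1 mixed2.
move=> T00 T11 psi0 src mixed1 mixed2.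
move: (s c) (s c1) s0 s1 => [|[|//]] [|[|//]] _ _.
- have -> : \sum_(k <- X2 c) Dc xi W T (st2 c s 0 0) k = 0.
    rewrite !big_cons big_nil /Dc Wc Wc1 st2_1 (st2_0 hc).
    by case: d => /=; rewrite ?(st2_upd0 hc) ?st2_upd1 Tbad // mulr0 !addr0.
  rewrite /J (st2_0 hc) st2_1 !big_seq1 /ov !st2_st2 src {1}/f subrr add0r.
  rewrite /f /psiv /xf /phi !phid_out ?subrr; first exact: cideal0.
  - by rewrite inE /= (ordS_neq' hc).
  - by rewrite inE /= (ordS_neq' hc).
  by rewrite inE /= (ordS_neq' hc).
- rewrite psi0 ?add0n // subr0 /J (st2_0 hc) st2_1 !big_nil subr0 addr0.
  rewrite !big_cons big_nil /Dc /em Wc Wc1 st2_1 (st2_0 hc).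
  case Ed: d => /=; first by rewrite !addr0; apply: cideal0.
  rewrite !(st2_upd0 hc) !st2_upd1 !addr0 (sg_st2_0 hc) (sg_st2_1 hc) expr0 mulr1 T00 T11 dgt dgt dgt.
  move: mixed1 mixed2; rewrite /n /q /posp /negp Ed /= => -> m2.
  by apply: (wrap _ _ _ (sg P s c * Z1 (st2 c s 0 0)) m2); rewrite /tl /=; ring.
- rewrite psi0 ?addn0 // subr0 /J (st2_0 hc) st2_1 !big_nil subr0 addr0.
  rewrite !big_cons big_nil /Dc /em Wc Wc1 st2_1 (st2_0 hc).
  case Ed: d => /=; last by rewrite !addr0; apply: cideal0.
  rewrite !(st2_upd0 hc) !st2_upd1 !addr0 (sg_st2_0 hc) (sg_st2_1 hc) expr1 T00 T11 dgt dgt dgt.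
  move: mixed1 mixed2; rewrite /n /q /posp /negp Ed /= => -> m2.
  by apply: (wrap _ _ _ (sg P s c * Z1 (st2 c s 0 0)) m2); rewrite /tl /=; ring.
- have -> : \sum_(k <- X2 c) Dc xi W T (st2 c s 1 1) k = 0.
    rewrite !big_cons big_nil /Dc Wc Wc1 st2_1 (st2_0 hc).
    by case: d => /=; rewrite ?(st2_upd0 hc) ?st2_upd1 Tbad // mulr0 !addr0.
  rewrite psi0 // subr0 /J (st2_0 hc) st2_1 !big_seq1 /ov !st2_st2 src.
  rewrite (_ : f true _ 0 = 0); last by rewrite /f /fS mulr0 oppr0 if_same.
  rewrite subrr add0r dgt /psiv; case: eqP => _; last first.
    by rewrite /f /fS mulr0 oppr0 if_same; apply: cideal0.
  (* The second component kills psi: the turnback at level [c] joins two of its three nodes, so a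
     square appears. *)
  rewrite (_ : f true _ _ = (if d then 1 else -1) * mu xf (ovr (X2 c) (pat2 c None None)
     (dg W (st2 c s 1 1))) q i * (xi (c, Some (~~ i)) * (xi (c, Some i) * xi (c, None)))).
    apply/cidealM/cidealM; rewrite (_ : _ * _ = xi (c, Some i) ^+ 2
      - xi (c, Some i) * (xi (c, Some i) - xi (c, None))); last by ring.
    apply: cidealB; first exact: cideal_sqr1.
    by apply/cidealM/cid_conn; case: i; conn_tac hc.
  have xfc p : xf (c, p) = xi (c, p) by rewrite /xf /phi phid_out // inE /= (ordS_neq' hc).
  by rewrite /f /fS !xfc dgt; case: d; case: i => /=; ring.
Qed.
End R2i.

(** * Merging negative twists *)

Section TwistMerge.
Variables (M : nat) (c : 'I_M).
Hypothesis hc : (c.+1 < M)%N.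
Notation c1 := (ordS c).
Notation c2 := (ordS (ordS c)).
Variables (R : comNzRingType) (W W' : nat -> gletter) (i j1 : bool) (k : nat).
Hypothesis Wc : W c = Neg i k.
Hypothesis Wc1 : W c1 = Neg i 1.
Hypothesis W'c : W' c = Neg i k.+1.
Hypothesis W'c1 : W' c1 = Neg j1 0.
Hypothesis WW' : forall l : 'I_M, l \notin X2 c -> W l = W' l.

Let e0 := pat2 c (Some i) None.
Let e1 := pat2 c None (Some i).
Let ee := pat2 c (Some i) (Some i).

Lemma link_e1e0 : forall U l, l \in X2 c ->
  link (ovr (X2 c) e1 U) (fun x y => conn (ovr (X2 c) e0 U) (phiT c x) (phiT c y)) l.
Proof. by rewrite /e1 /e0; case: i; link2 hc. Qed.

Lemma link_e0e1 : forall U l, l \in X2 c ->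
  link (ovr (X2 c) e0 U) (fun x y => conn (ovr (X2 c) e1 U) (phiB c x) (phiB c y)) l.
Proof. by rewrite /e1 /e0; case: i; link2 hc. Qed.

Lemma conn_e1e0 U x y : x.1 \notin Y2 c -> y.1 \notin Y2 c ->
  conn (ovr (X2 c) e1 U) x y = conn (ovr (X2 c) e0 U) x y.
Proof.
apply: (conn_ovr (@XY2 M c) (@phiT_out M c) (@phiB_out M c)) => l lX.
  exact: link_e1e0. exact: link_e0e1.
Qed.

(** The two patterns differ by sliding the turnback across a straight level, so removing it by a
    saddle is of the same kind in both. *)
Lemma conn_slide U : conn (ovr (X2 c) e1 U) (c1, Some i) (c2, None) =
  conn (ovr (X2 c) e0 U) (c, Some i) (c1, None).
Proof.
have H1 : conn (ovr (X2 c) e1 U) (c, Some i) (c1, Some i).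
  by rewrite /e1; case: i; conn_tac hc.
have H2 : conn (ovr (X2 c) e0 U) (c1, None) (c2, None).
  by rewrite /e0; case: i; conn_tac hc.
have n0 p : (c, p).1 \notin Y2 c by rewrite inE /= (ordS_neq' hc).
have n2 p : (c2, p).1 \notin Y2 c by rewrite inE /= (ordSS_neq hc).
apply/idP/idP => H.
  apply: (conn_trans (y := (c2, None))); last by rewrite conn_sym.
  rewrite -conn_e1e0 //; exact: conn_trans H1 H.
rewrite conn_sym in H1; apply: conn_trans H1 _; rewrite conn_e1e0 //.
exact: conn_trans H H2.
Qed.

Section Fam.
Variables (P : comNzRingType) (xi : cnode M -> P).

Lemma nat_same al : natural (X2 c) (Y2 c) al al (xiU P) xi (fun _ => evm idfun xi).
Proof.
apply: (natural_hom (@XY2 M c) (phi := id) (psi := id)) => // [v|U l _|U l _].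
- by rewrite evm_xi.
- exact: link_id.
- exact: link_id.
Qed.

Lemma nat_slide : natural (X2 c) (Y2 c) e1 e0 (xiU P) xi
  (fun _ => evm idfun (fun v => xi (phiT c v))).
Proof.
apply: (natural_hom (@XY2 M c) (phi := phiT c) (psi := phiB c)) => //.
- by move=> v; rewrite evm_xi.
- exact: phiT_out.
- exact: phiB_out.
- exact: link_e1e0.
- exact: link_e0e1.
Qed.

Lemma nat_death_top : natural (X2 c) (Y2 c) ee e0 (xiU P) xi
  (fun _ => death xi (loopd c i) id).
Proof.
apply: (@natural_death M (X2 c) (Y2 c) (@XY2 M c) P xi (loopd c i) id (phiB c)) => //.
- by move=> v /andP [/eqP -> _]; rewrite inE.
- exact: phiB_out.
- rewrite /e0 /ee /loopd; case: i => U l; rewrite [_ \in _]inE [_ \in [:: _]]inE => /orP [] /eqP ->;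
  rewrite /link ?ovr2_0 ?(ovr2_1 hc) /=; do !split; conn_simp hc; conn_tac hc.
- by rewrite /e0 /ee; case: i; link2 hc.
Qed.

Lemma mu_ee0 U : mu xi (ovr (X2 c) ee U) c i = 1.
Proof.
have tg : togglable (ovr (X2 c) e1 U) c i by rewrite /togglable /e1 ovr2_0.
have E : ovr (X2 c) ee U = tog (ovr (X2 c) e1 U) c i.
  apply/ffunP => l; rewrite /tog /e1 ovr2_0 !ffunE !inE /ee /pat2 /=.
  by case: (eqVneq l c).
rewrite muE E conn_tog // (_ : conn _ _ _ = true) //.
by rewrite /e1; case: i; conn_tac hc.
Qed.

Lemma mu_ee1 U : mu xi (ovr (X2 c) ee U) c1 i = 1.
Proof.
have tg : togglable (ovr (X2 c) e0 U) c1 i by rewrite /togglable /e0 (ovr2_1 hc).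
have E : ovr (X2 c) ee U = tog (ovr (X2 c) e0 U) c1 i.
  apply/ffunP => l; rewrite /tog /e0 (ovr2_1 hc) !ffunE !inE /ee /pat2 /=.
  case: (eqVneq l c) => [->|_] /=; first by rewrite (ordS_neq' hc).
  by case: (eqVneq l c1).
rewrite muE E conn_tog // (_ : conn _ _ _ = true) //.
by rewrite /e0; case: i; conn_tac hc.
Qed.
End Fam.

(** State [j] of the longer twist receives state [(j, 0)] unchanged and state [(j-1, 1)]: by sliding
    its turnback if [j = 1], by the counit of its loop if [j > 1]. The new arrows of the twist
    complex come from evaluating the loop variable at its two neighbours, as [death_subst]
    describes. *)
Lemma twist_merge : Bound M R W -> Bound M R W'.
Proof.
move=> B P rho xi; have [Z1 S1] := Bound_univ rho B.
pose th0 := evm idfun xi : {rmorphism {mpoly P[#|{: cnode M}|]} -> P}.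
pose th1 := evm idfun (fun v => xi (phiT c v)) : {rmorphism {mpoly P[#|{: cnode M}|]} -> P}.
pose E := death xi (loopd c i) id.
pose f (a : nat) (U : diag M) p : P := match a with 0 => th0 p | 1 => th1 p | _ => E p end.
pose ov (a : nat) s := match a with 0 => st2 c s (s c) 0 | _ => st2 c s (s c).-1 1 end.
(* The first letter of the source stops at state [k], so the top state of the target has a single
   component. *)
pose J (s : state M) := (if (s c <= k)%N then [:: 0%N] else [::]) ++
  match s c with 0 => [::] | 1 => [:: 1%N] | _ => [:: 2%N] end.
have v0 s : vst W' s -> (s c <= k.+1)%N /\ s c1 = 0%N.
  by move=> vs; have := vs c; have := vs c1; rewrite W'c W'c1 /= leqn0 => /eqP ->.
have W1 s a b : dg W (st2 c s a b) = ovr (X2 c) (pat2 c (tl (Pos i) a) (tl (Pos i) b)) (dg W' s).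
  rewrite (dg_st2 hc) Wc Wc1 /tl /=; apply/ffunP => l; rewrite !ffunE;
  by case: ifPn => // nX; rewrite ?ffunE WW'.
have WU (s : state M) : s c1 = 0%N -> dg W' s = ovr (X2 c) (pat2 c (tl (Pos i) (s c)) None) (dg W' s).
  by move=> s1; rewrite -{1}(st2_id c s) (dg_st2 hc) W'c W'c1 s1.
have JP a (s : state M) : a \in J s -> [\/ a = 0%N /\ (s c <= k)%N, a = 1%N /\ s c = 1%N
    | a = 2%N /\ exists j, s c = j.+2].
  rewrite mem_cat => /orP []; first by case: ifP => // H; rewrite inE => /eqP ->; constructor 1.
  case Es: (s c) => [|[|j]] //; rewrite inE => /eqP ->; first by constructor 2.
  by constructor 3; split=> //; exists j.
exists (transferred W' J ov f Z1).
apply: (transfer (uX2 hc) (@XY2 M c) WW' S1 _ _ _ _ _ _ (cr := c)) => //.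
- move=> s l j; rewrite [_ \in _]inE [_ \in [:: _]]inE negb_or => /andP [l0 l1].
  by rewrite /J !ffunE eq_sym (negPf l0).
- move=> a s l j nX; have E0 : upd s l j c = s c.
    move: nX; rewrite [_ \in _]inE negb_or ffunE eq_sym => /andP [/negPf -> _] //.
  by case: a => [|a]; rewrite /ov E0 st2_upd.
- by move=> [|a] s l nX; rewrite /ov st2_out.
- move=> a s l vs aJ nX; have [s0 s1] := v0 s vs.
  case: (JP a s aJ) => [[-> _]|[-> Es]|[-> [j Es]]]; rewrite /ov sg_st2_out // ?s1 ?Es //.
  by rewrite addn0 addn1.
- move=> a s l vs aJ; have [s0 s1] := v0 s vs.
  rewrite [_ \in _]inE [_ \in [:: _]]inE => /orP [] /eqP ->;
  case: (JP a s aJ) => [[-> H]|[-> Es]|[-> [j Es]]]; rewrite /ov ?(st2_0 hc) ?st2_1 ?Wc ?Wc1 //= ?Es //.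
  by rewrite Es in s0.
- move=> a s vs aJ; have [s0 s1] := v0 s vs.
  have eb : {in X2 c, pat2 c (tl (Pos i) (s c)) None =1 dg W' s}.
    by move=> l lX; rewrite WU // ffunE lX.
  have ea x y : {in X2 c, pat2 c x y =1 ovr (X2 c) (pat2 c x y) (dg W' s)}.
    by move=> l lX; rewrite ffunE lX.
  case: (JP a s aJ) => [[-> H]|[-> Es]|[-> [j Es]]]; rewrite /ov W1;
    apply: natural_ext (ea _ _) eb _; rewrite ?Es /=.
  + exact: nat_same.
  + exact: nat_slide.
  + exact: nat_death_top.
move=> s vs; have [s0 s1] := v0 s vs.
set U := dg W' s; set T := transferred _ _ _ _ _.
pose Z a b := Z1 (st2 c s a b); pose z a := zW xi (loopd c i) id (Z a 1).
have TS j : T (st2 c s j.+1 0) = (if (j.+1 <= k)%N then th0 (Z j.+1 0%N) else 0)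
    + (if j is 0 then th1 (Z 0%N 1%N) else E (Z j 1%N)).
  rewrite /T /transferred big_cat /J (st2_0 hc) /=; congr (_ + _).
    by case: ifP => _; rewrite ?big_nil // big_seq1 /f /ov st2_st2 (st2_0 hc).
  by case: j => [|j]; rewrite big_seq1 /f /ov (st2_0 hc) /= st2_st2.
have DT j : \sum_(l <- X2 c) Dc xi W' T (st2 c s j 0) l = if (j < k.+1)%N then
   sg P s c * (if j is j'.+1 then xi (c, None) + (-1) ^+ j * xi (c1, None)
               else mu xi (ovr (X2 c) e0 U) c i) * T (st2 c s j.+1 0) else 0.
  rewrite !big_cons big_nil /Dc W'c W'c1 st2_1 (st2_0 hc) /= !addr0.
  case: ifP => // _; rewrite (sg_st2_0 hc) (st2_upd0 hc) /em W'c (st2_0 hc) /=.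
  by case: j => //; rewrite (st2_upd0 hc) (dg_st2 hc) W'c W'c1.
have D0 j : \sum_(l <- X2 c) Dc (xiU P) W Z1 (st2 c s j 0) l = (if (j < k)%N then
   sg _ s c * (if j is j'.+1 then xiU P (c, None) + (-1) ^+ j * xiU P (c1, None)
               else mu (xiU P) (ovr (X2 c) e0 U) c i) * Z j.+1 0%N else 0)
   + sg _ s c * (-1) ^+ j * (if j is j'.+1 then 1 else mu (xiU P) (ovr (X2 c) e1 U) c1 i) * Z j 1%N.
  rewrite !big_cons big_nil /Dc Wc Wc1 st2_1 (st2_0 hc) /= addr0 (sg_st2_1 hc) (sg_st2_0 hc) st2_upd1.
  congr (_ + _).
    case: ifP => // _; rewrite (st2_upd0 hc) /em Wc (st2_0 hc) /=.
    by case: j => //; rewrite (st2_upd0 hc) W1.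
  rewrite /em Wc1 st2_1 /= st2_upd1 W1; case: j => [//|j].
  by rewrite mu_ee1.
have D1 j : \sum_(l <- X2 c) Dc (xiU P) W Z1 (st2 c s j 1) l = (if (j < k)%N then
   sg _ s c * (if j is j'.+1 then xiU P (c, None) + (-1) ^+ j * xiU P (c1, None)
               else 1) * Z j.+1 1%N else 0).
  rewrite !big_cons big_nil /Dc Wc Wc1 st2_1 (st2_0 hc) /= !addr0 (sg_st2_0 hc).
  case: ifP => // _; rewrite (st2_upd0 hc) /em Wc (st2_0 hc) /=.
  by case: j => [|j] //; rewrite (st2_upd0 hc) W1 mu_ee0.
have psi0 (Q : comNzRingType) (x : cnode M -> Q) a b : (0 < a + b)%N -> psiv x (st2 c s a b) c = 0.
  rewrite /psiv; case: eqP => // Es; have := congr1 (fun t : state M => t c) Es.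
  have := congr1 (fun t : state M => t c1) Es; rewrite (st2_0 hc) st2_1 !ffunE.
  by move=> -> ->.
have Es : s = st2 c s (s c) 0 by rewrite -s1 st2_id.
have EU : U = ovr (X2 c) (pat2 c (tl (Pos i) (s c)) None) U by exact: WU.
have th0x v : th0 (xiU P v) = xi v by rewrite /th0 evm_xi.
have sub0 a : cid xi (ovr (X2 c) e0 U) (th0 (Z a 1%N) - ((z a)`_0 + xi (c1, None) * (z a)`_1)).
  apply: death_subst => v; case: ifPn => [|_]; last by rewrite subrr; apply: cideal0.
  case: v => l p /andP [/eqP /= -> ip]; apply: cid_conn.
  by rewrite /e0; case: i ip; case: p => [[]|] // _; conn_tac hc.
have sub1 a : cid xi (ovr (X2 c) e0 U) (th1 (Z a 1%N) - ((z a)`_0 + xi (c, None) * (z a)`_1)).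
  apply: death_subst => -[l p]; case: (eqVneq l c1) => [->|nl]; last first.
    by rewrite /loopd /phiT /= (negPf nl) /= subrr; apply: cideal0.
  case: ifPn; rewrite /loopd /phiT /= eqxx /= => ip; apply: cid_conn;
  by rewrite /e0; case: i ip; case: p => [[]|] // _; conn_tac hc.
have k1 : cid xi (ovr (X2 c) (pat2 c None None) U) (th1 (Z 0%N 1%N) - th0 (Z 0%N 1%N)).
  apply: evm_cid => -[l p]; rewrite /phiT /=; case: eqP => [->|_]; last by rewrite subrr; apply: cideal0.
  by apply: cid_conn; case: p => [[]|]; conn_tac hc.
have thsg a : th0 (sg _ s c * a) = sg P s c * th0 a by rewrite rmorphM rmorph_sign.
have th1sg a : th1 (sg _ s c * a) = sg P s c * th1 a by rewrite rmorphM rmorph_sign.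
have EZ a : E (Z a 1%N) = (z a)`_1 by [].
have nE := nat_death_top xi.
have E0 : E 0 = 0 by exact: (nat0 nE U).
have E2 a m : E (sg _ s c * (xiU P (c, None) + (-1) ^+ m * xiU P (c1, None)) * Z a 1%N)
    = sg P s c * (xi (c, None) * (z a)`_1 + (-1) ^+ m * (z a)`_0).
  have sgE p : E ((-1) ^+ m * p) = (-1) ^+ m * E p by exact: (nat_sign nE U).
  have sE p : E (sg _ s c * p) = sg P s c * E p by exact: (nat_sign nE U).
  have DE p q : E (p + q) = E p + E q by exact: (natD nE U).
  rewrite -mulrA sE mulrDl DE -mulrA sgE; congr (_ * (_ + _ * _)).
    have nt : ((c, None) : cnode M).1 \notin Y2 c by rewrite /Y2 inE /= (ordS_neq' hc).
    exact: (nat_lin nE U _ nt).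
  by rewrite /E /death zWM zW_in ?coefXM // /loopd /= eqxx.
have thlin m p : th0 (sg _ s c * (xiU P (c, None) + (-1) ^+ m * xiU P (c1, None)) * p)
    = sg P s c * (xi (c, None) + (-1) ^+ m * xi (c1, None)) * th0 p.
  by rewrite -!mulrA thsg rmorphM rmorphD [th0 (_ ^+ m * _)]rmorphM rmorph_sign !th0x.
have thsgn m p : th0 (sg _ s c * (-1) ^+ m * p) = sg P s c * (-1) ^+ m * th0 p.
  by rewrite -!mulrA thsg rmorphM rmorph_sign.
clearbody th0 th1 E.
have DTs := DT (s c); have ps0 := psi0 P xi (s c) 0%N; rewrite -Es in DTs ps0.
rewrite DTs /J /ov; case Ej: (s c) EU ps0 => [|[|j]] EU ps0.
- rewrite leq0n cats0 !big_seq1 D0 /= TS expr0 !mulr1.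
  have -> : th0 (psiv (xiU P) (st2 c s 0 0) c) = psiv xi s c.
    have -> : st2 c s 0 0 = s by move: Es; rewrite Ej => <-.
    rewrite /psiv; case: eqP => _; last exact: rmorph0.
    by rewrite !rmorphM !th0x.
  have muth V l : th0 (mu (xiU P) V l i) = mu xi V l i by apply: rmorph_mu.
  have k2 : cid xi U (mu xi (ovr (X2 c) e0 U) c i - mu xi (ovr (X2 c) e1 U) c1 i).
    rewrite !muE conn_slide; case: ifP => _; last by rewrite subrr; apply: cideal0.
    by rewrite opprD addrACA EU; apply: cidealD; apply: cid_conn; case: i; conn_tac hc.
  rewrite subrr addr0 rmorphD -!mulrA !thsg !rmorphM !muth.
  have -> : th0 (if (0 < k)%N then sg _ s c * (mu (xiU P) (ovr (X2 c) e0 U) c i * Z 1%N 0%N) else 0)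
     = sg P s c * (mu xi (ovr (X2 c) e0 U) c i * (if (0 < k)%N then th0 (Z 1%N 0%N) else 0)).
    by case: ifP => _; rewrite ?mulr0 ?rmorph0 // thsg rmorphM muth.
  set m0 := mu _ _ _ _; set m1 := mu _ _ _ _; set A := th1 _; set B0 := th0 (Z 0%N _).
  rewrite [X in cid _ _ X](_ : _ = sg P s c * m0 * (A - B0) + sg P s c * B0 * (m0 - m1)); last by ring.
  by apply: cidealD; apply: cidealM => //; rewrite EU.
- case: (posnP k) => [k0|kp].
    rewrite k0 /= !big_seq1 /f D1 k0 /= rmorph0 psi0 // rmorph0 (ps0 isT) !subr0 addr0.
    exact: cideal0.
  rewrite ltnS kp !big_cat !big_seq1 /f D0 D1 kp !psi0 // !rmorph0 (ps0 isT) TS EZ /= !mulr1 expr1.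
  (* Evaluating the loop at [c] or at [c1] differs by [x_c - x_c1] times the counit: this is the
     first arrow between copies of the turnback. *)
  have := cidealM (sg P s c) (cidealB (sub0 1%N) (sub1 1%N)); rewrite -[ovr _ _ _]EU.
  have -> : th0 ((if (1 < k)%N then sg _ s c * (xiU P (c, None) + -1 * xiU P (c1, None)) * Z 2%N 0%N
     else 0) + sg _ s c * (-1) * Z 1%N 1%N) =
     sg P s c * (xi (c, None) - xi (c1, None)) * (if (1 < k)%N then th0 (Z 2%N 0%N) else 0)
     - sg P s c * th0 (Z 1%N 1%N).
    rewrite rmorphD; congr (_ + _).
      by case: ifP => _; rewrite ?mulr0 ?rmorph0 // -!mulrA thsg mulN1r rmorphM rmorphB !th0x.
    by rewrite -mulrA thsg mulN1r rmorphN mulrN.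
  rewrite th1sg; set A := (X in cideal _ _ X); set B' := (X in cid _ _ X).
  suff -> : B' = A by []; rewrite /A /B'.
  move: (th0 (Z 1%N 1%N)) (th1 (Z 1%N 1%N)) (if (1 < k)%N then _ else _) (sg P s c) => a0 a1 t e.
  by ring.
- have jk : (j.+2 <= k.+1)%N by rewrite -Ej.
  case: (ltnP j.+1 k) => jk'; last first.
    have -> : (j.+2 < k.+1)%N = false by apply/negbTE; rewrite -leqNgt.
    rewrite /= !big_seq1 /f D1 ltnNge jk' /= E0 psi0 // E0 (ps0 isT) !subr0 addr0.
    exact: cideal0.
  rewrite ltnS jk' !big_cat !big_seq1 /f D0 D1 jk' !psi0 // !rmorph0 E0 (ps0 isT) TS EZ E2 /= !mulr1.
  have := cidealM (- sg P s c * (-1) ^+ j) (sub0 j.+2); rewrite -[ovr _ _ _]EU.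
  have -> : th0 ((if (j.+2 < k)%N then sg _ s c * (xiU P (c, None) + (-1) ^+ j.+2 * xiU P (c1, None)) * Z j.+3 0%N
     else 0) + sg _ s c * (-1) ^+ j.+2 * Z j.+2 1%N) =
     sg P s c * (xi (c, None) + (-1) ^+ j.+2 * xi (c1, None)) * (if (j.+2 < k)%N then th0 (Z j.+3 0%N) else 0)
     + sg P s c * (-1) ^+ j.+2 * th0 (Z j.+2 1%N).
    rewrite rmorphD; congr (_ + _).
      by case: ifP => _; rewrite ?mulr0 ?rmorph0 // thlin.
    by rewrite thsgn.
  set A := (X in cideal _ _ X); set B' := (X in cid _ _ X).
  suff -> : B' = A by []; rewrite /A /B' !exprS.
  move: (th0 (Z j.+2 1%N)) (if (j.+2 < k)%N then _ else _) (sg P s c) => a0 t e.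
  by ring.
Qed.
End TwistMerge.

(** * Third Reidemeister move *)

Section Triple.
Variables (M : nat) (c : 'I_M).
Hypothesis hc : (c.+2 < M)%N.
Notation c1 := (ordS c).
Notation c2 := (ordS (ordS c)).
Notation c3 := (ordS (ordS (ordS c))).

Let hc1 : (c.+1 < M)%N. Proof. exact: ltnW. Qed.

Lemma val_ordSS : c2 = c.+2 :> nat.
Proof. by rewrite /= [(c.+1 %% M)%N]modn_small ?modn_small. Qed.

Lemma neq10 : (c1 == c) = false. Proof. exact: ordS_neq. Qed.
Lemma neq01 : (c == c1) = false. Proof. exact: ordS_neq'. Qed.
Lemma neq20 : (c2 == c) = false.
Proof. by rewrite -(inj_eq (@ord_inj M)) val_ordSS; apply/negbTE/eqP; lia. Qed.
Lemma neq02 : (c == c2) = false. Proof. by rewrite eq_sym neq20. Qed.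
Lemma neq21 : (c2 == c1) = false. Proof. exact: ordSS_neq. Qed.
Lemma neq12 : (c1 == c2) = false. Proof. by rewrite eq_sym neq21. Qed.
Lemma neq31 : (c3 == c1) = false.
Proof. by rewrite (inj_eq (can_inj (@ordSK M))) neq20. Qed.
Lemma neq32 : (c3 == c2) = false.
Proof. by rewrite (inj_eq (can_inj (@ordSK M))) neq21. Qed.
Definition neq3 := (neq10, neq01, neq20, neq02, neq21, neq12, neq31, neq32).

Definition X3 := [:: c; c1; c2].
Definition Y3 := [:: c1; c2].

Lemma uX3 : uniq X3.
Proof. by rewrite /= !inE !neq3. Qed.

Lemma XY3 k : k \notin X3 -> k \notin Y3 /\ ordS k \notin Y3.
Proof.
rewrite /X3 /Y3 !inE !negb_or => /and3P [k0 k1 k2].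
by rewrite !(inj_eq (can_inj (@ordSK M))) k0 k1 k2.
Qed.

Definition pat3 (x y z : option bool) : 'I_M -> option bool :=
  fun k => if k == c then x else if k == c1 then y else z.

Lemma ovr3_0 x y z U : ovr X3 (pat3 x y z) U c = x.
Proof. by rewrite ffunE /pat3 inE eqxx. Qed.
Lemma ovr3_1 x y z U : ovr X3 (pat3 x y z) U c1 = y.
Proof. by rewrite ffunE /pat3 !inE eqxx orbT neq10. Qed.
Lemma ovr3_2 x y z U : ovr X3 (pat3 x y z) U c2 = z.
Proof. by rewrite ffunE /pat3 !inE eqxx !orbT neq20 neq21. Qed.

(** State [xyz] of three letters with sides [l], [~~ l], [l]. *)
Definition pt (l x y z : bool) := pat3 (if x then Some l else None)
  (if y then Some (~~ l) else None) (if z then Some l else None).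

(* Where the arc of [pt l x y z] through an inner node leaves the three levels. *)
Definition ph (l x y z : bool) (v : cnode M) : cnode M :=
  if v.1 == c1 then
    if x then if y then (c, Some (~~ l)) else if z then (c, v.2) else (c3, v.2)
    else (c, v.2)
  else if v.1 == c2 then
    if z then if y then (c3, Some (~~ l)) else (c, v.2) else (c3, v.2)
  else v.

Lemma ph_out l x y z v : v.1 \notin Y3 -> ph l x y z v = v.
Proof. by rewrite !inE negb_or /ph => /andP [/negPf -> /negPf ->]. Qed.

Lemma ph_notin l x y z v : (ph l x y z v).1 \notin Y3.
Proof.
rewrite /ph !inE; case: (eqVneq v.1 c1) => [_|n1].
  by case: x; case: y; case: z; rewrite /= !neq3.
case: (eqVneq v.1 c2) => [_|n2]; first by case: x; case: y; case: z; rewrite /= !neq3.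
by rewrite negb_or n1.
Qed.

Lemma ph_ph l x y z l' x' y' z' v : ph l x y z (ph l' x' y' z' v) = ph l' x' y' z' v.
Proof. exact/ph_out/ph_notin. Qed.

Definition st3 (s : state M) x y z : state M := upd (upd (upd s c x) c1 y) c2 z.

Lemma st3_0 s x y z : st3 s x y z c = x.
Proof. by rewrite !ffunE !neq3 eqxx. Qed.
Lemma st3_1 s x y z : st3 s x y z c1 = y.
Proof. by rewrite !ffunE !neq3 eqxx. Qed.
Lemma st3_2 s x y z : st3 s x y z c2 = z.
Proof. by rewrite !ffunE eqxx. Qed.
Lemma st3_out s x y z k : k \notin X3 -> st3 s x y z k = s k.
Proof. by rewrite !inE !negb_or !ffunE => /and3P [/negPf -> /negPf -> /negPf ->]. Qed.
Lemma st3_upd s x y z k j : k \notin X3 -> st3 (upd s k j) x y z = upd (st3 s x y z) k j.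
Proof.
rewrite !inE !negb_or => /and3P [n0 n1 n2]; apply/ffunP => l; rewrite !ffunE.
case: (eqVneq l c2) => [->|_]; first by rewrite (eq_sym _ k) (negPf n2).
case: (eqVneq l c1) => [->|_]; first by rewrite (eq_sym _ k) (negPf n1).
by case: (eqVneq l c) => [->|_]; first by rewrite (eq_sym _ k) (negPf n0).
Qed.
Lemma st3_upd0 s x y z x' : upd (st3 s x y z) c x' = st3 s x' y z.
Proof.
by apply/ffunP => l; rewrite !ffunE; case: (eqVneq l c) => [->|//]; rewrite !neq3.
Qed.
Lemma st3_upd1 s x y z y' : upd (st3 s x y z) c1 y' = st3 s x y' z.
Proof.
by apply/ffunP => l; rewrite !ffunE; case: (eqVneq l c1) => [->|//]; rewrite !neq3.
Qed.
Lemma st3_upd2 s x y z z' : upd (st3 s x y z) c2 z' = st3 s x y z'.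
Proof. by apply/ffunP => l; rewrite !ffunE; case: eqP. Qed.
Lemma st3_id s : st3 s (s c) (s c1) (s c2) = s.
Proof.
apply/ffunP => l; rewrite !ffunE; case: (eqVneq l c2) => [->//|_].
by case: (eqVneq l c1) => [->//|_]; case: eqP => // ->.
Qed.
Lemma st3_st3 s x y z x' y' z' : st3 (st3 s x y z) x' y' z' = st3 s x' y' z'.
Proof. by apply/ffunP => l; rewrite !ffunE; do 3 case: eqP => //. Qed.

Lemma dg_st3 W s x y z : dg W (st3 s x y z) =
  ovr X3 (pat3 (tl (W c) x) (tl (W c1) y) (tl (W c2) z)) (dg W s).
Proof.
apply/ffunP => l; rewrite !ffunE !inE /pat3.
case: (eqVneq l c2) => [->|_]; first by rewrite !neq3.
by case: (eqVneq l c1) => [->|_]; rewrite ?neq3 //; case: (eqVneq l c) => [->|].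
Qed.

Section Sg.
Variable P : comNzRingType.

Lemma sg_st3_0 s x y z : sg P (st3 s x y z) c = sg P s c.
Proof.
rewrite /sg; congr (_ ^+ _); apply: eq_bigr => k kc; rewrite !ffunE.
by do ?[case: eqP => [E|_]; first by move: kc; rewrite E ?val_ordSS ?val_ordS; lia].
Qed.

Lemma sg_st3_1 s x y z : sg P (st3 s x y z) c1 = sg P s c * (-1) ^+ x.
Proof.
rewrite /sg (val_ordS hc1) (bigD1 c) //=.
rewrite st3_0 -exprD addnC; congr (_ ^+ (_ + _)).
apply: eq_big => k; first by rewrite -(inj_eq (@ord_inj M)); lia.
move=> /andP [k1 k0]; rewrite !ffunE (negPf k0).
by do ?[case: eqP => [E|_]; first by move: k1; rewrite E ?val_ordSS ?val_ordS; lia].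
Qed.

Lemma sg_st3_2 s x y z : sg P (st3 s x y z) c2 = sg P s c * (-1) ^+ (x + y).
Proof.
rewrite /sg val_ordSS (bigD1 c) //=.
rewrite (bigD1 c1); last by rewrite neq10 (val_ordS hc1) ltnSn.
rewrite /= st3_0 st3_1 -exprD addnA addnC; congr (_ ^+ (_ + _)).
apply: eq_big => k; first by rewrite -!(inj_eq (@ord_inj M)) (val_ordS hc1); lia.
move=> /andP [/andP [k2 k0] k1]; rewrite !ffunE (negPf k0) (negPf k1).
by case: eqP => [E|_] //; move: k2; rewrite E val_ordSS; lia.
Qed.

Lemma sg_st3_out (s : state M) x y z k : k \notin X3 ->
  odd (x + y + z) = odd (s c + s c1 + s c2) -> sg P (st3 s x y z) k = sg P s k.
Proof.
move=> kX od; have : [&& (k != c :> nat), (k != c.+1 :> nat) & (k != c.+2 :> nat)].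
  by move: kX; rewrite !inE !negb_or -!(inj_eq (@ord_inj M)) val_ordSS (val_ordS hc1).
move=> /and3P [k0 k1 k2]; rewrite /sg; case: (ltnP k c) => kc.
  congr (_ ^+ _); apply: eq_bigr => l lk; rewrite !ffunE.
  by do ?[case: eqP => [E|_]; first by move: lk; rewrite E ?val_ordSS ?val_ordS; lia].
have spl (t : state M) : (\sum_(l < M | (l < k)%N) t l = t c + t c1 + t c2 +
    \sum_(l < M | (l < k)%N && (l != c) && (l != c1) && (l != c2)) t l)%N.
  rewrite (bigD1 c) /=; last by lia.
  rewrite (bigD1 c1); last by rewrite neq10 (val_ordS hc1) andbT; lia.
  rewrite (bigD1 c2); first by rewrite /= !addnA.
  by rewrite neq20 neq21 val_ordSS !andbT; lia.
rewrite -signr_odd -[RHS]signr_odd (spl s) (spl (st3 s x y z)) st3_0 st3_1 st3_2.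
rewrite (eq_bigr (fun l => s l)) => [|l /andP [/andP [/andP [_ l0] l1] l2]].
  by rewrite oddD od -oddD.
by rewrite !ffunE (negPf l0) (negPf l1) (negPf l2).
Qed.
End Sg.
End Triple.

Ltac conn_simp3 hc :=
  rewrite /ph /= ?eqxx ?(neq10 hc) ?(neq01 hc) ?(neq20 hc) ?(neq02 hc) ?(neq21 hc)
     ?(neq12 hc) ?(neq31 hc) ?(neq32 hc) //=.
Ltac conn_walk3 hc n :=
  lazymatch n with
  | O => fail
  | S ?m => first [ exact: conn_refl
    | apply: conn_nxt; rewrite /nxt ?ordSK ?ovr3_0 ?(ovr3_1 hc) ?(ovr3_2 hc) //=; conn_walk3 hc m ]
  end.
Ltac conn_tac3 hc := solve [conn_walk3 hc 10%nat | rewrite conn_sym; conn_walk3 hc 10%nat].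
Ltac link3 hc :=
  let U := fresh "U" in let k := fresh "k" in
  move=> U k; rewrite [_ \in _]inE [_ \in [:: _; _]]inE [_ \in [:: _]]inE => /or3P [] /eqP ->;
  rewrite /link ?ovr3_0 ?(ovr3_1 hc) ?(ovr3_2 hc) /=; split; conn_simp3 hc; conn_tac3 hc.

Section Iso.
Variables (M : nat) (c : 'I_M).
Hypothesis hc : (c.+2 < M)%N.
Notation X := (X3 c).
Notation Y := (Y3 c).

(** Pairs of states of the two words with isotopic diagrams. The state 010 of one word matches both
    100 and 001 of the other; the loop state 101 and the state 111 do not occur. *)
Definition isop (x y z x' y' z' : bool) := (x, y, z, (x', y', z')) \in
  [:: (false, false, false, (false, false, false)); (true, false, false, (false, true, false));
      (false, true, false, (true, false, false)); (false, true, false, (false, false, true));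
      (false, false, true, (false, true, false));
      (true, true, false, (false, true, true)); (false, true, true, (true, true, false))].

Lemma iso_link l x y z x' y' z' : isop x y z x' y' z' -> forall U k, k \in X ->
  link (ovr X (pt c l x y z) U)
    (fun v w => conn (ovr X (pt c (~~ l) x' y' z') U) (ph c l x y z v) (ph c l x y z w)) k.
Proof.
by move: x y z x' y' z' => [] [] [] [] [] [] // _; rewrite /pt; case: l; link3 hc.
Qed.

Lemma iso_link' l x y z x' y' z' : isop x y z x' y' z' -> forall U k, k \in X ->
  link (ovr X (pt c (~~ l) x' y' z') U)
    (fun v w => conn (ovr X (pt c l x y z) U) (ph c (~~ l) x' y' z' v) (ph c (~~ l) x' y' z' w)) k.
Proof.
by move: x y z x' y' z' => [] [] [] [] [] [] // _; rewrite /pt; case: l; link3 hc.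
Qed.
End Iso.

Lemma evm_eq (M : nat) (P Q : comNzRingType) (h : {rmorphism P -> Q}) (z1 z2 : cnode M -> Q) p :
  z1 =1 z2 -> evm h z1 p = evm h z2 p.
Proof.
move=> E; apply: (evm_comp (g := idfun) (h := h) (h' := h)) => //.
Qed.

Section EdgeMatch.
Variables (M : nat) (X Y : seq 'I_M) (P : comNzRingType) (F : cnode M -> P).
Variables (al al' be be' : 'I_M -> option bool) (phi phi' : cnode M -> cnode M).
Variables (k k' : 'I_M) (l : bool) (U : diag M).
Let a : cnode M := (k, Some l). Let b : cnode M := (ordS k, None).
Let a' : cnode M := (k', Some l). Let b' : cnode M := (ordS k', None).

(** The square formed by a saddle at [k] in the source and its counterpart at [k'] in the target.
    Both are of the same kind since [phi] preserves connectivity, and their factors agree since the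
    end nodes only move along their own circles. *)
Lemma edge_match A :
  (forall v, phi' (phi v) = phi v) -> (forall v, conn (ovr X al U) v (phi v)) ->
  togglable (ovr X al U) k l -> ovr X al' U = tog (ovr X al U) k l ->
  conn (ovr X al U) (phi a) (phi b) = conn (ovr X be U) (phi a) (phi b) ->
  conn (ovr X be U) (phi a) a' -> conn (ovr X be U) (phi b) b' ->
  natural X Y al' be' (fun v => F (phi' v)) F (fun _ => idfun) ->
  conn (ovr X be' U) (phi' a) a' -> conn (ovr X be' U) (phi' b) b' ->
  cid F (ovr X be' U) (mu F (ovr X be U) k' l * evm idfun (fun v => F (phi v)) A
    - evm idfun (fun v => F (phi' v)) (mu (xiU P) (ovr X al U) k l * A)).
Proof.
move=> pp own tg Etg Ec ca cb nF ca' cb'; pose ze v := F (phi' v).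
have cE : conn (ovr X al U) a b = conn (ovr X be U) a' b'.
  have E1 : conn (ovr X al U) a b = conn (ovr X al U) (phi a) (phi b).
    have oa := own a; have ob := own b; apply/idP/idP => H.
      by apply: conn_trans (conn_trans _ H) ob; rewrite conn_sym.
    by apply: conn_trans (conn_trans oa H) _; rewrite conn_sym.
  rewrite E1 Ec; apply/idP/idP => H.
    by apply: conn_trans (conn_trans _ H) cb; rewrite conn_sym.
  by apply: conn_trans (conn_trans ca H) _; rewrite conn_sym.
rewrite rmorphM (rmorph_mu (xi := ze)); last by move=> v; rewrite evm_xi.
have H1 : cid F (ovr X be' U) (mu ze (ovr X al U) k l * (evm idfun (fun v => F (phi v)) A - evm idfun ze A)).
  apply: (nat_cid nF); rewrite Etg; apply: mu_cid => //; apply: evm_cid => v.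
  by rewrite -pp -/(ze _); apply: cid_conn; rewrite conn_sym.
have H2 : cid F (ovr X be' U) (mu F (ovr X be U) k' l - mu ze (ovr X al U) k l).
  rewrite !muE -/a' -/b' -/a -/b -cE; case: ifP => _; last by rewrite subrr; apply: cideal0.
  rewrite opprD addrACA; apply: cidealD; apply: cideal_sym; exact: cid_conn.
have := cidealD H1 (cidealM (evm idfun (fun v => F (phi v)) A) H2).
set e := (X in cideal _ _ X); set g := (X in cid _ _ X); suff -> : g = e by [].
by rewrite /e /g; move: (evm _ _ A) (evm _ _ A) => p q; ring.
Qed.
End EdgeMatch.

Section R3.
Variables (M : nat) (c : 'I_M).
Hypothesis hc : (c.+2 < M)%N.
Notation c1 := (ordS c).
Notation c2 := (ordS (ordS c)).
Notation c3 := (ordS (ordS (ordS c))).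
Notation X := (X3 c).
Notation Y := (Y3 c).
Notation "0b" := false. Notation "1b" := true.

Lemma tog3_0 x x' y z U l : (x == None) || (x == Some l) ->
  x' = (if x == Some l then None else Some l) ->
  ovr X (pat3 c x' y z) U = tog (ovr X (pat3 c x y z) U) c l.
Proof.
move=> _ ->; apply/ffunP => m; rewrite /tog ovr3_0 !ffunE !inE /pat3.
by case: (eqVneq m c).
Qed.
Lemma tog3_1 x y y' z U l : (y == None) || (y == Some l) ->
  y' = (if y == Some l then None else Some l) ->
  ovr X (pat3 c x y' z) U = tog (ovr X (pat3 c x y z) U) c1 l.
Proof.
move=> _ ->; apply/ffunP => m; rewrite /tog (ovr3_1 hc) !ffunE !inE /pat3.
by case: (eqVneq m c1) => [->|_]; rewrite ?(neq10 hc) ?eqxx ?orbT.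
Qed.
Lemma tog3_2 x y z z' U l : (z == None) || (z == Some l) ->
  z' = (if z == Some l then None else Some l) ->
  ovr X (pat3 c x y z') U = tog (ovr X (pat3 c x y z) U) c2 l.
Proof.
move=> _ ->; apply/ffunP => m; rewrite /tog (ovr3_2 hc) !ffunE !inE /pat3.
case: (eqVneq m c2) => [->|_]; rewrite ?(neq20 hc) ?(neq21 hc) ?eqxx ?orbT /= ?orbF //.
by case: (eqVneq m c) => // _; case: (eqVneq m c1).
Qed.

Variable i : bool.
Notation src := (pt c i).
Notation tgt := (pt c (~~ i)).
Notation phs := (ph c i).
Notation pht := (ph c (~~ i)).

Section Frame.
Variables (P : comNzRingType) (F : cnode M -> P).
Definition th x y z : {rmorphism {mpoly P[#|{: cnode M}|]} -> P} :=
  evm idfun (fun v => F (phs x y z v)).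

Lemma nat_th x y z x' y' z' : isop x y z x' y' z' ->
  natural X Y (src x y z) (tgt x' y' z') (xiU P) F (fun _ => th x y z).
Proof.
move=> ip; apply: (natural_hom (@XY3 M c) (phi := phs x y z) (psi := pht x' y' z')).
- by move=> v; rewrite /th evm_xi.
- exact: ph_out.
- exact: ph_out.
- exact: iso_link.
- exact: iso_link'.
Qed.

Lemma nat_frame x y z x' y' z' : isop x y z x' y' z' ->
  natural X Y (src x y z) (tgt x' y' z') (fun v => F (phs x y z v)) F (fun _ => idfun).
Proof.
move=> ip; apply: (natural_hom (@XY3 M c) (phi := phs x y z) (psi := pht x' y' z')) => //.
- exact: ph_out.
- exact: ph_out.
- exact: iso_link.
- exact: iso_link'.
Qed.

Lemma conn_own U x y z v : ~~ (x && z) -> conn (ovr X (src x y z) U) v (phs x y z v).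
Proof.
case: v => k p; case: (eqVneq k c1) => [->|n1].
  by move: x y z => [] [] [] // _; rewrite /pt; case: i; case: p => [[]|];
  conn_simp3 hc; conn_tac3 hc.
case: (eqVneq k c2) => [->|n2].
  by move: x y z => [] [] [] // _; rewrite /pt; case: i; case: p => [[]|];
  conn_simp3 hc; conn_tac3 hc.
by rewrite ph_out ?conn_refl // !inE negb_or n1.
Qed.

Lemma conn_iso U x y z x' y' z' v w : isop x y z x' y' z' ->
  conn (ovr X (src x y z) U) (phs x y z v) (phs x y z w) =
  conn (ovr X (tgt x' y' z') U) (phs x y z v) (phs x y z w).
Proof.
move=> ip; have out u : (phs x y z u).1 \notin Y by apply: ph_notin.
apply: (conn_ovr (@XY3 M c) (phi := phs x y z) (psi := pht x' y' z')) => //.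
- exact: ph_out.
- exact: ph_out.
- by move=> k kX; apply: iso_link.
- by move=> k kX; apply: iso_link'.
Qed.

Ltac edge3 t :=
  apply: (edge_match (Y := Y) (al' := t));
  [ by move=> v; apply: ph_ph | by move=> v; apply: conn_own
  | by rewrite /togglable /pt ?ovr3_0 ?(ovr3_1 hc) ?(ovr3_2 hc)
  | by rewrite /pt; first [exact: tog3_0 | exact: tog3_1 | exact: tog3_2]
  | by apply: conn_iso
  | by rewrite /pt; case: i; conn_simp3 hc; conn_tac3 hc
  | by rewrite /pt; case: i; conn_simp3 hc; conn_tac3 hc
  | by apply: nat_frame
  | by rewrite /pt; case: i; conn_simp3 hc; conn_tac3 hc
  | by rewrite /pt; case: i; conn_simp3 hc; conn_tac3 hc ].

(** In the names of these squares the digits are states of the source. The edge from 000 to 010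
    occurs twice because 010 is sent to both 100 and 001. *)
Lemma edge_000_100 U A : cid F (ovr X (tgt 0b 1b 0b) U)
  (mu F (ovr X (tgt 0b 0b 0b) U) c1 i * th 0b 0b 0b A
   - th 1b 0b 0b (mu (xiU P) (ovr X (src 0b 0b 0b) U) c i * A)).
Proof. edge3 (src 1b 0b 0b). Qed.
Lemma edge_000_010 U A : cid F (ovr X (tgt 1b 0b 0b) U)
  (mu F (ovr X (tgt 0b 0b 0b) U) c (~~ i) * th 0b 0b 0b A
   - th 0b 1b 0b (mu (xiU P) (ovr X (src 0b 0b 0b) U) c1 (~~ i) * A)).
Proof. edge3 (src 0b 1b 0b). Qed.
Lemma edge_000_010' U A : cid F (ovr X (tgt 0b 0b 1b) U)
  (mu F (ovr X (tgt 0b 0b 0b) U) c2 (~~ i) * th 0b 0b 0b A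
   - th 0b 1b 0b (mu (xiU P) (ovr X (src 0b 0b 0b) U) c1 (~~ i) * A)).
Proof. edge3 (src 0b 1b 0b). Qed.
Lemma edge_010_110 U A : cid F (ovr X (tgt 0b 1b 1b) U)
  (mu F (ovr X (tgt 0b 0b 1b) U) c1 i * th 0b 1b 0b A
   - th 1b 1b 0b (mu (xiU P) (ovr X (src 0b 1b 0b) U) c i * A)).
Proof. edge3 (src 1b 1b 0b). Qed.
Lemma edge_100_110 U A : cid F (ovr X (tgt 0b 1b 1b) U)
  (mu F (ovr X (tgt 0b 1b 0b) U) c2 (~~ i) * th 1b 0b 0b A
   - th 1b 1b 0b (mu (xiU P) (ovr X (src 1b 0b 0b) U) c1 (~~ i) * A)).
Proof. edge3 (src 1b 1b 0b). Qed.
Lemma edge_010_011 U A : cid F (ovr X (tgt 1b 1b 0b) U)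
  (mu F (ovr X (tgt 1b 0b 0b) U) c1 i * th 0b 1b 0b A
   - th 0b 1b 1b (mu (xiU P) (ovr X (src 0b 1b 0b) U) c2 i * A)).
Proof. edge3 (src 0b 1b 1b). Qed.
Lemma edge_001_011 U A : cid F (ovr X (tgt 1b 1b 0b) U)
  (mu F (ovr X (tgt 0b 1b 0b) U) c (~~ i) * th 0b 0b 1b A
   - th 0b 1b 1b (mu (xiU P) (ovr X (src 0b 0b 1b) U) c1 (~~ i) * A)).
Proof. edge3 (src 0b 1b 1b). Qed.

Definition loop3 (v : cnode M) := (v.1 \in Y) && (v.2 != Some (~~ i)).
Definition dth := death F loop3 (phs 1b 0b 1b).

Lemma nat_death3 : natural X Y (src 1b 0b 1b) (tgt 0b 1b 0b) (xiU P) F (fun _ => dth).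
Proof.
apply: (@natural_death M X Y (@XY3 M c) P F loop3 (phs 1b 0b 1b) (pht 0b 1b 0b)) => //.
- by move=> v /andP [].
- exact: ph_out.
- exact: ph_out.
- rewrite /pt /loop3; case: i => U k;
  rewrite [_ \in _]inE [_ \in [:: _; _]]inE [_ \in [:: _]]inE => /or3P [] /eqP ->;
  rewrite /link ?ovr3_0 ?(ovr3_1 hc) ?(ovr3_2 hc) /=; do !split; rewrite ?inE; conn_simp3 hc; conn_tac3 hc.
- by rewrite /pt; case: i; link3 hc.
Qed.

(** The saddle at [c] splits off the loop, and the counit after a split is the identity, up to
    pushing interior nodes outwards. *)
Lemma death_001 U A : cid F (ovr X (tgt 0b 1b 0b) U)
  (th 0b 0b 1b A - dth (mu (xiU P) (ovr X (src 0b 0b 1b) U) c i * A)).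
Proof.
have Ec : conn (ovr X (src 0b 0b 1b) U) (c, Some i) (c1, None).
  by rewrite /pt; case: i; conn_tac3 hc.
rewrite muE Ec /dth /death zWM zWD zW_out; last by rewrite /loop3 !inE /= !(neq3 hc).
rewrite zW_in; last by rewrite /loop3 !inE /= eqxx.
rewrite mulrDl coefD coefCM coefXM /= [X in _ - X]addrC ph_out ?inE /= ?(neq3 hc) //.
apply: (@death_subst _ _ F loop3 (phs 1b 0b 1b) _ _ A (fun v => F (phs 0b 0b 1b v))) => -[k p]; case: ifPn => [/andP [/= kY ip]|nW].
  apply: cid_conn; move: kY; rewrite !inE /pt => /orP [] /eqP ->;
  by case: i ip; case: p => [[]|] // _; conn_simp3 hc; conn_tac3 hc.
have [kY|kY] := boolP (k \in Y); last by rewrite !ph_out // subrr; apply: cideal0.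
move: nW; rewrite /loop3 /= kY /= negbK => /eqP ->; apply: cid_conn.
by move: kY; rewrite !inE /pt => /orP [] /eqP ->; case: i; conn_simp3 hc; conn_tac3 hc.
Qed.

Lemma death_100 U A : cid F (ovr X (tgt 0b 1b 0b) U)
  (th 1b 0b 0b A - dth (mu (xiU P) (ovr X (src 1b 0b 0b) U) c2 i * A)).
Proof.
have Ec : conn (ovr X (src 1b 0b 0b) U) (c2, Some i) (c3, None).
  by rewrite /pt; case: i; conn_tac3 hc.
rewrite muE Ec /dth /death zWM zWD zW_in; last by rewrite /loop3 !inE /= !(neq3 hc) eqxx; case: i.
rewrite zW_out; last by rewrite /loop3 !inE /= !(neq3 hc).
rewrite mulrDl coefD coefCM coefXM /= ph_out ?inE /= ?(neq3 hc) //.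
apply: (@death_subst _ _ F loop3 (phs 1b 0b 1b) _ _ A (fun v => F (phs 1b 0b 0b v))) => -[k p]; case: ifPn => [/andP [/= kY ip]|nW].
  apply: cid_conn; move: kY; rewrite !inE /pt => /orP [] /eqP ->;
  by case: i ip; case: p => [[]|] // _; conn_simp3 hc; conn_tac3 hc.
have [kY|kY] := boolP (k \in Y); last by rewrite !ph_out // subrr; apply: cideal0.
move: nW; rewrite /loop3 /= kY /= negbK => /eqP ->; apply: cid_conn.
by move: kY; rewrite !inE /pt => /orP [] /eqP ->; case: i; conn_simp3 hc; conn_tac3 hc.
Qed.

End Frame.

Section Birth.
Variables (P : comNzRingType) (xi : cnode M -> P).
(** The target state 101 is reached by the birth of a loop from 001 or from 100. The interior nodes
    may then lie on the loop, so they are read at the level above or below it: level [c] for [frT],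
    the level after the three letters for [frB]. *)
Definition frT v := xi (pht 0b 0b 1b v).
Definition frB v := xi (pht 1b 0b 0b v).

Lemma nat_birthT : natural X Y (tgt 0b 0b 1b) (tgt 1b 0b 1b) frT xi (fun _ => idfun).
Proof.
apply: (natural_hom (@XY3 M c) (phi := pht 0b 0b 1b) (psi := id)) => //.
- exact: ph_out.
- by rewrite /pt; case: i; link3 hc.
- by rewrite /pt; case: i; link3 hc.
Qed.
Lemma nat_birthB : natural X Y (tgt 1b 0b 0b) (tgt 1b 0b 1b) frB xi (fun _ => idfun).
Proof.
apply: (natural_hom (@XY3 M c) (phi := pht 1b 0b 0b) (psi := id)) => //.
- exact: ph_out.
- by rewrite /pt; case: i; link3 hc.
- by rewrite /pt; case: i; link3 hc.
Qed.

Lemma th_frT x y z : th frT x y z =1 th xi x y z.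
Proof. by move=> p; apply: evm_eq => v; rewrite /frT ph_ph. Qed.
Lemma th_frB x y z : th frB x y z =1 th xi x y z.
Proof. by move=> p; apply: evm_eq => v; rewrite /frB ph_ph. Qed.
Lemma dth_frB p : dth frB p = dth xi p.
Proof.
rewrite /dth /death /zW; congr (_`_1); congr (polyseq _); apply: evm_eq => v.
by rewrite /zeW /frB ph_ph.
Qed.
End Birth.
End R3.

Lemma conn_congr M (U : diag M) a b a' b' :
  conn U a a' -> conn U b b' -> conn U a b = conn U a' b'.
Proof.
move=> H1 H2; apply/idP/idP => H.
  by apply: conn_trans (conn_trans _ H) H2; rewrite conn_sym.
by apply: conn_trans (conn_trans H1 H) _; rewrite conn_sym.
Qed.

Lemma tl_bool l (b : bool) : tl (Pos l) b = if b then Some l else None.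
Proof. by case: b. Qed.

Section R3main.
Variables (M : nat) (c : 'I_M).
Hypothesis hc : (c.+2 < M)%N.
Notation c1 := (ordS c).
Notation c2 := (ordS (ordS c)).
Notation c3 := (ordS (ordS (ordS c))).
Notation X := (X3 c).
Notation Y := (Y3 c).
Notation "0b" := false. Notation "1b" := true.

Lemma DX3 (P : comNzRingType) (xi : cnode M -> P) (W : nat -> gletter) Z s l (x y z : bool) :
  W c = Pos l -> W c1 = Pos (~~ l) -> W c2 = Pos l ->
  \sum_(k <- X) Dc xi W Z (st3 c s x y z) k =
   (if x then sg P s c * mu xi (ovr X (pt c l 0b y z) (dg W s)) c l * Z (st3 c s 0b y z) else 0)
   + (if y then sg P s c * (-1) ^+ x * mu xi (ovr X (pt c l x 0b z) (dg W s)) c1 (~~ l)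
        * Z (st3 c s x 0b z) else 0)
   + (if z then sg P s c * (-1) ^+ (x + y) * mu xi (ovr X (pt c l x y 0b) (dg W s)) c2 l
        * Z (st3 c s x y 0b) else 0).
Proof.
move=> w0 w1 w2; rewrite !big_cons big_nil addr0 addrA /Dc /em w0 w1 w2.
rewrite (st3_0 hc) (st3_1 hc) (st3_2) /= (sg_st3_0 hc) (sg_st3_1 hc) (sg_st3_2 hc).
congr (_ + _ + _).
- case: x => //=; rewrite (st3_upd0 hc) (dg_st3 hc) w0 w1 w2.
  by rewrite /pt !tl_bool.
- case: y => //=; rewrite (st3_upd1 hc) (dg_st3 hc) w0 w1 w2.
  by rewrite /pt !tl_bool.
- case: z => //=; rewrite (st3_upd2) (dg_st3 hc) w0 w1 w2.
  by rewrite /pt !tl_bool.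
Qed.

Variable i : bool.
Notation j := (~~ i).
Notation src := (pt c i).
Notation tgt := (pt c (~~ i)).

Section Scalars.
Variables (P : comNzRingType) (xi : cnode M -> P) (U : diag M).
Notation O x y z := (ovr X (tgt x y z) U).
Let fT := frT c i xi. Let fB := frB c i xi.
Let mT := mu fT (O 0b 1b 1b) c1 i. Let mB := mu fB (O 1b 1b 0b) c1 i.

Lemma frT_top p : fT (c1, p) = xi (c, p) /\ fT (c2, p) = xi (c, p).
Proof. by rewrite /fT /frT; split; conn_simp3 hc. Qed.
Lemma frB_bot p : fB (c1, p) = xi (c3, p) /\ fB (c2, p) = xi (c3, p).
Proof. by rewrite /fB /frB; split; conn_simp3 hc. Qed.
Lemma fr_out v : v.1 \notin Y -> fT v = xi v /\ fB v = xi v.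
Proof. by move=> nY; rewrite /fT /fB /frT /frB !ph_out. Qed.
Lemma out0 p : ((c, p) : cnode M).1 \notin Y. Proof. by rewrite !inE /= !(neq3 hc). Qed.
Lemma out3 p : ((c3, p) : cnode M).1 \notin Y. Proof. by rewrite !inE /= !(neq3 hc). Qed.

Lemma birthT p : cid fT (O 0b 0b 1b) p -> cid xi (O 1b 0b 1b) p.
Proof. exact: (nat_cid (nat_birthT hc i xi)). Qed.
Lemma birthB p : cid fB (O 1b 0b 0b) p -> cid xi (O 1b 0b 1b) p.
Proof. exact: (nat_cid (nat_birthB hc i xi)). Qed.
Ltac tog_tac := by rewrite /pt; case: i; first [exact: tog3_0 | exact: tog3_1 | exact: tog3_2].
Ltac tgl_tac := by rewrite /togglable /pt ?ovr3_0 ?(ovr3_1 hc) ?(ovr3_2 hc) ?negbK /= ?eqxx ?orbT.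

Lemma tgE1 : O 0b 0b 1b = tog (O 0b 1b 1b) c1 i. Proof. tog_tac. Qed.
Lemma tgE2 : O 1b 0b 0b = tog (O 1b 1b 0b) c1 i. Proof. tog_tac. Qed.
Lemma tgE3 : O 1b 1b 0b = tog (O 0b 1b 0b) c j. Proof. tog_tac. Qed.
Lemma tgE4 : O 0b 1b 1b = tog (O 0b 1b 0b) c2 j. Proof. tog_tac. Qed.
Lemma tgE5 : O 0b 0b 0b = tog (O 0b 1b 0b) c1 i. Proof. tog_tac. Qed.
Lemma tgE6 : O 0b 1b 1b = tog (O 0b 0b 1b) c1 i. Proof. tog_tac. Qed.
Lemma tgE7 : O 1b 1b 0b = tog (O 1b 0b 0b) c1 i. Proof. tog_tac. Qed.
Lemma tgE8 : O 0b 0b 1b = tog (O 0b 0b 0b) c2 j. Proof. tog_tac. Qed.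
Lemma tgE9 : O 1b 0b 1b = tog (O 1b 1b 1b) c1 i. Proof. tog_tac. Qed.
Lemma tgE10 : O 1b 1b 1b = tog (O 1b 1b 0b) c2 j. Proof. tog_tac. Qed.
Lemma tgl1 x z : togglable (O x 1b z) c1 i. Proof. case: x; case: z; tgl_tac. Qed.
Lemma tgl0 x z : togglable (O x 0b z) c1 i. Proof. case: x; case: z; tgl_tac. Qed.
Lemma tglc x y z : togglable (O x y z) c j. Proof. case: x; case: y; case: z; tgl_tac. Qed.
Lemma tglc2 x y z : togglable (O x y z) c2 j. Proof. case: x; case: y; case: z; tgl_tac. Qed.

Lemma sadT p : cid fT (O 0b 1b 1b) p -> cid xi (O 1b 0b 1b) (mT * p).
Proof. by move=> Ip; apply: birthT; rewrite tgE1; apply: mu_cid Ip; apply: tgl1. Qed.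
Lemma sadB p : cid fB (O 1b 1b 0b) p -> cid xi (O 1b 0b 1b) (mB * p).
Proof. by move=> Ip; apply: birthB; rewrite tgE2; apply: mu_cid Ip; apply: tgl1. Qed.
Lemma sadM (G : cnode M -> P) p : cid G (O 0b 1b 0b) p ->
  cid G (O 1b 1b 0b) (mu G (O 0b 1b 0b) c j * p).
Proof. by move=> Ip; rewrite tgE3; apply: mu_cid Ip; apply: tglc. Qed.

Lemma twiceT : mu fT (O 0b 0b 1b) c1 i * mT = xi (c, Some i) + xi (c, None).
Proof.
rewrite /mT tgE6 mu_twice; last exact: tgl0.
by rewrite (frT_top _).1 (frT_top _).2.
Qed.
Lemma twiceB : mu fB (O 1b 0b 0b) c1 i * mB = xi (c3, Some i) + xi (c3, None).
Proof.
rewrite /mB tgE7 mu_twice; last exact: tgl0.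
by rewrite (frB_bot _).1 (frB_bot _).2.
Qed.

Lemma mu_101 : mu xi (O 1b 0b 1b) c1 i = 1.
Proof.
rewrite muE tgE9 conn_tog; last exact: tgl1.
by rewrite (_ : conn _ _ _ = true) // /pt; case: i; conn_tac3 hc.
Qed.
Lemma mu_001 : mu xi (O 0b 0b 1b) c j = xi (c, Some j) + xi (c1, None).
Proof.
by rewrite muE (_ : conn _ _ _ = true) // /pt; case: i; conn_tac3 hc.
Qed.
Lemma mu_100 : mu xi (O 1b 0b 0b) c2 j = xi (c2, Some j) + xi (c3, None).
Proof.
by rewrite muE (_ : conn _ _ _ = true) // /pt; case: i; conn_tac3 hc.
Qed.

Ltac cc := apply: cid_conn; rewrite /pt; case: i; conn_tac3 hc.

(** Commuting the saddles makes both routes pass through 000, where the remaining saddles have the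
    same factor [m]. What is left is [m] times differences of variables: if [m] is a split factor,
    squares appear; if [m = 1], the merge has identified the nodes. *)
Lemma two_saddles : cid xi (O 1b 0b 1b)
  (mu fT (O 0b 1b 0b) c2 j * mT - mu fB (O 0b 1b 0b) c j * mB).
Proof.
have C1 : cid xi (O 1b 0b 1b) (mu fT (O 0b 1b 0b) c2 j * mT
    - mu fT (O 0b 1b 0b) c1 i * mu fT (O 0b 0b 0b) c2 j).
  apply: birthT; rewrite /mT tgE1 tgE4 tgE5; apply: mu_comm.
  - by rewrite (neq21 hc).
  - exact: tglc2.
  - exact: tgl1.
have C2 : cid xi (O 1b 0b 1b) (mu fB (O 0b 1b 0b) c j * mB
    - mu fB (O 0b 1b 0b) c1 i * mu fB (O 0b 0b 0b) c j).
  apply: birthB; rewrite /mB tgE2 tgE3 tgE5; apply: mu_comm.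
  - by rewrite (neq01 hc).
  - exact: tglc.
  - exact: tgl1.
pose b := conn (O 0b 0b 0b) (c2, Some j) (c3, None).
pose m := if b then xi (c, Some j) + xi (c3, None) else 1.
have Em : mu fT (O 0b 0b 0b) c2 j = m.
  by rewrite muE -/b /m (frT_top _).2 (fr_out (out3 _)).1.
have Em' : mu fB (O 0b 0b 0b) c j = m.
  rewrite muE (conn_congr (a' := (c2, Some j)) (b' := (c3, None))).
  - by rewrite -/b /m (frB_bot _).1 (fr_out (out0 _)).2.
  - by rewrite /pt; case: i; conn_tac3 hc.
  - by rewrite /pt; case: i; conn_tac3 hc.
have Cm : cid xi (O 1b 0b 1b) (m * (xi (c, None) - xi (c3, None))).
  rewrite /m; case: (boolP b) => [_|nb].
    rewrite [X in cid _ _ X](_ : _ = xi (c, None) ^+ 2 - xi (c3, None) ^+ 2 +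
      (xi (c, None) - xi (c3, None)) * (xi (c, Some j) - xi (c, None))); last by ring.
    apply: cidealD; first by apply: cidealB; apply: cideal_sqr1.
    by apply: cidealM; cc.
  rewrite mul1r -(fr_out (out0 None)).1 -(fr_out (out3 None)).1; apply/birthT/cid_conn.
  rewrite (conn_congr (a' := (c2, Some j)) (b' := (c3, None))) ?conn_refl //.
    by rewrite tgE8 conn_tog //; exact: tglc2.
  by rewrite /pt; case: i; conn_tac3 hc.
have C3 : cid xi (O 1b 0b 1b) ((mu fT (O 0b 1b 0b) c1 i - mu fB (O 0b 1b 0b) c1 i) * m).
  rewrite !muE; case: ifP => _; last by rewrite subrr mul0r; apply: cideal0.
  rewrite !(frT_top _).1 !(frT_top _).2 !(frB_bot _).1 !(frB_bot _).2.
  rewrite [X in cid _ _ X](_ : _ = m * (xi (c, Some i) - xi (c3, Some i))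
     + m * (xi (c, None) - xi (c3, None))); last by ring.
  by apply: cidealD => //; apply: cidealM; cc.
have := cidealD (cidealB C1 C2) C3; rewrite Em Em'.
set e := (X in cideal _ _ X); set g := (X in cid _ _ X); suff -> : g = e by [].
by rewrite /e /g; ring.
Qed.

Lemma cube_top1 : cid xi (O 1b 1b 1b) (mu xi (O 0b 1b 1b) c j - mT).
Proof.
rewrite /mT !muE (conn_congr (a' := (c2, None)) (b' := (c1, Some i))).
- rewrite conn_sym; case: ifP => _; last by rewrite subrr; apply: cideal0.
  rewrite (frT_top _).1 (frT_top _).2 [X in cid _ _ X](_ : _ = (xi (c, Some j) - xi (c, None))
    + (xi (c1, None) - xi (c, Some i))); last by ring.
  by apply: cidealD; cc.
- by rewrite /pt; case: i; conn_tac3 hc.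
- by rewrite /pt; case: i; conn_tac3 hc.
Qed.

Lemma cube_top2 : cid xi (O 1b 1b 1b) (mu xi (O 1b 1b 0b) c2 j - mB).
Proof.
rewrite /mB !muE (conn_congr (a' := (c1, Some i)) (b' := (c2, None))).
- case: ifP => _; last by rewrite subrr; apply: cideal0.
  rewrite (frB_bot _).1 (frB_bot _).2 [X in cid _ _ X](_ : _ = (xi (c2, Some j) - xi (c3, Some i)));
    last by ring.
  by cc.
- by rewrite /pt; case: i; conn_tac3 hc.
- by rewrite /pt; case: i; conn_tac3 hc.
Qed.

Lemma cube_top3 : cid xi (O 1b 1b 1b) (mB * (mu xi (O 0b 1b 0b) c j - mu fB (O 0b 1b 0b) c j)).
Proof.
rewrite [in X in _ * X]muE [in X in _ - X]muE; case: ifP => _; last by rewrite subrr mulr0; apply: cideal0.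
rewrite (frB_bot _).1 (fr_out (out0 _)).2.
rewrite [X in cid _ _ X](_ : _ = mB * (xi (c1, None) - xi (c3, Some i))
   + mB * (xi (c3, Some i) - xi (c3, None))); last by ring.
apply: cidealD; first by apply: cidealM; cc.
rewrite /mB muE; case: ifPn => [_|nb].
  rewrite (frB_bot _).1 (frB_bot _).2 [X in cideal _ _ X](_ : _ = xi (c3, Some i) ^+ 2
     - xi (c3, None) ^+ 2); last by ring.
  by apply: cidealB; apply: cideal_sqr1.
rewrite mul1r; apply: cid_conn; rewrite (conn_congr (a' := (c2, Some j)) (b' := (c3, None))) ?conn_refl //.
  rewrite tgE10 conn_tog; last exact: tglc2.
  rewrite (conn_congr (a' := (c1, Some i)) (b' := (c2, None))) //.
    by rewrite /pt; case: i; conn_tac3 hc.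
  by rewrite /pt; case: i; conn_tac3 hc.
by rewrite /pt; case: i; conn_tac3 hc.
Qed.
End Scalars.
End R3main.

Section R3.
Variables (M : nat) (c : 'I_M).
Hypothesis hc : (c.+2 < M)%N.
Notation c1 := (ordS c).
Notation c2 := (ordS (ordS c)).
Notation X := (X3 c).
Notation Y := (Y3 c).
Notation "0b" := false. Notation "1b" := true.
Variables (R : comNzRingType) (W W' : nat -> gletter) (i : bool).
Notation j := (~~ i).
Hypothesis Wc : W c = Pos i.
Hypothesis Wc1 : W c1 = Pos (~~ i).
Hypothesis Wc2 : W c2 = Pos i.
Hypothesis W'c : W' c = Pos (~~ i).
Hypothesis W'c1 : W' c1 = Pos i.
Hypothesis W'c2 : W' c2 = Pos (~~ i).
Hypothesis WW' : forall k : 'I_M, k \notin X -> W k = W' k.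
Notation src := (pt c i).
Notation tgt := (pt c (~~ i)).

(** The components arriving at a target state, with source states given by [r3_src]. Nothing leaves
    the source states 001 and 111, which cancel against the two labels of the loop of 101;
    preferring 100 to 001 is a choice, and makes the formulas asymmetric. *)
Definition r3_terms (x y z : bool) : seq nat :=
  match x, y, z with
  | false, false, false => [:: 0] | false, true, false => [:: 1]
  | true, false, false | false, false, true => [:: 2]
  | false, true, true => [:: 3] | true, true, false => [:: 4; 5]
  | true, false, true => [:: 6; 7; 8] | true, true, true => [::]
  end%N.

Definition r3_src (k : nat) : bool * bool * bool :=
  match k with
  | 0 => (0b, 0b, 0b) | 1 => (1b, 0b, 0b) | 2 => (0b, 1b, 0b)
  | 3 | 6 => (1b, 1b, 0b) | 4 | 7 => (0b, 1b, 1b) | _ => (1b, 0b, 1b)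
  end%N.

Definition r3_fam (P : comNzRingType) (xi : cnode M -> P) (k : nat) (U : diag M)
    (p : {mpoly P[#|{: cnode M}|]}) : P :=
  let O x y z := ovr X (tgt x y z) U in let fB := frB c i xi in
  match k with
  | 0%N => th c i xi 0b 0b 0b p
  | 1%N => th c i xi 1b 0b 0b p
  | 2%N => th c i xi 0b 1b 0b p
  | 3%N => th c i xi 1b 1b 0b p
  | 4%N => th c i xi 0b 1b 1b p
  | 5%N => - (mu xi (O 0b 1b 0b) c j * dth c i xi p)
  | 6%N => mu (frT c i xi) (O 0b 1b 1b) c1 i * th c i (frT c i xi) 1b 1b 0b p
  | 7%N => mu fB (O 1b 1b 0b) c1 i * th c i fB 0b 1b 1b p
  | _ => - (mu fB (O 1b 1b 0b) c1 i * (mu fB (O 0b 1b 0b) c j * dth c i fB p))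
  end.

Definition r3_ov (k : nat) (s : state M) : state M :=
  let '(x, y, z) := r3_src k in st3 c s x y z.

Lemma nat_sad_tgt (P : comNzRingType) (F : cnode M -> P) x y z x' y' z' k l :
  k \in X -> (forall U, ovr X (tgt x' y' z') U = tog (ovr X (tgt x y z) U) k l) ->
  (forall U, togglable (ovr X (tgt x y z) U) k l) ->
  natural X Y (tgt x y z) (tgt x' y' z') F F (fun U p => mu F (ovr X (tgt x y z) U) k l * p).
Proof.
move=> kX E tg; have tk : tgt x y z k = ovr X (tgt x y z) [ffun=> None] k.
  by rewrite ffunE kX.
apply: natural_ext (natural_saddle Y F (c := k) (i := l) kX _) => // [m mX|]; last first.
  by have := tg [ffun=> None]; rewrite /togglable -tk.
have := congr1 (fun U : diag M => U m) (E [ffun=> None]); rewrite /tog -tk !ffunE mX => ->.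
by case: eqP.
Qed.

Lemma r3_natural (P : comNzRingType) (xi : cnode M -> P) k x y z : k \in r3_terms x y z ->
  let '(x', y', z') := r3_src k in
  natural X Y (src x' y' z') (tgt x y z) (xiU P) xi (r3_fam xi k).
Proof.
have nj (F : cnode M -> P) : natural X Y (tgt 0b 1b 0b) (tgt 1b 1b 0b) F F
    (fun U p => mu F (ovr X (tgt 0b 1b 0b) U) c j * p).
  apply: nat_sad_tgt => [|U|U]; [by rewrite inE eqxx|exact: tgE3|exact: tglc].
have nB : natural X Y (tgt 1b 1b 0b) (tgt 1b 0b 1b) (frB c i xi) xi
    (fun U p => mu (frB c i xi) (ovr X (tgt 1b 1b 0b) U) c1 i * p).
  apply: (natural_comp (be := tgt 1b 0b 0b) _ (nat_birthB hc i xi)).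
  apply: nat_sad_tgt => [|U|U]; [by rewrite !inE eqxx orbT|exact: tgE2|exact: tgl1].
have nT : natural X Y (tgt 0b 1b 1b) (tgt 1b 0b 1b) (frT c i xi) xi
    (fun U p => mu (frT c i xi) (ovr X (tgt 0b 1b 1b) U) c1 i * p).
  apply: (natural_comp (be := tgt 0b 0b 1b) _ (nat_birthT hc i xi)).
  apply: nat_sad_tgt => [|U|U]; [by rewrite !inE eqxx orbT|exact: tgE1|exact: tgl1].
move: x y z => [] [] [] //=; rewrite !inE => H.
- case/orP: H => /eqP -> /=; first by apply: nat_th.
  exact: natural_opp (natural_comp (nat_death3 hc i xi) (nj xi)).
- case/or3P: H => /eqP -> /=.
  + exact: natural_comp (nat_th hc i _ (x' := 0b) (y' := 1b) (z' := 1b) _) nT.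
  + exact: natural_comp (nat_th hc i _ (x' := 1b) (y' := 1b) (z' := 0b) _) nB.
  + exact: natural_opp (natural_comp (natural_comp (nat_death3 hc i _) (nj _)) nB).
- by move/eqP: H => -> /=; apply: nat_th.
- by move/eqP: H => -> /=; apply: nat_th.
- by move/eqP: H => -> /=; apply: nat_th.
- by move/eqP: H => -> /=; apply: nat_th.
- by move/eqP: H => -> /=; apply: nat_th.
Qed.

(** There is one congruence for each of the eight target states, obtained as an explicit combination
    of the squares above; [ring] checks the combination. *)
Lemma r3_move : Bound M R W -> Bound M R W'.
Proof.
move=> B P rho xi; have [Z1 S1] := Bound_univ rho B.
pose J (s : state M) := r3_terms (s c != 0%N) (s c1 != 0%N) (s c2 != 0%N).
have b01 (n : nat) : (n <= 1)%N -> n = (n != 0%N) by case: n => [|[]].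
have v1 s : vst W' s -> [/\ (s c <= 1)%N, (s c1 <= 1)%N & (s c2 <= 1)%N].
  by move=> vs; have := (vs c, vs c1, vs c2); rewrite W'c W'c1 W'c2 => -[[]].
have W1 s x y z : dg W (st3 c s (x : bool) (y : bool) (z : bool)) = ovr X (src x y z) (dg W' s).
  rewrite (dg_st3 hc) Wc Wc1 Wc2 !tl_bool; apply/ffunP => k; rewrite !ffunE.
  by case: ifPn => // nX; rewrite WW'.
have W2 s x y z : dg W' (st3 c s (x : bool) (y : bool) (z : bool)) = ovr X (tgt x y z) (dg W' s).
  by rewrite (dg_st3 hc) W'c W'c1 W'c2 !tl_bool /pt negbK.
exists (transferred W' J r3_ov (r3_fam xi) Z1).
apply: (transfer (uX3 hc) (@XY3 M c) WW' S1 _ _ _ _ _ _ (cr := c)).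
- move=> s k n; rewrite [_ \in _]inE [_ \in [:: _; _]]inE [_ \in [:: _]]inE !negb_or => /and3P [k0 k1 k2].
  by rewrite /J !ffunE !(eq_sym _ k) (negPf k0) (negPf k1) (negPf k2).
- by move=> k s l n nX; rewrite /r3_ov; case: (r3_src k) => [[x y] z]; rewrite st3_upd.
- by move=> k s l nX; rewrite /r3_ov; case: (r3_src k) => [[x y] z]; rewrite st3_out.
- move=> k s l vs; have [s0 s1 s2] := v1 s vs; rewrite /J => kJ nX.
  have : odd (let '(x, y, z) := r3_src k in x + y + z) = odd (s c + s c1 + s c2).
    rewrite (b01 _ s0) (b01 _ s1) (b01 _ s2); move: kJ.
    by do 3 case: (_ != 0%N) => //=; rewrite !inE => H; do ?[case/orP: H => H]; move/eqP: H => ->.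
  by rewrite /r3_ov; case: (r3_src k) => [[x y] z] od; apply: sg_st3_out.
- move=> k s l vs _; rewrite [_ \in _]inE [_ \in [:: _; _]]inE [_ \in [:: _]]inE => /or3P [] /eqP ->;
  rewrite /r3_ov; case: (r3_src k) => [[x y] z];
  by rewrite ?(st3_0 hc) ?(st3_1 hc) ?st3_2 ?Wc ?Wc1 ?Wc2 /= leq_b1.
- move=> k s vs kJ; have [s0 s1 s2] := v1 s vs.
  have := r3_natural xi kJ; rewrite /r3_ov; case: (r3_src k) => [[x y] z] nf.
  apply: natural_ext nf => l lX; first by rewrite W1 ffunE lX.
  have Es : st3 c s (s c != 0%N) (s c1 != 0%N) (s c2 != 0%N) = s.
    by rewrite -(b01 _ s0) -(b01 _ s1) -(b01 _ s2) st3_id.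
  by have := W2 s (s c != 0%N) (s c1 != 0%N) (s c2 != 0%N); rewrite Es => ->; rewrite ffunE lX.
move=> s vs; have [s0 s1 s2] := v1 s vs.
have Es : s = st3 c s (s c != 0%N) (s c1 != 0%N) (s c2 != 0%N).
  by rewrite -(b01 _ s0) -(b01 _ s1) -(b01 _ s2) st3_id.
move: Es; move: (s c != 0%N) (s c1 != 0%N) (s c2 != 0%N) => x y z {s0 s1 s2 vs} Es; rewrite Es; move: s {Es} => s.
set U := dg W' s; set T := transferred _ _ _ _ _.
rewrite W2 -/U /J (st3_0 hc) (st3_1 hc) st3_2.
have bb (b : bool) : (b != 0%N :> nat) = b by case: b.
rewrite !bb (DX3 hc xi T s _ _ _ W'c) ?negbK //.
have OO be be' V : ovr X be (ovr X be' V) = ovr X be V.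
  by apply/ffunP => k; rewrite !ffunE; case: (k \in _).
have OW be : ovr X be (dg W s) = ovr X be U.
  by apply/ffunP => k; rewrite !ffunE; case: ifPn => // nX; rewrite WW'.
pose A (x y z : bool) := Z1 (st3 c s x y z).
have TT (x' y' z' : bool) : T (st3 c s x' y' z') = \sum_(k <- r3_terms x' y' z')
    r3_fam xi k U (let '(x', y', z') := r3_src k in A x' y' z').
  rewrite /T /transferred /J (st3_0 hc) (st3_1 hc) st3_2 !bb W2; apply: eq_bigr => k _.
  rewrite /r3_ov; case: (r3_src k) => [[x1 y1] z1]; rewrite st3_st3.
  by case: k => [|[|[|[|[|[|[|[|k]]]]]]]]; rewrite /= ?OO.
have psi0 (Q : comNzRingType) (ze : cnode M -> Q) (x' y' z' : bool) : x' || y' || z' ->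
    psiv ze (st3 c s x' y' z') c = 0.
  by move: x' y' z' => [] [] [] // _; rewrite /psiv; case: eqP => //;
    move/(congr1 (fun t : state M => (t c, t c1, t c2)));
    rewrite (st3_0 hc) (st3_1 hc) st3_2 !ffunE.
have SS x' y' z' := DX3 hc (xiU P) Z1 s x' y' z' Wc Wc1 Wc2.
pose e := sg P s c.
have thsg F x' y' z' p : th c i F x' y' z' (sg _ s c * p) = e * th c i F x' y' z' p.
  by rewrite rmorphM rmorph_sign.
have dsg F p : dth c i F (sg _ s c * p) = e * dth c i F p.
  exact: (nat_sign (nat_death3 hc i F) U).
have dD F p q : dth c i F (p + q) = dth c i F p + dth c i F q.
  exact: (natD (nat_death3 hc i F) U).
have dN F p : dth c i F (- p) = - dth c i F p.
  exact: (natN (nat_death3 hc i F) U).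
have d0 F : dth c i F 0 = 0 by exact: (nat0 (nat_death3 hc i F) U).
pose eU := sg {mpoly P[#|{: cnode M}|]} s c.
pose mS x y z k l := mu (xiU P) (ovr X (src x y z) U) k l.
have S000 : \sum_(l <- X) Dc (xiU P) W Z1 (st3 c s 0b 0b 0b) l = 0.
  by rewrite SS !addr0.
have S100 : \sum_(l <- X) Dc (xiU P) W Z1 (st3 c s 1b 0b 0b) l = eU * (mS 0b 0b 0b c i * A 0b 0b 0b).
  by rewrite SS OW !addr0 -mulrA.
have S010 : \sum_(l <- X) Dc (xiU P) W Z1 (st3 c s 0b 1b 0b) l = eU * (mS 0b 0b 0b c1 j * A 0b 0b 0b).
  by rewrite SS OW addr0 add0r expr0 mulr1 -mulrA.
have S110 : \sum_(l <- X) Dc (xiU P) W Z1 (st3 c s 1b 1b 0b) l =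
    eU * (mS 0b 1b 0b c i * A 0b 1b 0b - mS 1b 0b 0b c1 j * A 1b 0b 0b).
  by rewrite SS !OW addr0 expr1 mulrN1 !mulNr -!mulrA -mulrBr.
have S011 : \sum_(l <- X) Dc (xiU P) W Z1 (st3 c s 0b 1b 1b) l =
    eU * (mS 0b 0b 1b c1 j * A 0b 0b 1b - mS 0b 1b 0b c2 i * A 0b 1b 0b).
  by rewrite SS !OW add0r expr0 mulr1 expr1 mulrN1 !mulNr -!mulrA -mulrBr.
have S101 : \sum_(l <- X) Dc (xiU P) W Z1 (st3 c s 1b 0b 1b) l =
    eU * (mS 0b 0b 1b c i * A 0b 0b 1b - mS 1b 0b 0b c2 i * A 1b 0b 0b).
  by rewrite SS !OW addr0 addn0 expr1 mulrN1 !mulNr -!mulrA -mulrBr.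
have ovx k x' y' z' : r3_ov k (st3 c s x' y' z') = (let '(x', y', z') := r3_src k in st3 c s x' y' z').
  by rewrite /r3_ov; case: (r3_src k) => [[? ?] ?]; rewrite st3_st3.
have ov0 x' y' z' : r3_ov 0 (st3 c s x' y' z') = st3 c s 0b 0b 0b by exact: (ovx 0%N).
have ov1 x' y' z' : r3_ov 1 (st3 c s x' y' z') = st3 c s 1b 0b 0b by exact: (ovx 1%N).
have ov2 x' y' z' : r3_ov 2 (st3 c s x' y' z') = st3 c s 0b 1b 0b by exact: (ovx 2%N).
have ov3 x' y' z' : r3_ov 3 (st3 c s x' y' z') = st3 c s 1b 1b 0b by exact: (ovx 3%N).
have ov4 x' y' z' : r3_ov 4 (st3 c s x' y' z') = st3 c s 0b 1b 1b by exact: (ovx 4%N).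
have ov5 x' y' z' : r3_ov 5 (st3 c s x' y' z') = st3 c s 1b 0b 1b by exact: (ovx 5%N).
have ov6 x' y' z' : r3_ov 6 (st3 c s x' y' z') = st3 c s 1b 1b 0b by exact: (ovx 6%N).
have ov7 x' y' z' : r3_ov 7 (st3 c s x' y' z') = st3 c s 0b 1b 1b by exact: (ovx 7%N).
have ov8 x' y' z' : r3_ov 8 (st3 c s x' y' z') = st3 c s 1b 0b 1b by exact: (ovx 8%N).
have famO k x' y' z' p : r3_fam xi k (ovr X (tgt x' y' z') U) p = r3_fam xi k U p.
  by case: k => [|[|[|[|[|[|[|[|k]]]]]]]]; rewrite /r3_fam ?OO.
have L2 (F : nat -> P) a b : \sum_(k <- [:: a; b]) F k = F a + F b by rewrite !big_cons big_nil addr0.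
have L3 (F : nat -> P) a b d : \sum_(k <- [:: a; b; d]) F k = F a + F b + F d.
  by rewrite !big_cons big_nil addr0 addrA.
have f0 k : r3_fam xi k U 0 = 0.
  by case: k => [|[|[|[|[|[|[|[|k]]]]]]]]; rewrite /r3_fam ?d0 ?rmorph0 ?mulr0 ?oppr0.
pose O x y z := ovr X (tgt x y z) U; pose B0 x y z := th c i xi x y z (A x y z).
pose E101 := dth c i xi (A 1b 0b 1b).
pose mT := mu (frT c i xi) (O 0b 1b 1b) c1 i; pose mB := mu (frB c i xi) (O 1b 1b 0b) c1 i.
have T000 : T (st3 c s 0b 0b 0b) = B0 0b 0b 0b by rewrite TT big_seq1.
have T010 : T (st3 c s 0b 1b 0b) = B0 1b 0b 0b by rewrite TT big_seq1.
have T100 : T (st3 c s 1b 0b 0b) = B0 0b 1b 0b by rewrite TT big_seq1.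
have T001 : T (st3 c s 0b 0b 1b) = B0 0b 1b 0b by rewrite TT big_seq1.
have T011 : T (st3 c s 0b 1b 1b) = B0 1b 1b 0b by rewrite TT big_seq1.
have T110 : T (st3 c s 1b 1b 0b) = B0 0b 1b 1b - mu xi (O 0b 1b 0b) c j * E101.
  by rewrite TT L2.
have T101 : T (st3 c s 1b 0b 1b) = mT * B0 1b 1b 0b + mB * B0 0b 1b 1b
    - mB * (mu (frB c i xi) (O 0b 1b 0b) c j * E101).
  by rewrite TT L3 /r3_fam (th_frT hc) (th_frB hc) (dth_frB hc).
clearbody T.
have done' V a b : cid xi V a -> b = a -> cid xi V b by move=> H ->.
move: x y z => [] [] []; rewrite -?/(O _ _ _).
(* State 111 receives no component, so the three arrows into it must cancel by themselves. *)
- rewrite psi0 // !big_nil T011 T101 T110 -!/(O _ _ _) (mu_101 hc) -/e.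
  have H1 := cidealM (e * B0 1b 1b 0b) (cube_top1 hc i xi U).
  have H2 := cidealM (e * (B0 0b 1b 1b - mu xi (O 0b 1b 0b) c j * E101)) (cube_top2 hc i xi U).
  have H3 := cidealM (e * E101) (cube_top3 hc i xi U).
  rewrite -!/(O _ _ _) -/mT -/mB in H1 H2 H3.
  apply: (done' _ _ _ (cidealB (cidealD H1 H2) H3)).
  by rewrite ?negbK; ring.
- rewrite psi0 // !L2 !famO ov4 ov5 S011 S101 !psi0 // !f0 T010 T100 -/e /r3_fam thsg dsg.
  rewrite rmorphB dD dN -!/(O _ _ _).
  have H1 := sadM (death_100 hc i xi U (A 1b 0b 0b)).
  have H2 := edge_010_011 hc i xi U (A 0b 1b 0b).
  have H3 := edge_001_011 hc i xi U (A 0b 0b 1b).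
  have H4 := sadM (death_001 hc i xi U (A 0b 0b 1b)).
  apply: (done' _ _ _ (cidealM e (cidealB (cidealD (cidealB H1 H2) H3) H4))).
  rewrite -!/(O _ _ _) -!/(mS _ _ _ _ _) /B0.
  move: (dth _ _ _ _) (dth _ _ _ _) => p1 p2.
  move: (th c i xi 0b 1b 1b _) (th c i xi 0b 1b 1b _) (th c i xi 0b 0b 1b _) => p3 p4 p5.
  by ring.
(* State 101, with the loop. [K1] to [K6] are squares followed by a saddle and a birth, [K7]
   exchanges the two routes from 010, and [K8], [K9] are a saddle followed by its inverse. *)
- rewrite psi0 // !L3 !famO ov6 ov7 ov8 S110 S011 S101 !psi0 // !f0 T001 T100.
  rewrite -/e /r3_fam !thsg dsg !rmorphB dD dN (mu_001 hc) (mu_100 hc).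
  have K1 := sadT hc (edge_010_110 hc i (frT c i xi) U (A 0b 1b 0b)).
  have K2 := sadT hc (edge_100_110 hc i (frT c i xi) U (A 1b 0b 0b)).
  have K3 := sadB hc (edge_010_011 hc i (frB c i xi) U (A 0b 1b 0b)).
  have K4 := sadB hc (edge_001_011 hc i (frB c i xi) U (A 0b 0b 1b)).
  have K5 := sadB hc (sadM (death_001 hc i (frB c i xi) U (A 0b 0b 1b))).
  have K6 := sadB hc (sadM (death_100 hc i (frB c i xi) U (A 1b 0b 0b))).
  have K7 := cidealM (B0 1b 0b 0b) (two_saddles hc i xi U).
  have tT := twiceT hc i xi U; have tB := twiceB hc i xi U.
  rewrite !(th_frT hc) !(th_frB hc) in K1 K2 K3 K4 K5 K6 *.
  rewrite -!/(O _ _ _) -/mT -/mB -!/(mS _ _ _ _ _) in K1 K2 K3 K4 K5 K6 K7 tT tB *.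
  have K8 : cid xi (O 1b 0b 1b) (B0 0b 1b 0b * ((xi (c, Some i) + xi (c, None))
      - mu (frT c i xi) (O 0b 0b 1b) c1 i * mT)).
    by rewrite tT subrr mulr0; apply: cideal0.
  have K9 : cid xi (O 1b 0b 1b) (B0 0b 1b 0b * ((xi (ordS c2, Some i) + xi (ordS c2, None))
      - mu (frB c i xi) (O 1b 0b 0b) c1 i * mB)).
    by rewrite tB subrr mulr0; apply: cideal0.
  have Q1 : cid xi (O 1b 0b 1b) (B0 0b 1b 0b * (xi (c, Some j) - xi (c, None))).
    by apply/cidealM/cid_conn; rewrite /O /pt; case: i; conn_tac3 hc.
  have Q2 : cid xi (O 1b 0b 1b) (B0 0b 1b 0b * (xi (c1, None) - xi (c2, Some j))).
    by apply/cidealM/cid_conn; rewrite /O /pt; case: i; conn_tac3 hc.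
  have Q3 : cid xi (O 1b 0b 1b) (B0 0b 1b 0b * (xi (c, Some i) - xi (ordS c2, Some i))).
    by apply/cidealM/cid_conn; rewrite /O /pt; case: i; conn_tac3 hc.
  have KK := cidealD (cidealD (cidealB (cidealB (cidealD (cidealB K1 K2) K4) K3) K5) K6) K7.
  have QQ := cidealB (cidealD (cidealB (cidealD Q1 Q2) Q3) K8) K9.
  apply: (done' _ _ _ (cidealM e (cidealD KK QQ))) => {KK QQ K1 K2 K3 K4 K5 K6 K7 K8 K9 Q1 Q2 Q3}.
  rewrite /B0.
  move: (dth _ _ _ _) (dth _ _ _ _) => p1 p2.
  move: (th c i xi 0b 1b 1b _) (th c i xi 0b 1b 1b _) (th c i xi 0b 0b 1b _) => p3 p4 p5.
  move: (th c i xi 1b 1b 0b _) (th c i xi 1b 1b 0b _) (th c i xi 0b 1b 0b _) (th c i xi 1b 0b 0b _) => p6 p7 p8 p9.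
  by ring.
- rewrite psi0 // !big_seq1 !famO ov2 S010 !psi0 // !f0 T000 -/e /r3_fam thsg.
  apply: (done' _ _ _ (cidealM e (edge_000_010 hc i xi U (A 0b 0b 0b)))).
  by rewrite -!/(O _ _ _) -!/(mS _ _ _ _ _) /B0; ring.
- rewrite psi0 // !big_seq1 !famO ov3 S110 !psi0 // !f0 T001 T010 -/e /r3_fam thsg rmorphB.
  apply: (done' _ _ _ (cidealM e (cidealB (edge_010_110 hc i xi U (A 0b 1b 0b)) (edge_100_110 hc i xi U (A 1b 0b 0b))))).
  by rewrite -!/(O _ _ _) -!/(mS _ _ _ _ _) /B0 ?negbK; ring.
- rewrite psi0 // !big_seq1 !famO ov1 S100 !psi0 // !f0 T000 -/e /r3_fam thsg.
  apply: (done' _ _ _ (cidealM e (edge_000_100 hc i xi U (A 0b 0b 0b)))).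
  by rewrite -!/(O _ _ _) -!/(mS _ _ _ _ _) /B0 ?negbK; ring.
- rewrite psi0 // !big_seq1 !famO ov2 S010 !psi0 // !f0 T000 -/e /r3_fam thsg.
  apply: (done' _ _ _ (cidealM e (edge_000_010' hc i xi U (A 0b 0b 0b)))).
  by rewrite -!/(O _ _ _) -!/(mS _ _ _ _ _) /B0 ?negbK; ring.
- rewrite !big_seq1 !famO ov0 S000 !f0 /r3_fam /psiv; case: eqP => _; last first.
    by rewrite rmorph0 !(addr0, subr0); apply: cideal0.
  by rewrite !rmorphM /th !evm_xi !ph_out ?out0 // subrr !(addr0, subr0); apply: cideal0.
Qed.
End R3.

(** * Rotation and trivial letters *)

Lemma cid_map (M M' : nat) (P : comNzRingType) (U : diag M) (V : diag M')
    (xi : cnode M -> P) (xi' : cnode M' -> P) (phi : cnode M -> cnode M') :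
  (forall c, link U (fun x y => conn V (phi x) (phi y)) c) ->
  (forall v, xi v = xi' (phi v)) -> forall p, cid xi U p -> cid xi' V p.
Proof.
move=> /link_nxt H E p; elim=> [|u x q _ IH|u x q _ IH]; first exact: cideal0.
  by rewrite !E dpermE; apply: cidealD IH; apply/cidealM/cid_conn/H.
by rewrite E; apply: cidealD IH; apply/cidealM/cideal_sqr1.
Qed.

Lemma odd_pre l j j' : pre l j = Some j' -> odd j' = ~~ odd j.
Proof.
case: l => [i|i k] /=; first by case: eqP => // -> [<-].
by case: ifP => // _ [<-].
Qed.

Section Rotate.
Variables (m : nat) (R : comNzRingType) (W W' : nat -> gletter).
Hypothesis WW' : forall c : 'I_m.+1, W' c = W (ordS c).
Notation last := (@ord_max m).

Lemma ordS_last : ordS last = ord0.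
Proof. by apply: val_inj; rewrite /= modnn. Qed.
Lemma ordS_lt (c : 'I_m.+1) : c != last -> ordS c = c.+1 :> nat.
Proof.
move=> nl; rewrite /= modn_small // ltnS ltn_neqAle -ltnS ltn_ord andbT.
by apply: contraNneq nl => E; apply/eqP/val_inj.
Qed.

Definition rots (s : state m.+1) : state m.+1 := [ffun k => s (ord_pred k)].
Definition rotn (x : cnode m.+1) : cnode m.+1 := (ordS x.1, x.2).

Lemma rotate : Bound m.+1 R W -> Bound m.+1 R W'.
Proof.
move=> B P rho xi; pose xi1 (v : cnode m.+1) := xi (ord_pred v.1, v.2).
have [Z S] := B P rho xi1.
have dgE s k : dg W (rots s) (ordS k) = dg W' s k by rewrite !ffunE WW' ordSK.
have lk s c : link (dg W' s) (fun x y => conn (dg W (rots s)) (rotn x) (rotn y)) c.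
  by have := link_conn (dg W (rots s)) (ordS c); rewrite /link dgE.
have lk' s c : link (dg W (rots s)) (fun x y => conn (dg W' s) (ord_pred x.1, x.2) (ord_pred y.1, y.2)) c.
  have := link_conn (dg W' s) (ord_pred c); rewrite /link -dgE !ord_predK.
  by case: (dg _ _ c) => [i|]; rewrite /= ordSK.
have connE s x y : conn (dg W (rots s)) (rotn x) (rotn y) = conn (dg W' s) x y.
  apply/idP/idP; last exact: (conn_map (lk s)).
  by move/(conn_map (lk' s)); rewrite /= !ordSK -!surjective_pairing.
pose R' (s : state m.+1) := (\sum_(k < m.+1 | (k < last)%N) s k)%N.
(* The Koszul sign of moving the last letter across all the others. *)
pose eta (s : state m.+1) : P := (-1) ^+ (s last * R' s).
exists (fun s => eta s * Z (rots s)) => s vs c.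
have vt : vst W (rots s).
  by move=> k; rewrite ffunE; have := vs (ord_pred k); rewrite WW' ord_predK.
have upE k j : rots (upd s k j) = upd (rots s) (ordS k) j.
  apply/ffunP => l; rewrite !ffunE; congr (if _ then _ else _).
  by rewrite -(inj_eq (can_inj (@ordSK _))) ord_predK.
have main k : Dc xi W' (fun s => eta s * Z (rots s)) s k = eta s * Dc xi1 W Z (rots s) (ordS k).
  rewrite /Dc -WW' [rots s _]ffunE ordSK; case Ep: (pre _ _) => [j|]; last by rewrite mulr0.
  have -> : em xi W' s k j = em xi1 W (rots s) (ordS k) j.
    rewrite /em -WW' [rots s _]ffunE ordSK.
    have -> : mu xi1 (dg W (upd (rots s) (ordS k) j)) (ordS k) (side (W' k)) =
              mu xi (dg W' (upd s k j)) k (side (W' k)).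
      rewrite !muE -upE -[conn (dg W' _) _ _]connE /rotn /= /xi1 /= ordSK.
      by rewrite ordSK.
    by rewrite /xi1 /= !ordSK.
  rewrite upE; suff E : sg P s k * eta (upd s k j) = eta s * sg P (rots s) (ordS k).
    rewrite [RHS]mulrA [in RHS]mulrA -E; ring.
  rewrite /eta /sg -!exprD -signr_odd -[RHS]signr_odd; congr (_ ^+ nat_of_bool _).
  have od := odd_pre Ep.
  case: (eqVneq k last) => [kl|nl].
    rewrite kl ordS_last [X in odd _ = odd (_ + X)%N]big_pred0 ?addn0; last by [].
    have -> : R' (upd s last j) = R' s.
      by apply: eq_bigr => l ll; rewrite ffunE; case: eqP => // E; rewrite E ltnn in ll.
    rewrite ffunE eqxx; move: od; rewrite kl -/(R' s) => od.
    rewrite !oddD !oddM od; by case: (odd (s _)); case: (odd (R' s)).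
  rewrite [upd s k j last]ffunE eq_sym (negPf nl).
  have -> : (\sum_(l < m.+1 | (l < ordS k)%N) rots s l = s last + \sum_(l < m.+1 | (l < k)%N) s l)%N.
    have lE (l : 'I_m.+1) : (l < ordS k)%N = (l == ord0) || (ord_pred l < k)%N && (l != ord0).
      rewrite ordS_lt //; case: (eqVneq l ord0) => [-> //|l0] /=.
      have nl' : ord_pred l != last.
        by apply: contraNneq l0 => E; rewrite -(ord_predK l) E ordS_last.
      by rewrite -{1}(ord_predK l) ordS_lt // ltnS andbT.
    rewrite (bigD1 ord0) ?lE ?eqxx; last by rewrite ?lE.
    rewrite ffunE; congr (_ + _)%N.
      by rewrite -ordS_last ordSK.
    rewrite (reindex_inj (can_inj (@ordSK _))).
    apply: eq_big => l; last by rewrite ffunE ordSK.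
    rewrite lE ordSK -ordS_last (inj_eq (can_inj (@ordSK _))).
    case: (eqVneq l last) => [->|_]; last by rewrite !andbT.
    by rewrite andbF ltnNge -ltnS ltn_ord.
  have oR : odd (R' (upd s k j)) = ~~ odd (R' s).
    rewrite /R' (bigD1 k) /=; last by rewrite ltn_neqAle -ltnS ltn_ord andbT.
    rewrite [in RHS](bigD1 k) /=; last by rewrite ltn_neqAle -ltnS ltn_ord andbT.
    rewrite ffunE eqxx !oddD od addNb; congr (~~ (_ (+) odd _)).
    by apply: eq_bigr => l /andP [_ /negPf nk]; rewrite ffunE nk.
  rewrite !oddD !oddM oR; by case: (odd (s _)); case: (odd (R' s)); case: (odd _).
have ps : psiv xi s c = eta s * psiv xi1 (rots s) (ordS c).
  have E0 : (rots s == st0 m.+1) = (s == st0 m.+1).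
    apply/eqP/eqP => E; apply/ffunP => k; rewrite ffunE.
      by have := congr1 (fun t : state m.+1 => t (ordS k)) E; rewrite !ffunE ordSK.
    by rewrite E !ffunE.
  rewrite /psiv E0; case: eqP => [->|_]; last by rewrite mulr0.
  by rewrite /eta ffunE mul0n expr0 mul1r /xi1 /= !ordSK.
rewrite (eq_bigr _ (fun k _ => main k)) ps -mulr_sumr -mulrBr; apply: cidealM.
have -> : \sum_(k < m.+1) Dc xi1 W Z (rots s) (ordS k) = \sum_k Dc xi1 W Z (rots s) k.
  by rewrite [RHS](reindex_inj (can_inj (@ordSK _))).
apply: (cid_map (phi := fun x => (ord_pred x.1, x.2)) (lk' s)); last exact: S.
by move=> v; rewrite /xi1.
Qed.
End Rotate.

Section Null.
Variables (m : nat) (R : comNzRingType) (W : nat -> gletter) (i0 : bool).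
Hypothesis Wnull : W m.+1 = Neg i0 0.
Notation last := (@ord_max m.+1).

Definition wd (c : 'I_m.+1) : 'I_m.+2 := widen_ord (leqnSn _) c.
Definition dl (c : 'I_m.+2) : 'I_m.+1 := inord c.
Definition wdn (v : cnode m.+1) : cnode m.+2 := (wd v.1, v.2).
Definition dln (v : cnode m.+2) : cnode m.+1 := (dl v.1, v.2).

Lemma wdK : cancel wd dl. Proof. exact: inord_val. Qed.
Lemma wd_inj : injective wd. Proof. exact: can_inj wdK. Qed.
Lemma wd_last c : (wd c == last) = false.
Proof. by rewrite -val_eqE /= ltn_eqF. Qed.
Lemma dlK (c : 'I_m.+2) : c != last -> wd (dl c) = c.
Proof.
move=> nl; apply: val_inj; rewrite /= inordK // ltn_neqAle -ltnS ltn_ord andbT.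
exact: nl.
Qed.
(** The default value of [inord] is the desired one: the trivial letter joins the last level to
    level 0. *)
Lemma dl_last : dl last = ord0.
Proof. by rewrite /dl /inord /insubd insubF //= ltnn. Qed.
Lemma wd_or (c : 'I_m.+2) : {k | c = wd k} + {c = last}.
Proof.
by case: (eqVneq c last) => [->|nl]; [right | left; exists (dl c); rewrite dlK].
Qed.
Lemma ordS_wd (c : 'I_m.+1) :
  ordS (wd c) = (if c == ord_max then last else wd (ordS c)).
Proof.
apply: val_inj; case: (eqVneq c ord_max) => [->|nl] /=; first by rewrite modn_small.
have := ordS_lt nl; rewrite /= => ->; rewrite modn_small //; have := ltn_ord (ordS c); rewrite ordS_lt //; lia.
Qed.
Lemma dl_ordS_wd (c : 'I_m.+1) : dl (ordS (wd c)) = ordS c.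
Proof. by rewrite ordS_wd; case: eqP => [->|_]; rewrite ?wdK ?dl_last ?ordS_last. Qed.

Definition ext (s : state m.+1) : state m.+2 :=
  [ffun k => if k == last then 0%N else s (dl k)].
Definition res (s : state m.+2) : state m.+1 := [ffun k => s (wd k)].

Lemma ext_wd s c : ext s (wd c) = s c.
Proof. by rewrite ffunE wd_last wdK. Qed.
Lemma ext_last s : ext s last = 0%N. Proof. by rewrite ffunE eqxx. Qed.
Lemma resK s : res (ext s) = s.
Proof. by apply/ffunP => k; rewrite ffunE ext_wd. Qed.
Lemma extK s : vst W s -> ext (res s) = s.
Proof.
move=> vs; apply/ffunP => k; case: (wd_or k) => [[c ->]|->].
  by rewrite ext_wd ffunE.
by rewrite ext_last; have := vs last; rewrite /= Wnull leqn0 => /eqP.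
Qed.
Lemma ext_upd s c j : ext (upd s c j) = upd (ext s) (wd c) j.
Proof.
apply/ffunP => k; case: (wd_or k) => [[d ->]|->].
  by rewrite ext_wd !ffunE wd_last wdK (inj_eq wd_inj).
by rewrite ext_last !ffunE eqxx eq_sym wd_last.
Qed.
Lemma dg_ext s c : dg W (ext s) (wd c) = dg W s c.
Proof. by rewrite !ffunE wd_last wdK. Qed.
Lemma dg_ext_last s : dg W (ext s) last = None.
Proof. by rewrite !ffunE eqxx. Qed.
Lemma ext_st0 s : (ext s == st0 _) = (s == st0 _).
Proof.
apply/eqP/eqP => [E|->].
  by rewrite -[s]resK E; apply/ffunP => k; rewrite !ffunE.
by apply/ffunP => k; rewrite !ffunE if_same.
Qed.

Lemma link_wd s c :
  link (dg W s) (fun x y => conn (dg W (ext s)) (wdn x) (wdn y)) c.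
Proof.
have E p : conn (dg W (ext s)) (ordS (wd c), p) (wd (ordS c), p).
  rewrite ordS_wd; case: eqP => [->|_]; last exact: conn_refl.
  have := link_conn (dg W (ext s)) last; rewrite /link dg_ext_last !ordS_last.
  have -> : wd ord0 = ord0 by apply: val_inj.
  by case: p => [[]|] [H1 H2 H3] //; rewrite conn_sym.
have := link_conn (dg W (ext s)) (wd c); rewrite /link dg_ext /wdn /=.
case: (dg W s c) => [i|] [H1 H2 H3]; split; rewrite //.
- by apply: conn_trans (E _); apply: conn_trans H2; rewrite conn_sym.
- by apply: conn_trans (E _).
- by apply: conn_trans (E _).
- by apply: conn_trans (E _).
- by apply: conn_trans H3; rewrite conn_sym.
Qed.
Lemma link_dl s c :
  link (dg W (ext s)) (fun x y => conn (dg W s) (dln x) (dln y)) c.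
Proof.
case: (wd_or c) => [[k ->]|->]; last first.
  rewrite /link dg_ext_last /dln /= ordS_last dl_last.
  have -> : dl ord0 = ord0 by rewrite -{1}(_ : wd ord0 = ord0) ?wdK //; apply: val_inj.
  by split; apply: conn_refl.
have := link_conn (dg W s) k; rewrite /link dg_ext /dln /= dl_ordS_wd wdK.
by case: (dg W s k).
Qed.
Lemma conn_ext s x y : conn (dg W (ext s)) (wdn x) (wdn y) = conn (dg W s) x y.
Proof.
apply/idP/idP; last exact: (conn_map (link_wd s)).
by move/(conn_map (link_dl s)); rewrite /dln /wdn /= !wdK -!surjective_pairing.
Qed.

Section Compare.
Variables (P : comNzRingType) (xi : cnode m.+2 -> P) (xi' : cnode m.+1 -> P).
Hypothesis xiE : forall v, xi (wdn v) = xi' v.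

Lemma cid_wd s x : cid xi (dg W (ext s)) (xi (ordS (wd x), None) - xi' (ordS x, None)).
Proof.
rewrite -xiE; apply: cid_conn.
have := link_wd s x; rewrite ordS_wd; case: eqP => [->|_ _]; last exact: conn_refl.
have := link_conn (dg W (ext s)) last; rewrite /link dg_ext_last !ordS_last.
have -> : wdn (ord0, None) = (ord0, None) by congr (_, _); apply: val_inj.
by case=> _ _ H3 _; rewrite conn_sym.
Qed.

Lemma Dc_ext Z s c :
  cid xi (dg W (ext s)) (Dc xi W Z (ext s) (wd c) - Dc xi' W (fun t => Z (ext t)) s c).
Proof.
rewrite /Dc ext_wd /=; case Ep: (pre _ _) => [j|]; last by rewrite subrr; apply: cideal0.
have -> : sg P (ext s) (wd c) = sg P s c.
  rewrite /sg big_mkcond big_ord_recr /= ltnNge ltnW //= addn0 [in RHS]big_mkcond; congr (_ ^+ _).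
  by apply: eq_bigr => k _; rewrite -[s k]ext_wd.
rewrite ext_upd -mulrBl mulrC -mulrBr mulrA; apply: cidealM.
have H := cid_wd s c.
have Hn : cid xi (dg W (ext s)) (mu xi (dg W (upd (ext s) (wd c) j)) (wd c) (side (W c))
   - mu xi' (dg W (upd s c j)) c (side (W c))).
  rewrite -ext_upd !muE.
  have -> : conn (dg W (upd s c j)) (c, Some (side (W c))) (ordS c, None) =
     conn (dg W (ext (upd s c j))) (wd c, Some (side (W c))) (ordS (wd c), None).
    rewrite -conn_ext /wdn /= conn_sym [RHS]conn_sym.
    have E : conn (dg W (ext (upd s c j))) (ordS (wd c), None) (wd (ordS c), None).
      move: (upd s c j) => t; rewrite ordS_wd; case: eqP => [->|_]; last exact: conn_refl.
      have := link_conn (dg W (ext t)) last; rewrite /link dg_ext_last !ordS_last.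
      have -> : wd ord0 = ord0 by apply: val_inj.
      by case=> _ _; rewrite conn_sym.
    by apply/idP/idP => H1; [apply: conn_trans H1 | apply: conn_trans H1; rewrite conn_sym].
  case: ifP => _; last by rewrite subrr; apply: cideal0.
  rewrite -[xi (wd c, _)]/(xi (wdn (c, _))) xiE opprD addrACA subrr add0r; exact: H.
rewrite /em ext_wd /=; case: (W c) Hn => [i|i k] Hn; first exact: Hn.
case: (s c) => [|j'] //.
rewrite -[xi (wd c, _)]/(xi (wdn (c, _))) xiE opprD addrACA subrr add0r -mulrBr.
exact: cidealM.
Qed.

Lemma sum_Dc_ext Z s : 
  cid xi (dg W (ext s)) (\sum_k Dc xi W Z (ext s) k - \sum_k Dc xi' W (fun t => Z (ext t)) s k).
Proof.
rewrite big_ord_recr /= {2}/Dc ext_last /= Wnull addr0 -sumrB; apply: cideal_sum => k _.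
exact: Dc_ext.
Qed.
End Compare.

Lemma null_delete : Bound m.+2 R W -> Bound m.+1 R W.
Proof.
move=> B P rho xi; pose xi1 v := xi (dln v).
have E v : xi1 (wdn v) = xi v by rewrite /xi1 /dln /= wdK -surjective_pairing.
have [Z S] := B P rho xi1; exists (fun t => Z (ext t)) => s vs c.
have vt : vst W (ext s).
  move=> k; case: (wd_or k) => [[d ->]|->]; first by rewrite ext_wd; apply: vs.
  by rewrite ext_last.
apply: (cid_map (link_dl s) (fun v => erefl (xi1 v))).
have ps : psiv xi1 (ext s) (wd c) = psiv xi s c.
  by rewrite /psiv ext_st0 -!E /wdn.
have := S _ vt (wd c); rewrite -/xi1 ps; apply: cideal_eqm.
by apply/cideal_sym/sum_Dc_ext.
Qed.

Lemma null_insert : Bound m.+1 R W -> Bound m.+2 R W.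
Proof.
move=> B P rho xi; pose xi0 v := xi (wdn v).
have [Z S] := B P rho xi0; exists (fun t => Z (res t)) => s vs c.
have vt : vst W (res s) by move=> k; rewrite ffunE; apply: (vs (wd k)).
suff H : cid xi (dg W s) (\sum_k Dc xi W (fun t => Z (res t)) s k - psiv xi s (wd ord0)).
  by apply: cideal_eqm H _; apply: psiv_level.
rewrite -(extK vs); set t := res s.
have ps : psiv xi (ext t) (wd ord0) = psiv xi0 t ord0 by rewrite /psiv ext_st0.
rewrite ps; apply: cideal_eqm (sum_Dc_ext _ _ _) _; first by [].
have -> : \sum_k Dc xi0 W (fun t => Z (res (ext t))) t k = \sum_k Dc xi0 W Z t k.
  by apply: eq_bigr => k _; rewrite /Dc; case: (pre _ _) => // j; rewrite resK.
exact: (cid_map (link_wd t) (fun v => erefl (xi0 v)) (S _ vt ord0)).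
Qed.
End Null.

Lemma Bound_ext M R (W W' : nat -> gletter) :
  (forall c : 'I_M, W c = W' c) -> Bound M R W -> Bound M R W'.
Proof.
move=> E B P rho xi; have [Z S] := B P rho xi; exists Z => s vs c.
have dgE t : dg W' t = dg W t :> diag M.
apply/ffunP => k; rewrite !ffunE. by rewrite E.
have vs' : vst W s by move=> k; rewrite E.
have := S s vs' c; rewrite dgE.
rewrite (eq_bigr (fun k => Dc xi W' Z s k)) // => k _.
rewrite /Dc E; case: (pre _ _) => // j; congr (_ * _ * _).
by rewrite /em E dgE.
Qed.

Definition BoundL (R : comNzRingType) (L : seq gletter) := Bound (size L) R (nth (Neg false 0) L).

Section Lists.
Variable R : comNzRingType.
Notation B := (BoundL R).
Implicit Types (L r l : seq gletter).

Lemma BoundL_rot1 x r : B (x :: r) -> B (rcons r x).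
Proof.
rewrite /BoundL size_rcons /=; apply: rotate => c.
rewrite nth_rcons; case: (eqVneq c ord_max) => [->|nl].
  by rewrite ordS_last /= ltnn eqxx.
by rewrite ordS_lt //= ltn_neqAle -ltnS ltn_ord andbT nl.
Qed.

Lemma BoundL_rot l r : B (l ++ r) -> B (r ++ l).
Proof.
elim: l r => [|x l IH] r; first by rewrite cats0.
by rewrite cat_cons => /BoundL_rot1; rewrite -cats1 -catA => /IH; rewrite -catA.
Qed.

Lemma BoundL_drop i j r : B (Pos i :: r) -> B (Neg j 0 :: r).
Proof. by apply: (drop_pos (c := ord0 : 'I_(size r).+1)) => // -[[|k] Hk]. Qed.

Lemma BoundL_null_del j r : (0 < size r)%N -> B (Neg j 0 :: r) -> B r.
Proof.
case: r => // x r _ /BoundL_rot1; rewrite /BoundL size_rcons /= => H.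
apply: Bound_ext (null_delete (i0 := j) _ H).
  by move=> c; rewrite -rcons_cons nth_rcons /= ltn_ord.
by rewrite -rcons_cons nth_rcons /= ltnn eqxx.
Qed.

Lemma BoundL_null_ins j r : (0 < size r)%N -> B r -> B (Neg j 0 :: r).
Proof.
case: r => // x r _ H; rewrite -cat1s; apply: BoundL_rot; rewrite cats1.
rewrite /BoundL size_rcons /=; apply: (null_insert (i0 := j)).
  by rewrite -rcons_cons nth_rcons /= ltnn eqxx.
apply: Bound_ext H => c; by rewrite -rcons_cons nth_rcons /= ltn_ord.
Qed.

Lemma BoundL_r2 (d i : bool) j0 j1 r :
  let x := if d then Pos i else Neg i 1 in let y := if d then Neg i 1 else Pos i in
  (B [:: x, y & r] -> B [:: Neg j0 0, Neg j1 0 & r]) *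
  (B [:: Neg j0 0, Neg j1 0 & r] -> B [:: x, y & r]).
Proof.
have E : ordS (ord0 : 'I_(size r).+2) = 1%N :> nat by rewrite /= modn_small.
have out k : k \notin X2 (ord0 : 'I_(size r).+2) -> exists k', k = k'.+2 :> nat.
  rewrite !inE -!val_eqE [val (ordS _)]E.
  by case: k => -[|[|k]] Hk //= _; exists k.
split; [apply: (r2_delete (c := ord0 : 'I_(size r).+2) isT (d := d) (i := i) (j0 := j0) (j1 := j1))
  | apply: (r2_insert (c := ord0 : 'I_(size r).+2) isT (d := d) (i := i) (j0 := j0) (j1 := j1))];
  rewrite ?E //= => k /out [k' ->] //.
Qed.

Lemma BoundL_merge i j k r :
  B [:: Neg i k, Neg i 1 & r] -> B [:: Neg i k.+1, Neg j 0 & r].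
Proof.
have E : ordS (ord0 : 'I_(size r).+2) = 1%N :> nat by rewrite /= modn_small.
apply: (twist_merge (c := ord0 : 'I_(size r).+2)); rewrite ?E //= => l.
rewrite !inE -!val_eqE [val (ordS _)]E.
by case: l => -[|[|l]] Hl.
Qed.

Lemma BoundL_r3 i r :
  B [:: Pos i, Pos (~~ i), Pos i & r] -> B [:: Pos (~~ i), Pos i, Pos (~~ i) & r].
Proof.
have E : ordS (ord0 : 'I_(size r).+3) = 1%N :> nat by rewrite /= modn_small.
have E2 : ordS (ordS (ord0 : 'I_(size r).+3)) = 2%N :> nat by rewrite /= !modn_small.
apply: (r3_move (c := ord0 : 'I_(size r).+3) isT (i := i)); rewrite ?E ?E2 //= => l.
rewrite !inE -!val_eqE [val (ordS (ordS _))]E2 [val (ordS _)]E.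
by case: l => -[|[|[|l]]] Hl.
Qed.
End Lists.

(** * The base case *)

Section Formal.
Variables (K : eqType) (R : comNzRingType) (h : K -> R).
Implicit Type F : seq (int * K).

(** Formal integer combinations of keys: that one of them cancels is decided by computation, and
    then holds for all rings and all values [h] of the keys. *)
Definition fev F : R := \sum_(x <- F) h x.2 *~ x.1.
Definition fscale (z : int) F := [seq (z * x.1, x.2) | x <- F].
Fixpoint fadd (x : int * K) F :=
  if F is y :: F' then if x.2 == y.2 then (x.1 + y.1, y.2) :: F' else y :: fadd x F'
  else [:: x].
Definition fzero F := all (fun x => x.1 == 0) (foldr fadd [::] F).

Lemma fev_cat F G : fev (F ++ G) = fev F + fev G.
Proof. by rewrite /fev big_cat. Qed.
Lemma fev_scale z F : fev (fscale z F) = fev F *~ z.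
Proof.
elim: F => [|x F IH]; first by rewrite /fev !big_nil mul0rz.
by rewrite /fev !big_cons -!/(fev _) IH mulrzDl /= [z * _]mulrC mulrzA.
Qed.
Lemma fev_flatten (I : Type) (r : seq I) (G : I -> seq (int * K)) :
  fev (flatten [seq G i | i <- r]) = \sum_(i <- r) fev (G i).
Proof.
elim: r => [|i r IH]; first by rewrite big_nil /fev big_nil.
by rewrite big_cons /= fev_cat IH.
Qed.
Lemma fev_zero F : fzero F -> fev F = 0.
Proof.
have Ea x G : fev (fadd x G) = h x.2 *~ x.1 + fev G.
  elim: G => [|y G IH] /=; first by rewrite /fev big_seq1 big_nil addr0.
  case: eqP => [E|_]; rewrite /fev !big_cons -!/(fev _) /=.
    by rewrite E mulrzDr addrA.
  by rewrite IH addrCA.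
have -> : fev F = fev (foldr fadd [::] F).
  by elim: F => //= x F IH; rewrite Ea -IH /fev big_cons.
move/allP => H; rewrite /fev big_seq big1 // => x /H /eqP ->.
by rewrite mulr0z.
Qed.
End Formal.

Definition mon (b : seq bool) : 'X_{1..8} := [multinom (nth false b i : nat) | i < 8].
(** The transpose of the multiplication by the variable [v], acting on functionals supported on
    squarefree monomials. *)
Definition fadj (v : nat) (F : seq (int * seq bool)) :=
  [seq (x.1, set_nth false x.2 v false) | x <- F & nth false x.2 v].
Definition coe (R : comNzRingType) (p : {mpoly R[8]}) (b : seq bool) : R := p@_(mon b).

Lemma fev_adj (R : comNzRingType) (p : {mpoly R[8]}) (v : 'I_8) F : fev (coe p) (fadj v F) = fev (coe ('X_v * p)) F.
Proof.
rewrite /fev big_map big_filter big_mkcond; apply: eq_bigr => -[z b] _ /=.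
rewrite /coe mulrC; case: ifP => bv; last first.
  rewrite (_ : _@_ _ = 0) ?mul0rz //; apply/eqP.
  rewrite mcoeff_eq0 (perm_mem (msuppMX _ _)); apply/mapP => -[m _ E].
  by move/(congr1 (fun m : 'X_{1..8} => m v)): E; rewrite mnmDE mnm1E eqxx mnmE bv.
rewrite -(mcoeffMX p U_(v)); congr (_@_ _ *~ _); apply/mnmP => i.
rewrite mnmDE mnm1E !mnmE nth_set_nth /= (eq_sym v) -val_eqE.
by case: eqP => // ->; rewrite bv.
Qed.

Lemma fev_sqr (R : comNzRingType) (u : {mpoly R[8]}) (v : 'I_8) F :
  fev (coe (u * 'X_v ^+ 2)) F = 0.
Proof.
rewrite mulrC expr2 -mulrA -!fev_adj /fadj /fev !big_map filter_map big_map.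
rewrite -filter_predI (eq_filter (a2 := pred0)) ?filter_pred0 ?big_nil // => y /=.
by rewrite nth_set_nth /= eqxx.
Qed.

Lemma coeB (R : comNzRingType) (p q : {mpoly R[8]}) F : fev (coe (p - q)) F = fev (coe p) F - fev (coe q) F.
Proof. by rewrite /fev -sumrB; apply: eq_bigr => x _; rewrite /coe mcoeffB mulrzBl. Qed.
Lemma coeD (R : comNzRingType) (p q : {mpoly R[8]}) F : fev (coe (p + q)) F = fev (coe p) F + fev (coe q) F.
Proof. by rewrite /fev -big_split; apply: eq_bigr => x _; rewrite /coe mcoeffD mulrzDl. Qed.
Lemma coe0 (R : comNzRingType) F : fev (coe (0 : {mpoly R[8]})) F = 0.
Proof. by rewrite /fev big1 // => x _; rewrite /coe mcoeff0 mul0rz. Qed.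
Lemma coe_sum (R : comNzRingType) (I : Type) (r : seq I) (G : I -> {mpoly R[8]}) F :
  fev (coe (\sum_(i <- r) G i)) F = \sum_(i <- r) fev (coe (G i)) F.
Proof. exact: (big_morph (fun p => fev (coe p) F) (fun p q => coeD p q F) (coe0 R F)). Qed.
Lemma coe_sign (R : comNzRingType) n (p : {mpoly R[8]}) F :
  fev (coe ((-1) ^+ n * p)) F = fev (coe p) (fscale ((-1) ^+ n) F).
Proof.
rewrite fev_scale -signr_odd -[in RHS]signr_odd; case: (odd n); last by rewrite mul1r.
by rewrite mulN1r -[- p]sub0r coeB coe0 sub0r mulrN1z.
Qed.

(* [nxt] on untyped nodes, so that connectivity can be computed. *)
Definition nnode := (nat * option bool)%type.
Definition nxtN (M : nat) (u : nat -> option bool) (x : nnode) : nnode :=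
  match x with
  | (c, Some i) => if u c == Some i then (c, None) else (c.+1 %% M, Some i)%N
  | (c, None) => let c' := ((c + M).-1 %% M)%N in
                 if u c' is Some i then (c, Some i) else (c', None)
  end.
Definition enc M (x : cnode M) : nnode := (nat_of_ord x.1, x.2).

Section Enc.
Variables (M : nat) (U : diag M) (u : nat -> option bool).
Hypothesis Uu : forall c : 'I_M, U c = u c.
Lemma enc_inj : injective (@enc M).
Proof. by move=> [c p] [d q] [/val_inj -> ->]. Qed.
Lemma enc_nxt x : enc (nxt U x) = nxtN M u (enc x).
Proof.
by case: x => c [i|]; rewrite /enc /= Uu; [case: ifP | case: (u _)].
Qed.
(** There are [M * 3] nodes, so a trajectory of that length runs through the whole cycle. *)
Lemma connN x y : conn U x y = (enc y \in traject (nxtN M u) (enc x) (M * 3)).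
Proof.
have it i : enc ((dperm U ^+ i)%g x) = iter i (nxtN M u) (enc x).
  elim: i => [|i IH]; first by rewrite perm1.
  by rewrite expgSr permM dpermE enc_nxt IH.
apply/idP/idP; last first.
  by move/trajectP => [i _]; rewrite -it => /enc_inj ->; apply: mem_porbit.
rewrite /conn porbit_traject => /trajectP [i li ->].
apply/trajectP; exists i; last by rewrite -it permX.
apply: leq_trans li _; apply: leq_trans (max_card _) _.
by rewrite card_prod card_ord card_option card_bool.
Qed.
End Enc.

(* Identifications of node variables under which the functional below exists. *)
Definition clsN (x : nnode) : nat :=
  let r := nth [::] [:: [:: 0; 1; 2]; [:: 3; 4; 2]; [:: 3; 4; 2]; [:: 3; 4; 2];
                        [:: 3; 5; 6]; [:: 0; 7; 6]]%N x.1 in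
  nth 0%N r (match x.2 with Some false => 0 | None => 1 | Some true => 2 end)%N.

Fixpoint bits n : seq (seq bool) :=
  if n is n'.+1 then [seq false :: b | b <- bits n'] ++ [seq true :: b | b <- bits n']
  else [:: [::]].
Definition wt (b : seq bool) : nat := count id b.
Definition stN (b : seq bool) (j c : nat) : nat := if (c < 5)%N then (nth false b c : nat) else j.
Definition sideN (c : nat) : bool := c \in [:: 2; 3; 5]%N.
Definition diaN b j c : option bool := if stN b j c == 0%N then None else Some (sideN c).

Definition nodesN : seq nnode := [seq (c, p) | c <- iota 0 6, p <- [:: Some false; None; Some true]].

(* Signs found by solving the linear system expressed by [totalN_zero]. *)
Definition certN (b : seq bool) : int :=
  let v := foldl (fun a (x : bool) => a.*2 + x)%N 0%N b in
  if v \in [:: 0; 3; 13; 15; 18; 22; 25; 27; 30]%N then 1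
  else if v \in [:: 2; 14; 17; 19; 21; 23; 26; 29; 31]%N then -1 else 0.

(** Representatives of the connected classes of variables, by three rounds of merging. The outcome
    is validated through the computations [kills_nxtP], [totalN_zero] and [traceN_psi]. *)
Definition repsN (b : seq bool) : seq nat :=
  let u := diaN b (wt b) in
  let step rep (x : nnode) :=
    let p := nth 0%N rep (clsN x) in let q := nth 0%N rep (clsN (nxtN 6 u x)) in
    [seq if z == maxn p q then minn p q else z | z <- rep] in
  iter 3 (fun rep => foldl step rep nodesN) (iota 0 8).

(* The functional on state [b]: [certN b] times the sum of the coefficients of the
   squarefree monomials with one variable in each class of connected variables. *)
Definition traceN (b : seq bool) : seq (int * seq bool) :=
  if certN b == 0 then [::] else
  let rep := repsN b in
  [seq (certN b, m) | m <- bits 8 & all (fun q =>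
     count id [seq (nth 0%N rep i == q) && nth false m i | i <- iota 0 8] == 1%N) rep].

Definition sgnz (n : nat) : int := if odd n then -1 else 1.

Definition saddleN (u : nat -> option bool) (c : nat) F : seq (int * seq bool) :=
  let a := (c, Some (sideN c)) in let d := (c.+1 %% 6, None)%N in
  if d \in traject (nxtN 6 u) a 18 then fadj (clsN a) F ++ fadj (clsN d) F else F.

(** The functional of state [b] composed with the arrow at level [k]. A key [(r, m)] stands for the
    coefficient of [m] in the unknown chain at the state with bits [r] and twist position
    [(wt r).+1]; these are the states of degree -1, just as [b] with position [wt b] has degree
    0. *)
Definition edgeN (b : seq bool) (F : seq (int * seq bool)) (k : nat) :
    seq (int * (seq bool * seq bool)) :=
  if (k < 5)%N then
    if nth false b k then
      let r := set_nth false b k false in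
      [seq (x.1, (r, x.2)) | x <- fscale (sgnz (wt (take k b))) (saddleN (diaN r (wt b)) k F)]
    else [::]
  else [seq (x.1, (b, x.2)) | x <- fscale (sgnz (wt b))
         (if wt b == 0%N then saddleN (diaN b 1) 5 F
          else fadj (clsN (5, None)%N) F ++ fscale (sgnz (wt b)) (fadj (clsN (0, None)%N) F))].

Definition totalN :=
  flatten [seq let F := traceN b in flatten [seq edgeN b F k | k <- iota 0 6] | b <- bits 5].

Definition kills_nxt (b : seq bool) : bool :=
  let F := traceN b in
  all (fun x => fzero (fadj (clsN x) F ++
                       fscale (-1) (fadj (clsN (nxtN 6 (diaN b (wt b)) x)) F))) nodesN.

(** The functional vanishes on boundaries: each coefficient of the unknown chain occurs with total
    weight 0. The keys do not involve [n]. *)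
Lemma totalN_zero : fzero totalN. Proof. by vm_cast_no_check (erefl true). Qed.
(** The functional respects the relations along circles; the relations [x^2 = 0] are respected
    because only squarefree monomials are read. *)
Lemma kills_nxtP : all kills_nxt (bits 5). Proof. by vm_cast_no_check (erefl true). Qed.
Lemma traceN_psi : fadj 2 (fadj 1 (fadj 0 (traceN (nseq 5 false)))) = [:: (1, nseq 8 false)].
Proof. by vm_compute. Qed.

Lemma bits_size n b : b \in bits n -> size b = n.
Proof.
elim: n b => [|n IH] b /=; first by rewrite inE => /eqP ->.
by rewrite mem_cat => /orP [] /mapP [c /IH <- ->].
Qed.

Lemma sgnzE n : sgnz n = (-1) ^+ n.
Proof. by rewrite /sgnz -signr_odd; case: (odd n). Qed.

Lemma wt_set b k : nth false b k -> (wt (set_nth false b k false)).+1 = wt b.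
Proof.
elim: b k => [|x b IH] [|k] //=; first by move=> ->.
by rewrite /wt /= => /IH; rewrite /wt => <-; rewrite addnS.
Qed.

Lemma wt_take b k : wt (take k b) = (\sum_(l < size b | (l < k)%N) nth false b l)%N.
Proof.
elim: b k => [|x b IH] [|k] //=; rewrite ?big_ord0 //; first by rewrite big_pred0.
by rewrite /wt /= -/(wt _) IH [RHS]big_mkcond big_ord_recl /= big_mkcond.
Qed.

Section Base.
Variables (R : comNzRingType) (n : nat).
Definition baseL := [:: Pos false; Pos false; Pos true; Pos true; Pos false; Neg true n].
Notation W := (nth (Neg false 0) baseL).
Notation P := {mpoly R[8]}.

Definition cls (v : cnode 6) : 'I_8 := inord (clsN (enc v)).
Definition xic (v : cnode 6) : P := 'X_(cls v).

Lemma nodesNP (v : cnode 6) : enc v \in nodesN.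
Proof.
case: v => c p; apply/allpairsP; exists (nat_of_ord c, p); split=> //=.
  by case: c => -[|[|[|[|[|[|c]]]]]].
by case: p => [[]|].
Qed.

Lemma clsE v : cls v = clsN (enc v) :> nat.
Proof.
rewrite inordK //; have : all (fun x => clsN x < 8)%N nodesN by [].
by move/allP; apply; apply: nodesNP.
Qed.

Definition st b j : state 6 := [ffun c : 'I_6 => stN b j c].

Lemma dg_st b j (c : 'I_6) : dg W (st b j) c = diaN b j c.
Proof.
rewrite !ffunE /tl /diaN; case: eqP => // _; congr Some.
by case: c => -[|[|[|[|[|[|c]]]]]].
Qed.

Lemma trace_cid b p : b \in bits 5 -> cid xic (dg W (st b (wt b))) p ->
  fev (coe p) (traceN b) = 0.
Proof.
move=> bb; elim=> [|u x q _ IH|u x q _ IH]; rewrite ?coe0 // coeD IH addr0.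
  rewrite mulrC mulrBl coeB -!fev_adj !clsE dpermE (enc_nxt (dg_st b _)).
  have /allP/(_ _ (nodesNP x)) := allP kills_nxtP _ bb.
  by move/(fev_zero (coe u)); rewrite fev_cat fev_scale mulrN1z.
exact: fev_sqr.
Qed.

Variable Z : state 6 -> P.

(** The value 0 beyond the end of the twist specializes the computation, made for an unlimited
    twist, to [n] crossings. *)
Definition Zr (r : seq bool) : P := if (wt r < n)%N then Z (st r (wt r).+1) else 0.
Definition hr (x : seq bool * seq bool) : R := coe (Zr x.1) x.2.

Lemma hrE r F : fev hr [seq (x.1, (r, x.2)) | x <- F] = fev (coe (Zr r)) F.
Proof. by rewrite /fev big_map. Qed.

Lemma saddle_coe b j (c : 'I_6) F p :
  fev (coe (mu xic (dg W (st b j)) c (side (W c)) * p)) F = fev (coe p) (saddleN (diaN b j) c F).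
Proof.
have sE : side (W c) = sideN c by case: c => -[|[|[|[|[|[|c]]]]]].
rewrite muE (connN (dg_st b j)) sE /saddleN.
rewrite -[enc (c, _)]/(nat_of_ord c, Some (sideN c)) -[enc (ordS c, None)]/(c.+1 %% 6, None)%N.
case: ifP => _; last by rewrite mul1r.
by rewrite mulrDl coeD fev_cat -!fev_adj !clsE.
Qed.

(** Such a state lies beyond the end of the twist; the sources of the arrows into it do so as
    well. *)
Lemma edge_small b k : (n < wt b)%N -> fev hr (edgeN b (traceN b) k) = 0.
Proof.
move=> nb; rewrite /edgeN; case: ifP => _.
  case: ifP => bk; last by rewrite /fev big_nil.
  by rewrite hrE /Zr ltnNge -ltnS wt_set // (leq_trans nb) ?leqnn // coe0.
by rewrite hrE /Zr ltnNge ltnW // coe0.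
Qed.

Lemma edge_coe b (k : 'I_6) : b \in bits 5 -> (wt b <= n)%N ->
  fev (coe (Dc xic W Z (st b (wt b)) k)) (traceN b) = fev hr (edgeN b (traceN b) k).
Proof.
move=> bb bn; rewrite /Dc; set s := st _ _.
have sz := bits_size bb.
have sk : s k = stN b (wt b) k by rewrite ffunE.
have sgE : sg P s k = (-1) ^+ (if (k < 5)%N then wt (take k b) else wt b).
  rewrite /sg; congr (_ ^+ _); rewrite -[wt b](congr1 wt (take_size b)) sz.
  rewrite -(fun_if (fun k => wt (take k b))) wt_take sz.
  rewrite big_mkcond big_ord_recr /= [RHS]big_mkcond /= [(5 < k)%N]ltnNge -ltnS ltn_ord addn0.
  apply: eq_bigr => l _; rewrite !ffunE /stN /= ltn_ord.
  case: (ltnP k 5) => k5; first by []. by rewrite (leq_trans (ltn_ord l) k5) ltn_ord.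
rewrite /edgeN sk {1}/stN; case: ifP sgE => k5 sgE.
  have Wk : W k = Pos (sideN k) by case: (k) k5 => -[|[|[|[|[|[|c]]]]]].
  rewrite Wk /=; case bk: (nth false b k); last by rewrite coe0 /fev big_nil.
  have Es : upd s k 0%N = st (set_nth false b k false) (wt b).
    apply/ffunP => l; rewrite !ffunE /stN nth_set_nth /=.
    by case: (eqVneq l k) => [->|]; [rewrite k5 eqxx | rewrite -val_eqE => /negPf ->].
  have -> : (nat_of_bool true == 1%N) = true by [].
  rewrite /em Wk Es sgE -mulrA coe_sign fev_scale -[sideN k]/(side (Pos (sideN k))) -Wk saddle_coe.
  by rewrite hrE /Zr -ltnS wt_set // ltnS bn sgnzE fev_scale.
have k5' : k = 5%N :> nat by have := ltn_ord k; lia.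
have Wk : W k = Neg true n by rewrite k5'.
rewrite Wk [pre _ _]/= hrE /Zr; case: ltnP => bn'; last by rewrite !coe0.
have Es j : upd s k j = st b j.
  apply/ffunP => l; rewrite !ffunE /stN.
  case: (eqVneq l k) => [->|]; rewrite ?k5 // -val_eqE /= k5' => l5.
  by rewrite ltn_neqAle l5 -ltnS ltn_ord.
rewrite Es /em Wk sk sgE -mulrA coe_sign sgnzE !fev_scale /stN k5; congr (_ *~ _).
case Eb: (wt b) => [|j'] /=.
  by rewrite Es -[true]/(side (Neg true n)) -Wk saddle_coe k5'.
rewrite mulrDl coeD -mulrA coe_sign fev_cat !fev_scale -!fev_adj !clsE.
by rewrite /enc /= k5'.
Qed.


Lemma trace_psi b : b \in bits 5 ->
  fev (coe (psiv xic (st b (wt b)) ord0)) (traceN b) = (b == nseq 5 false)%:R.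
Proof.
move=> bb; rewrite /psiv; have -> : (st b (wt b) == st0 6) = (b == nseq 5 false).
  apply/eqP/eqP => [E|->]; last first.
    by apply/ffunP => c; rewrite !ffunE /stN; case: c => -[|[|[|[|[|[|c]]]]]].
  apply: (@eq_from_nth _ false); rewrite (bits_size bb) // => c c5.
  have := congr1 (fun s : state 6 => s (inord c)) E; rewrite !ffunE /stN inordK ?c5; last exact: leqW.
  by rewrite nth_nseq c5; case: nth.
case: eqP => [->|_]; last by rewrite coe0.
rewrite -[_ * _]mulr1 [xic _ * _]mulrC -!mulrA -!fev_adj !clsE.
rewrite [X in fev _ X](_ : _ = [:: (1, nseq 8 false)]); last exact: traceN_psi.
rewrite /fev big_seq1 /coe mcoeff1 (_ : mon _ = 0%MM) ?eqxx //.
by apply/mnmP => i; rewrite !mnmE nth_nseq if_same.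
Qed.
End Base.

(** Pairing the equation [D Z = psi] with the functional gives [0 = 1]: [E0] uses that it descends
    to the quotients, [E1] rewrites the boundary part as [totalN], and [E2] is its value on psi. *)
Lemma not_BoundL_base R n : ~ BoundL R (baseL n).
Proof.
move=> /(_ {mpoly R[8]} (@mpolyC 8 R : {rmorphism R -> {mpoly R[8]}}) (xic R)) [Z S].
have vs b : (wt b <= n)%N -> vst (nth (Neg false 0) (baseL n)) (st b (wt b)).
  move=> bn c; rewrite ffunE /stN.
  by case: c => -[|[|[|[|[|[|c]]]]]] Hc //=; case: nth.
have E0 : \sum_(b <- bits 5 | (wt b <= n)%N) fev (coe (\sum_k Dc (xic R)
    (nth (Neg false 0) (baseL n)) Z (st b (wt b)) k - psiv (xic R) (st b (wt b)) ord0)) (traceN b) = 0.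
  rewrite big_seq_cond; apply: big1 => b /andP [bb bn]; apply: trace_cid bb _.
  exact: S (vs _ bn) ord0.
have E1 : \sum_(b <- bits 5 | (wt b <= n)%N) fev (coe (\sum_k Dc (xic R)
    (nth (Neg false 0) (baseL n)) Z (st b (wt b)) k)) (traceN b) = fev (hr n Z) totalN.
  rewrite /totalN fev_flatten big_mkcond !big_seq; apply: eq_bigr => b bb.
  rewrite [RHS](fev_flatten (hr n Z) (iota 0 6) (edgeN b (traceN b))).
  rewrite -[iota 0 6]/(index_iota 0 6) big_mkord.
  case: leqP => bn; last by rewrite big1 // => k _; apply: edge_small.
  by rewrite coe_sum; apply: eq_bigr => k _; apply: edge_coe.
have E2 : \sum_(b <- bits 5 | (wt b <= n)%N) fev (coe (psiv (xic R) (st b (wt b)) ord0)) (traceN b) = 1.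
  rewrite big_seq_cond (eq_bigr (fun b => (b == nseq 5 false)%:R)); last first.
    by move=> b /andP [bb _]; apply: trace_psi.
  rewrite -big_seq_cond big_cons /= big_seq_cond big1 ?addr0 // => b /andP [bb _].
  by case: eqP bb => // ->.
move: E0; under eq_bigr do rewrite coeB; rewrite sumrB E1 E2.
rewrite (fev_zero _ totalN_zero) sub0r => /eqP; rewrite oppr_eq0; apply/negP/oner_neq0.
Qed.

(** The closure consists of three separate circles without any arrow; squares are the only
    nontrivial relations, and the coefficient of [x_0 x_1 x_2] detects psi. *)
Lemma not_BoundL_null (R : comNzRingType) : ~ BoundL R [:: Neg false 0].
Proof.
pose k (p : option bool) : 'I_8 := inord (clsN (0%N, p)).
have kE p : k p = clsN (0%N, p) :> nat by rewrite inordK //; case: p => [[]|].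
pose xi (v : cnode 1) : {mpoly R[8]} := 'X_(k v.2).
move=> /(_ {mpoly R[8]} (@mpolyC 8 R : {rmorphism R -> {mpoly R[8]}}) xi) [Z S].
have /S/(_ ord0) : vst (nth (Neg false 0) [:: Neg false 0]) (st0 1) by move=> c; rewrite ffunE.
pose F : seq (int * seq bool) := [:: (1, nseq 3 true)].
rewrite big_ord1 /Dc ffunE /= sub0r /psiv eqxx => /cidealN; rewrite opprK => H.
have : fev (coe (xi (ord0, None) * xi (ord0, Some false) * xi (ord0, Some true))) F = 0.
  elim: H => [|u x q _ IH|u x q _ IH]; rewrite ?coe0 // coeD IH addr0.
    rewrite dpermE (_ : nxt _ x = x) ?subrr ?mulr0 ?coe0 //.
    by case: x => c [i|]; rewrite /nxt ?ffunE ?ord1 //= !ffunE [ord_pred _]ord1.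
  exact: fev_sqr.
rewrite -[_ * _]mulr1 -!mulrA -!fev_adj !kE /fev /= big_seq1 /coe mcoeff1.
rewrite (_ : mon _ = 0%MM) ?eqxx; last first.
  by apply/mnmP => i; rewrite !mnmE; case: i => -[|[|[|i]]] //= _; rewrite nth_nil.
by move/eqP; rewrite oner_eq0.
Qed.

(** * Braid words *)

Local Close Scope ring_scope.
Definition gl (x : letter) : gletter := if x.2 then Pos (x.1 == 2) else Neg (x.1 == 2) 1.

Lemma braid_eq_ctx n l r u v : braid_eq n u v -> braid_eq n (l ++ u ++ r) (l ++ v ++ r).
Proof.
elim=> [_ _ [l' r' x y H]|x|x y _ IH|x y z _ IH1 _ IH2].
- by apply: rst_step; rewrite -!catA catA [X in braid_step _ _ X]catA; apply: bstep.
- exact: rst_refl.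
- exact: rst_sym.
- exact: rst_trans IH1 IH2.
Qed.

Section Words.
Variable R : comNzRingType.
Notation B := (BoundL R).

(** The trivial letter keeps the cyclic word nonempty, even for the empty braid word. *)
Definition BoundW (w : bword) := B (Neg false 0 :: map gl w).

(** By rotation the subword to be replaced may be brought to the front. *)
Lemma BoundW_ctx x y :
  (forall r, (0 < size r)%N -> B (map gl x ++ r) -> B (map gl y ++ r)) ->
  forall l r, BoundW (l ++ x ++ r) -> BoundW (l ++ y ++ r).
Proof.
move=> H l r; rewrite /BoundW !map_cat -!cat_cons => /BoundL_rot; rewrite -catA => /H.
rewrite size_cat addnS => /(_ isT); rewrite catA => /BoundL_rot.
by rewrite catA.
Qed.

Lemma BoundL_null2 j0 j1 r : (0 < size r)%N ->
  (B [:: Neg j0 0, Neg j1 0 & r] -> B r) * (B r -> B [:: Neg j0 0, Neg j1 0 & r]).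
Proof.
move=> r0; split=> H; last by do 2! apply: BoundL_null_ins => //.
exact: BoundL_null_del r0 (BoundL_null_del _ H).
Qed.

Lemma BoundW_relator x y : relator 3 x y ->
  forall l r, BoundW (l ++ x ++ r) <-> BoundW (l ++ y ++ r).
Proof.
case=> [i b _|i j b c Hi Hj Hij|i Hi Hi'] l r.
- have E q : map gl [:: (i, b); (i, ~~ b)] ++ q =
    [:: if b then Pos (i == 2) else Neg (i == 2) 1,
        if b then Neg (i == 2) 1 else Pos (i == 2) & q] by case: b.
  split; apply: BoundW_ctx => q q0; rewrite E.
    by move/(fst (BoundL_r2 _ _ _ false false _)) => H; apply: (fst (BoundL_null2 _ _ q0)) H.
  move/(snd (BoundL_null2 false false q0)); exact: (snd (BoundL_r2 _ _ _ _ _ _)).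
- lia.
- have -> : i = 1 by lia.
  split; apply: BoundW_ctx => q _ /=; exact: BoundL_r3.
Qed.

Lemma BoundW_braid_eq u v : braid_eq 3 u v -> BoundW u <-> BoundW v.
Proof.
elim=> [_ _ [l r x y H]|x|x y _ IH|x y z _ IH1 _ IH2] //.
- exact: BoundW_relator.
- by rewrite IH.
- by rewrite IH1.
Qed.

Lemma BoundW_negs v l r : BoundW (l ++ v ++ r) -> BoundW (l ++ filter (fun x => ~~ x.2) v ++ r).
Proof.
elim: v l => // -[i [|]] v IH l /=; last first.
  by rewrite -[_ :: v ++ r]cat1s catA => /IH; rewrite -catA.
move=> H; apply: IH; move: (v ++ r) H => {}r.
apply: (BoundW_ctx (x := [:: (i, true)]) (y := [::])) => q q0 /= /BoundL_drop -/(_ false).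
exact: BoundL_null_del.
Qed.

Lemma BoundW_pos l v r : all (fun x => x.2) v -> BoundW (l ++ v ++ r) -> BoundW (l ++ r).
Proof.
move=> /allP H /BoundW_negs; rewrite (eq_in_filter (a2 := pred0)) ?filter_pred0 //.
by move=> x /H ->.
Qed.

Lemma BoundL_merge_pow i k n r : (0 < size r)%N ->
  B (Neg i k :: nseq n (Neg i 1) ++ r) -> B (Neg i (k + n) :: r).
Proof.
move=> r0; elim: n k => [|n IH] k; first by rewrite addn0.
move/(BoundL_merge (j := false)) => H; rewrite addnS -addSn; apply: IH.
move: H; rewrite -cat1s => /BoundL_rot; rewrite cat_cons => /BoundL_null_del.
rewrite !size_cat addn1 => /(_ isT) H; exact: (@BoundL_rot _ _ [:: _] H).
Qed.

End Words.

Notation sa := (1%N, true).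
Notation sb := (2, true).
Notation sB := (2, false).

Lemma full_twist3 : full_twist 3 = [:: sa; sb; sa; sb; sa; sb]. Proof. by []. Qed.

Lemma aba_bab l r : braid_eq 3 (l ++ [:: sa; sb; sa] ++ r) (l ++ [:: sb; sa; sb] ++ r).
Proof. by apply: rst_step; apply: bstep; apply: (@rel_braid 3 1). Qed.

Lemma full_twist_B : braid_eq 3 (full_twist 3 ++ [:: sB]) (sB :: full_twist 3).
Proof.
have cb : braid_eq 3 (sb :: full_twist 3) (full_twist 3 ++ [:: sb]).
  apply: rst_trans (rst_sym _ _ _ _ (aba_bab [::] [:: sa; sb; sa; sb])) _.
  exact: (aba_bab [:: sa; sb; sa] [:: sb]).
have can l r b : braid_eq 3 (l ++ [:: (2, b); (2, ~~ b)] ++ r) (l ++ [::] ++ r).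
  by apply: rst_step; apply: bstep; apply: rel_cancel.
apply: rst_trans (rst_sym _ _ _ _ (can [::] (full_twist 3 ++ [:: sB]) false)) _.
apply: rst_trans (braid_eq_ctx [:: sB] [:: sB] cb) _.
by have := can (sB :: full_twist 3) [::] true; rewrite !cats0.
Qed.

Lemma full_twist_Bs p : braid_eq 3 (full_twist 3 ++ nseq p sB) (nseq p sB ++ full_twist 3).
Proof.
elim: p => [|p IH]; first by rewrite cats0; apply: rst_refl.
have := braid_eq_ctx [::] (nseq p sB) full_twist_B; rewrite /= => H.
apply: rst_trans H _; have := braid_eq_ctx [:: sB] [::] IH; by rewrite !cats0.
Qed.

Lemma nseq_filter_neg v : all (valid_letter 3) v -> (1, false) \notin v ->
  exists p, filter (fun x : letter => ~~ x.2) v = nseq p sB.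
Proof.
elim: v => [|[i [|]] v IH] /=; first by exists 0.
  by move=> /andP [_ /IH H]; rewrite inE negb_or => /andP [_ /H].
move=> /andP [Hi /IH H]; rewrite inE negb_or xpair_eqE andbT => /andP [n1 /H [p ->]].
by exists p.+1; move: Hi n1; case: i => [|[|[|i]]].
Qed.

Lemma BoundW_reduce R k v : all (valid_letter 3) v -> (1, false) \notin v -> (1, true) \in v ->
  BoundW R (wpow (full_twist 3) k.+1 ++ v) ->
  exists n, BoundL R [:: Pos false; Pos false; Pos true; Pos true; Pos false; Neg true n].
Proof.
move: (full_twist 3) full_twist_Bs full_twist3 => FT FTB EFT.
have -> : wpow FT k.+1 = FT ++ wpow FT k by [].
move=> vv nv /splitPr E; case: E vv nv => v1 v2.
rewrite all_cat mem_cat negb_or inE negb_or [all _ (_ :: _)]/= => /andP [vv1 vv2] /andP [nv1 nv2].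
have [p Ep] := nseq_filter_neg vv1 nv1; have [q Eq] := nseq_filter_neg vv2 nv2.
have allFT : all (fun x : letter => x.2) (wpow (FT) k).
  by rewrite EFT; elim: k.
rewrite -!catA => H0.
have {allFT}H1 := BoundW_pos allFT H0.
have H2 := BoundW_negs H1; rewrite {}Ep in H2.
have {}H2 : BoundW R ((FT ++ nseq p sB ++ [:: sa]) ++ v2 ++ [::]).
  by rewrite cats0 -!catA.
have {}H2 := BoundW_negs H2; rewrite {}Eq cats0 -!catA in H2.
(* One full twist is left, and of the two pieces of [v] around [a] only powers of [b^-1]. Moving the
   twist next to [a] gives [abababa], and deleting its second and fifth letters leaves [aabba]. *)
have [H _] := BoundW_braid_eq R (braid_eq_ctx [::] ([:: sa] ++ nseq q sB) (FTB p)).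
move: H; rewrite !cat0s -!catA => /(_ H2) H.
have {H H2}H2 : BoundW R ((nseq p sB ++ [:: sa]) ++ [:: sb] ++ [:: sa; sb; sa; sb; sa] ++ nseq q sB).
  by move: H; rewrite EFT -!catA.
have {}H2 : BoundW R ((nseq p sB ++ [:: sa; sa; sb]) ++ [:: sa] ++ [:: sb; sa] ++ nseq q sB).
  by move: (BoundW_pos (v := [:: sb]) isT H2); rewrite -!catA.
have {H2} : BoundW R (nseq p sB ++ [:: sa; sa; sb; sb; sa] ++ nseq q sB).
  by move: (BoundW_pos (v := [:: sa]) isT H2); rewrite -!catA.
move=> b {H0 H1}; exists (q + p); move: b; rewrite /BoundW !map_cat !map_nseq => /BoundL_null_del.
rewrite !size_cat addnS => /(_ isT)/BoundL_rot; rewrite -catA => /BoundL_rot.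
rewrite -nseqD => /(BoundL_null_ins (j := true)); rewrite size_cat addnS => /(_ isT) H.
apply: (@BoundL_rot _ [:: Neg true (q + p)] [:: Pos false; Pos false; Pos true; Pos true; Pos false]).
exact: (@BoundL_merge_pow _ _ 0).
Qed.

Lemma BoundW_positive R v : all (fun x : letter => x.2) v -> BoundW R v -> BoundL R [:: Neg false 0].
Proof.
by move=> pv H; apply: (@BoundW_pos R [::] v [::] pv); rewrite cats0.
Qed.
Local Open Scope ring_scope.

(** * Comparison with the Khovanov complex *)

Section Bridge.
Variable w : bword.
Hypothesis vw : valid_word 3 w.
Notation N := (size w).
Notation W := (nth (Neg false 0) (rcons (map gl w) (Neg false 0))).

Definition pos_of (p : 'I_3) : option bool :=
  if p == 0%N :> nat then Some false else if p == 1%N :> nat then None else Some true.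
Definition of_pos (p : option bool) : 'I_3 :=
  match p with Some false => inord 0 | None => inord 1 | Some true => inord 2 end.
Lemma pos_ofK : cancel pos_of of_pos.
Proof.
by case=> -[|[|[|p]]] Hp //; apply: val_inj; rewrite /= inordK.
Qed.
Lemma of_posK : cancel of_pos pos_of.
Proof. by case=> [[]|]; rewrite /pos_of /= inordK. Qed.

(** The levels agree as they stand: the trivial letter appended to the word provides the closure
    arcs from level [N] to level 0. *)
Definition nd (x : node 3 w) : cnode N.+1 := (x.1, pos_of x.2).
Definition dn (x : cnode N.+1) : node 3 w := (x.1, of_pos x.2).
Lemma fst_dn l p : (dn (l, p)).1 = l. Proof. by []. Qed.
Lemma snd_dn l p : (dn (l, p)).2 = of_pos p. Proof. by []. Qed.
Lemma ndK : cancel nd dn. Proof. by case=> l p; rewrite /nd /dn /= pos_ofK. Qed.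
Lemma dnK : cancel dn nd. Proof. by case=> l p; rewrite /nd /dn /= of_posK. Qed.

Definition cw (c : 'I_N) : 'I_N.+1 := widen_ord (leqnSn N) c.
Lemma cw_or (l : 'I_N.+1) : {c | l = cw c} + {l = ord_max}.
Proof.
case: (eqVneq l ord_max) => [->|nl]; [by right | left].
have lt : (l < N)%N by rewrite ltn_neqAle -ltnS ltn_ord andbT; apply: nl.
by exists (Ordinal lt); apply: val_inj.
Qed.
Lemma cw_inj : injective cw. Proof. by move=> c d /(congr1 val) /= /val_inj. Qed.
Lemma cw_max c : (cw c == ord_max) = false.
Proof. by rewrite -val_eqE /= ltn_eqF. Qed.
Lemma ordS_cw c : ordS (cw c) = c.+1 :> nat.
Proof. by rewrite ordS_lt // cw_max. Qed.

Lemma W_cw (c : 'I_N) : W (cw c) = gl (lett w c).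
Proof. by rewrite nth_rcons size_map /= ltn_ord (nth_map (0%N, true)). Qed.
Lemma W_max : W (@ord_max N) = Neg false 0.
Proof. by rewrite nth_rcons size_map /= ltnn eqxx. Qed.
Lemma lett_or (c : 'I_N) : (lett w c).1 = if side (W (cw c)) then 2%N else 1%N.
Proof.
rewrite W_cw; have /allP/(_ (lett w c)) := vw; rewrite mem_nth // => /(_ isT).
by rewrite /gl /valid_letter; case: (lett w c) => -[|[|[|i]]] [].
Qed.

(** A state records turnbacks, which are 1-resolutions at positive crossings and 0-resolutions at
    negative ones. *)
Definition ks (s : state N.+1) : kstate w :=
  [ffun c : 'I_N => if (lett w c).2 then s (cw c) != 0%N else s (cw c) == 0%N].

Lemma orientE s (c : 'I_N) : (ks s c != (lett w c).2) = (s (cw c) == 0%N).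
Proof. by rewrite ffunE; case: (lett w c).2; case: (s (cw c) == 0%N). Qed.

Lemma vst1 s (c : 'I_N) : vst W s -> (s (cw c) <= 1)%N.
Proof. by move/(_ (cw c)); rewrite W_cw /gl; case: (lett w c).2. Qed.
Lemma vst_max s : vst W s -> s (@ord_max N) = 0%N.
Proof. by move/(_ (@ord_max N)); rewrite W_max leqn0 => /eqP. Qed.

Section State.
Variable s : state N.+1.
Hypothesis vs : vst W s.
Notation U := (dg W s).

Lemma U_max : U ord_max = None.
Proof. by rewrite ffunE vst_max. Qed.

Lemma adj_conn x y : adj (ks s) x y -> conn U (nd x) (nd y).
Proof.
case: x y => [l p] [l' p'] /orP [/and3P [/eqP /= lN /eqP l0 /eqP <-]|/existsP [c]] /=.
  have -> : l = ord_max by apply: val_inj.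
  have -> : l' = ord0 by apply: val_inj.
  have := link_conn U ord_max; rewrite /link U_max ordS_last /nd /=.
  by case: (pos_of p) => [[]|] [H1 H2 H3] //; rewrite conn_sym.
rewrite orientE; have := link_conn U (cw c); rewrite /link ffunE /tl lett_or.
have e1 : l == c :> nat -> l = cw c by move=> /eqP E; apply: val_inj.
have e2 (k : 'I_N.+1) : k == c.+1 :> nat -> k = ordS (cw c).
  by move=> /eqP E; apply: val_inj; rewrite [val (ordS _)]ordS_cw.
case: (s (cw c) == 0%N) => [[H1 H2 H3]|[H1 H2 H3]].
  rewrite orbF => /and4P [/e1 -> /e2 -> /eqP <- _]; rewrite /nd /=.
  by case: (pos_of p) => [[]|] //; rewrite conn_sym.
case/orP => [/and4P [/e1 -> /e2 -> /eqP <-]|/and5P [_ /eqP <- H]].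
  rewrite /nd /= /pos_of; case: (side _) H3 => /= H3; case: p => -[|[|[|p]]] Hp //.
have {H}H : l = cw c \/ l = ordS (cw c) by case/orP: H => [/e1|/e2]; [left|right].
rewrite /nd /= /pos_of => /eqP -> /eqP ->.
case: (side _) H1 H2 => /= H1 H2; case: H => -> //; rewrite conn_sym //.
Qed.

Lemma conn_adj x : same_circle (ks s) x (dn (nxt U (nd x))).
Proof.
have sy a b : same_circle (ks s) a b = same_circle (ks s) b a.
  by apply: sym_connect_sym => u v; rewrite /sadj orbC.
have st a b : adj (ks s) a b -> same_circle (ks s) a b.
  by move=> H; apply: connect1; rewrite /sadj H.
rewrite -{1}[x]ndK; move: (nd x) => {}x.
move: x; apply: (link_nxt (R := fun x y => same_circle (ks s) (dn x) (dn y))) => k; case: (cw_or k) => [[c ->]|->]; last first.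
  rewrite /link U_max ordS_last; have H p : same_circle (ks s) (dn (ord_max, p)) (dn (ord0, p)).
    by apply: st; rewrite /adj /= !eqxx.
  by split; rewrite // sy.
have H p : s (cw c) = 0%N \/ p = Some (~~ side (W (cw c))) ->
    same_circle (ks s) (dn (cw c, p)) (dn (ordS (cw c), p)).
  move=> Hp; apply: st; apply/orP; right; apply/existsP; exists c.
  rewrite orientE !fst_dn !snd_dn ordS_cw !eqxx /= lett_or; apply/orP; left.
  case: Hp => [->|->] //; apply/orP; right.
  by case: (side _); rewrite /= inordK.
have H' l : s (cw c) != 0%N -> l = cw c \/ l = ordS (cw c) ->
    same_circle (ks s) (dn (l, Some (side (W (cw c))))) (dn (l, None)).
  move=> s0 Hl.
  have A : (l == c :> nat) || (l == c.+1 :> nat).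
    by case: Hl => ->; rewrite ?ordS_cw /= eqxx ?orbT.
  suff : adj (ks s) (dn (l, Some (side (W (cw c))))) (dn (l, None)) \/
         adj (ks s) (dn (l, None)) (dn (l, Some (side (W (cw c))))).
    by case=> [/st //|/st]; rewrite sy.
  case E: (side _); [right | left]; apply/orP; right; apply/existsP; exists c;
    rewrite orientE (negPf s0) /= A lett_or E /= !inordK ?eqxx ?orbT //.
rewrite /link ffunE /tl; case: eqP => [s0|/eqP s0].
  by split; [apply: H; left|apply: H; left|rewrite sy; apply: H; left].
split; [apply: H' => //; left| rewrite sy; apply: H' => //; right|apply: H; right]; done.
Qed.

Lemma same_circleE x y : same_circle (ks s) x y = conn U (nd x) (nd y).
Proof.
apply/idP/idP.
  case/connectP => p; elim: p x => [|z p IH] x /=; first by move=> _ ->; apply: conn_refl.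
  move=> /andP [Hz Hp] E; apply: conn_trans (IH _ Hp E).
  by case/orP: Hz => /adj_conn //; rewrite conn_sym.
rewrite -{2}[y]ndK; move: (nd y); rewrite /conn; apply: porbit_ind.
  by rewrite ndK; apply: connect0.
by move=> z H; apply: connect_trans H _; rewrite dpermE -{2}[z]dnK; apply: conn_adj.
Qed.
End State.
End Bridge.

(** * Monomials of enhanced states and the rules for merges and splits *)

Section Circles.
Variables (M : nat) (P : comNzRingType) (xi : cnode M -> P).
Implicit Types (U V : diag M) (A : cnode M -> bool).

Definition rp U x : cnode M := odflt x [pick y | conn U x y].
(** The monomial of an enhanced state: [A] is the set of nodes labelled [v_-], and each of its
    circles contributes the variable of one representative. *)
Definition mprod U A : P := \prod_(x | (rp U x == x) && A x) xi x.
Definition cclosed U A := forall x y, conn U x y -> A x = A y.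

Lemma rp_conn U x : conn U x (rp U x).
Proof. by rewrite /rp; case: pickP => //= _; apply: conn_refl. Qed.
Lemma connl U x y : conn U x y -> conn U x =1 conn U y.
Proof.
move=> H z; apply/idP/idP => H'; apply: conn_trans H' => //; by rewrite conn_sym.
Qed.
Lemma rp_eq U x y : conn U x y -> rp U x = rp U y.
Proof.
move=> H; rewrite /rp (eq_pick (connl H)); case: pickP => //= /(_ y).
by rewrite conn_refl.
Qed.
Lemma rp_rp U x : rp U (rp U x) = rp U x.
Proof. by rewrite -(rp_eq (rp_conn U x)). Qed.

Lemma mprod_ext U A A' : A =1 A' -> mprod U A = mprod U A'.
Proof. by move=> E; apply: eq_bigl => x; rewrite E. Qed.

Lemma mprod_cons U A a : cclosed U A -> ~~ A a ->
  mprod U (fun x => conn U a x || A x) = xi (rp U a) * mprod U A.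
Proof.
move=> cA nA; rewrite /mprod (bigD1 (rp U a)) /=; last by rewrite rp_rp eqxx rp_conn.
congr (_ * _); apply: eq_bigl => x; case: eqP => //= rx.
case: (boolP (conn U a x)) => ax /=; last first.
  rewrite andb_idr // => Ax; apply: contraNneq ax => ->; exact: rp_conn.
by rewrite -(cA _ _ ax) (negPf nA) -{1}rx (rp_eq ax) eqxx.
Qed.

Lemma mprod_eq U V A : (forall x, A x -> conn U x =1 conn V x) -> mprod U A = mprod V A.
Proof.
move=> H; apply: eq_bigl => x; case Ax: (A x); last by rewrite !andbF.
by rewrite /rp (eq_pick (H _ Ax)).
Qed.

(** Isolates the factors of the circles through [a] and [b], the only ones which a saddle between
    them affects. *)
Lemma mprod_split U A a b : cclosed U A ->
  mprod U A = (if A a then xi (rp U a) else 1)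
    * (if conn U a b then 1 else if A b then xi (rp U b) else 1)
    * mprod U (fun x => ~~ (conn U a x || conn U b x) && A x).
Proof.
move=> cA.
have step B c : cclosed U B ->
    mprod U B = (if B c then xi (rp U c) else 1) * mprod U (fun x => ~~ conn U c x && B x).
  move=> cB; case: ifP => Bc; last first.
    rewrite mul1r; apply: mprod_ext => x; case: (boolP (conn U c x)) => //= cx.
    by rewrite -(cB _ _ cx).
  rewrite -mprod_cons; last by rewrite conn_refl.
    apply: mprod_ext => x; case: (boolP (conn U c x)) => //= cx.
    by rewrite -(cB _ _ cx).
  by move=> x y xy; rewrite (cB _ _ xy) ![conn U c _]conn_sym (connl xy).
have cA' : cclosed U (fun x => ~~ conn U a x && A x).
  by move=> x y xy; rewrite (cA _ _ xy) ![conn U a _]conn_sym (connl xy).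
rewrite (step _ a cA) (step _ b cA') -!mulrA; congr (_ * (_ * _)).
  by case: (conn U a b).
by apply: mprod_ext => x; rewrite negb_or andbA [~~ conn U b x && _]andbC.
Qed.

Section Toggle.
Variables (U : diag M) (c : 'I_M) (i : bool).
Hypothesis tg : togglable U c i.
Notation V := (tog U c i).
Notation a := (c, Some i).
Notation b := (ordS c, @None bool).
Definition tch U x := conn U a x || conn U b x.

Lemma ab_neq : a != b. Proof. by rewrite xpair_eqE andbF. Qed.

Lemma tch_sub x : tch U x -> tch V x.
Proof. by rewrite /tch /conn dperm_tog //; apply: porbit_tperm_cover. Qed.
Lemma U_tog : U = tog V c i.
Proof.
apply/ffunP => k; rewrite !ffunE eqxx; case: (eqVneq k c) => [->|//].
by case/orP: tg => /eqP ->; rewrite ?eqxx //= if_same.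
Qed.
Lemma tg_V : togglable V c i.
Proof. by rewrite /togglable !ffunE eqxx; case: ifP; rewrite ?eqxx ?orbT. Qed.
End Toggle.

Section Toggle2.
Variables (U : diag M) (c : 'I_M) (i : bool).
Hypothesis tg : togglable U c i.
Notation V := (tog U c i).
Notation a := (c, Some i).
Notation b := (ordS c, @None bool).
Notation tch := (tch c i).

Lemma tchE x : tch V x = tch U x.
Proof.
apply/idP/idP; last exact: tch_sub.
by move=> /(tch_sub (tg_V _ _ _)); rewrite -(U_tog tg).
Qed.

Lemma far_sub (U' : diag M) x y : togglable U' c i -> ~~ tch U' x -> conn U' x y ->
  conn (tog U' c i) x y.
Proof.
move=> tg'; rewrite /tch negb_or => /andP [H1 H2]; rewrite /conn dperm_tog //.
exact: porbit_tperm_far.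
Qed.

Lemma far_conn x : ~~ tch U x -> conn U x =1 conn V x.
Proof.
move=> nx y; apply/idP/idP; first exact: far_sub.
move=> H; rewrite (U_tog tg); apply: far_sub H; first exact: tg_V.
by rewrite tchE.
Qed.

Lemma mprod_far A : mprod U (fun x => ~~ tch U x && A x) = mprod V (fun x => ~~ tch V x && A x).
Proof.
rewrite (@mprod_eq U V); last by move=> x /andP [/far_conn].
by apply: mprod_ext => x; rewrite tchE.
Qed.

Variables (A A' A'' : cnode M -> bool).
Hypothesis cA : cclosed U A.
Hypothesis cA' : cclosed V A'.
Hypothesis AA' : forall x, ~~ tch U x -> A x = A' x.

Lemma mprod_off : mprod U (fun x => ~~ tch U x && A x) = mprod V (fun x => ~~ tch V x && A' x).
Proof.
rewrite mprod_far; apply: mprod_ext => x; rewrite tchE.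
by case: (boolP (tch U x)) => //= /AA'.
Qed.

Lemma cid_rp x : cid xi V (xi (rp V x) - xi x).
Proof. by apply: cid_conn; rewrite conn_sym; apply: rp_conn. Qed.

Lemma cid_tch : ~~ conn U a b -> forall x, tch U x -> cid xi V (xi x - xi a).
Proof.
move=> nab x H; apply: cid_conn; rewrite conn_sym /conn dperm_tog //.
have ab' : b \in porbit (tperm a b * dperm U)%g a by rewrite porbit_tperm_flip // ab_neq.
case/orP: H => H; have {}H := porbit_tperm_merge (ab_neq _ _) nab H => //.
exact: porbit_trans ab' H.
Qed.

Lemma cid_merge : ~~ conn U a b -> A' a = A a || A b -> ~~ (A a && A b) ->
  cid xi V (mprod U A - mprod V A').
Proof.
move=> nab A'a nA; rewrite (mprod_split a b cA) (mprod_split a b cA') mprod_off.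
rewrite conn_tog // (negPf nab) /= mulr1 -mulrBl mulrC; apply: cidealM.
have mrg := cid_tch nab.
have r x := cid_rp x.
rewrite A'a; move: nA; case: (A a); case: (A b) => //= _; rewrite ?mulr1 ?mul1r ?subrr; try exact: cideal0.
- apply: cideal_eqm (mrg _ _) (cideal_sym (r a)); by rewrite /tch rp_conn.
- apply: cideal_eqm (mrg _ _) (cideal_sym (r a)); by rewrite /tch rp_conn orbT.
Qed.

Lemma cid_merge0 : ~~ conn U a b -> A a && A b -> cid xi V (mprod U A).
Proof.
move=> nab /andP [Aa Ab]; rewrite (mprod_split a b cA) (negPf nab) Aa Ab mulrC; apply: cidealM.
have mrg := cid_tch nab.
have H1 : cid xi V (xi (rp U a) - xi a) by apply: mrg; rewrite /tch rp_conn.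
have H2 : cid xi V (xi (rp U b) - xi a) by apply: mrg; rewrite /tch rp_conn orbT.
rewrite [X in cideal _ _ X](_ : _ = xi (rp U b) * (xi (rp U a) - xi a)
   + xi a * (xi (rp U b) - xi a) + xi a ^+ 2); last by ring.
apply: cidealD (cideal_sqr1 _ _ _); apply: cidealD; exact: cidealM.
Qed.

(** This is the rule for splitting [v_-]: since [x_a^2 = 0], multiplying [x_a] by [x_a + x_b] leaves
    [x_a x_b]. *)
Lemma cid_split0 : conn U a b -> A a -> A' a -> A' b ->
  cid xi V ((xi a + xi b) * mprod U A - mprod V A').
Proof.
move=> ab Aa A'a A'b; rewrite (mprod_split a b cA) (mprod_split a b cA') mprod_off.
rewrite conn_tog // ab /= Aa A'a A'b mulr1 mulrA -mulrBl mulrC; apply: cidealM.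
have Hr : tch V (rp U a) by rewrite tchE /tch rp_conn.
have r x := cid_rp x.
have R1 : cid xi V (xi (rp V a) * xi (rp V b) - xi a * xi b).
  rewrite [X in cid _ _ X](_ : _ = xi (rp V b) * (xi (rp V a) - xi a)
    + xi a * (xi (rp V b) - xi b)); last by ring.
  by apply: cidealD; apply: cidealM; apply: r.
apply: cideal_eqm (cideal_sym R1).
have sq x : cid xi V (xi x ^+ 2) by apply: cideal_sqr1.
(* The representative of the old circle may lie on either of the two new ones. *)
case/orP: Hr => /(cid_conn xi) Hr.
  rewrite [X in cideal _ _ X](_ : _ = - (xi a + xi b) * (xi a - xi (rp U a)) + xi a ^+ 2); last by ring.
  by apply: cidealD; [apply: cidealM | apply: sq].
rewrite [X in cideal _ _ X](_ : _ = - (xi a + xi b) * (xi b - xi (rp U a)) + xi b ^+ 2); last by ring.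
by apply: cidealD; [apply: cidealM | apply: sq].
Qed.

Hypothesis cA'' : cclosed V A''.
Hypothesis AA'' : forall x, ~~ tch U x -> A x = A'' x.

Lemma mprod_off2 : mprod V (fun x => ~~ tch V x && A'' x) = mprod V (fun x => ~~ tch V x && A' x).
Proof.
apply: mprod_ext => x; rewrite tchE.
by case: (boolP (tch U x)) => //= H; rewrite -AA' // AA''.
Qed.

Lemma cid_split1 : conn U a b -> ~~ A a -> A' a -> ~~ A' b -> ~~ A'' a -> A'' b ->
  cid xi V ((xi a + xi b) * mprod U A - (mprod V A' + mprod V A'')).
Proof.
move=> ab /negPf Aa A'a /negPf A'b /negPf A''a A''b.
rewrite (mprod_split a b cA) (mprod_split a b cA') (mprod_split a b cA'').
rewrite mprod_off2 mprod_off.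
rewrite conn_tog // ab /= Aa A'a A'b A''a A''b !mulr1 !mul1r -mulrDl -mulrBl mulrC.
apply: cidealM; rewrite opprD addrACA; apply: cidealD; apply: cideal_sym; exact: cid_rp.
Qed.
End Toggle2.
End Circles.

(** * A single edge of the cube of resolutions *)

Section Local.
Variable w : bword.
Hypothesis vw : valid_word 3 w.
Notation N := (size w).
Notation W := (nth (Neg false 0) (rcons (map gl w) (Neg false 0))).
Notation sd c := (side (W (cw c))).
Notation na c := (cw c, Some (sd c)).
Notation nb c := (ordS (cw c), @None bool).

Section State.
Variable s : state N.+1.
Hypothesis vs : vst W s.
Notation U := (dg W s).
Variable c : 'I_N.

Lemma togglable_dg : togglable U (cw c) (sd c).
Proof. by rewrite /togglable ffunE /tl; case: (s _ == 0%N); rewrite ?eqxx ?orbT. Qed.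

Lemma loc_tch (u : node 3 w) : loc c u -> tch (cw c) (sd c) U (nd u).
Proof.
case: u => l p; rewrite /loc /= lett_or // => /andP [Hl Hp].
have {}Hl : l = cw c \/ l = ordS (cw c).
  by case/orP: Hl => /eqP E; [left|right]; apply: val_inj => //; rewrite [val (ordS _)]ordS_cw.
have {}Hp : pos_of p = Some (sd c) \/ pos_of p = None.
  by rewrite /pos_of; case: (sd c) Hp; case/orP => /= /eqP ->; rewrite ?eqxx /=; [right|left|left|right].
have := link_conn U (cw c); rewrite /tch /link ffunE /tl /nd /=.
case: (s (cw c) == 0%N) => -[H1 H2 H3].
  have {H1 H2}H : conn U (na c) (ordS (cw c), Some (sd c)) by case: (sd c).
  by case: Hl => ->; case: Hp => ->; rewrite ?conn_refl ?orbT ?H ?H3 ?orbT.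
by case: Hl => ->; case: Hp => ->; rewrite ?conn_refl ?orbT ?H1 ?H2 ?orbT.
Qed.

Lemma loc_a : loc c (dn (na c)).
Proof. by rewrite /loc lett_or //= eqxx; case: (sd c); rewrite /= inordK. Qed.
Lemma loc_b : loc c (dn (nb c)).
Proof.
by rewrite /loc fst_dn snd_dn ordS_cw lett_or // eqxx orbT; case: (sd c); rewrite /= inordK.
Qed.

Lemma touchedE v : touched (ks s) c v = tch (cw c) (sd c) U (nd v).
Proof.
apply/existsP/idP => [[u /andP [lu]]|].
  rewrite same_circleE // => uv; have := loc_tch lu; rewrite /tch.
  by rewrite ![conn U _ (nd u)]conn_sym !(connl uv) ![conn U (nd v) _]conn_sym.
case/orP => H; [exists (dn (na c)) | exists (dn (nb c))];
  by rewrite same_circleE // dnK H ?loc_a ?loc_b.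
Qed.

Notation rt := (fingraph.root (@sadj 3 w (ks s))).
Lemma root_eq u v : (rt u == rt v) = conn U (nd u) (nd v).
Proof.
rewrite -same_circleE // /same_circle -root_connect // => x y.
by apply: sym_connect_sym => u' v'; rewrite /sadj orbC.
Qed.

Lemma card_loc (lb : node 3 w -> bool) :
  (forall u v, conn U (nd u) (nd v) -> lb u = lb v) ->
  #|[set rt u | u in [pred u | loc c u && lb u]]| =
  if conn U (na c) (nb c) then (lb (dn (na c)) : nat)
  else (lb (dn (na c)) + lb (dn (nb c)))%N.
Proof.
move=> cl; set S := [set _ | _ in _].
have E : S = (if lb (dn (na c)) then [set rt (dn (na c))] else set0)
         :|: (if lb (dn (nb c)) then [set rt (dn (nb c))] else set0).
  apply/setP => r; rewrite inE; apply/imsetP/orP => [[u]|].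
    rewrite inE => /andP [lu bu] ->; case/orP: (loc_tch lu) => H; [left|right].
      by rewrite (cl _ u) ?dnK // bu inE root_eq dnK conn_sym.
    by rewrite (cl _ u) ?dnK // bu inE root_eq dnK conn_sym.
  case; case: ifP => bu; rewrite inE // => /eqP ->.
    by exists (dn (na c)) => //; rewrite inE bu loc_a.
  by exists (dn (nb c)) => //; rewrite inE bu loc_b.
rewrite E; case: (boolP (conn U (na c) (nb c))) => ab.
  have -> : lb (dn (nb c)) = lb (dn (na c)) by apply/esym/cl; rewrite !dnK.
  have -> : rt (dn (nb c)) = rt (dn (na c)) by apply/esym/eqP; rewrite root_eq !dnK.
  by rewrite setUid; case: (lb _); rewrite ?cards1 ?cards0.
have ne : rt (dn (na c)) != rt (dn (nb c)) by rewrite root_eq !dnK.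
case: (lb (dn (na c))); case: (lb (dn (nb c))); rewrite ?setU0 ?set0U ?cards1 ?cards0 //.
by rewrite cards2 ne.
Qed.

Lemma ncirc_locE : ncirc_loc 3 (ks s) c = if conn U (na c) (nb c) then 1%N else 2%N.
Proof.
have -> : (if conn U (na c) (nb c) then 1 else 2)%N =
  #|[set rt u | u in [pred u | loc c u && true]]| by rewrite (card_loc (lb := xpredT)).
rewrite /ncirc_loc; congr #|pred_of_set _|; apply/setP => r.
by apply/imsetP/imsetP => -[u lu ->]; exists u => //; move: lu; rewrite !inE ?andbT.
Qed.

Lemma nplus_locE lab : consistent (ks s, lab) -> nplus_loc (ks s) lab c =
  if conn U (na c) (nb c) then (lab (dn (na c)) : nat)
  else (lab (dn (na c)) + lab (dn (nb c)))%N.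
Proof.
move=> cs; rewrite /nplus_loc card_loc // => u v uv.
by have /forallP/(_ u)/forallP/(_ v) := cs; rewrite /= same_circleE // uv => /eqP.
Qed.
End State.

Definition neg (lab : {ffun node 3 w -> bool}) (v : cnode N.+1) : bool := ~~ lab (dn v).

Lemma consistentP s (lab : {ffun node 3 w -> bool}) : vst W s ->
  reflect (cclosed (dg W s) (neg lab)) (consistent (ks s, lab)).
Proof.
move=> vs; apply: (iffP idP) => [cs u v uv|cl].
  have /forallP/(_ (dn u))/forallP/(_ (dn v)) := cs.
  by rewrite /= same_circleE // !dnK uv /neg => /eqP ->.
apply/forallP => u; apply/forallP => v; apply/implyP; rewrite /= same_circleE // => /cl.
by rewrite /neg !ndK => /negb_inj ->.
Qed.

Section Edge.
Variables (s : state N.+1) (c : 'I_N) (j : nat).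
Hypothesis vs : vst W s.
Hypothesis prej : pre (W (cw c)) (s (cw c)) = Some j.
Notation t := (upd s (cw c) j).
Notation V := (dg W s).
Notation U := (dg W t).

Lemma edge_vst : vst W t.
Proof. by move=> k; rewrite ffunE; case: eqP => [->|_] //; apply: pre_valid prej _. Qed.

Lemma edge_jE : j = (s (cw c) == 0%N).
Proof.
have := vst1 c vs; move: prej; rewrite W_cw /gl; case: (lett w c).2 => /=.
  by case: eqP => // -> [<-].
by case: ltnP => // H [<-] _; case: (s _) H.
Qed.

Lemma edge_tog : V = tog U (cw c) (sd c).
Proof.
apply/ffunP => k; rewrite !ffunE eqxx; case: (eqVneq k (cw c)) => [->|//].
by rewrite edge_jE /tl; case: (s _ == 0%N); rewrite /= ?eqxx.
Qed.

Lemma edge_one : ks s c.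
Proof.
have := vst1 c vs; move: prej; rewrite W_cw /gl ffunE; case: (lett w c).2 => /=.
  by case: eqP => // ->.
by case: ltnP => //; case: (s _).
Qed.

Lemma edge_ks k : ks t k = if k == c then false else ks s k.
Proof.
rewrite !ffunE (inj_eq (@cw_inj w)); case: (eqVneq k c) => [->|//]; rewrite edge_jE.
by have := edge_one; rewrite ffunE; case: (lett w c).2; case: (s _ == 0%N).
Qed.

Variables (P : comNzRingType) (xi : cnode N.+1 -> P).
Variable x : gen 3 w.
Hypothesis xt : (val x).1 = ks t.
Notation lab := (val x).2.
Notation la := (lab (dn (na c))).
Notation lb := (lab (dn (nb c))).

Lemma cx : consistent (ks t, lab).
Proof. by rewrite -xt -surjective_pairing; apply: (valP x). Qed.
Lemma clx : cclosed U (neg lab). Proof. exact/consistentP/cx/edge_vst. Qed.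

(** The labellings of the target which agree with [lab] away from the saddle. After a merge both
    nodes lie on one circle, whose label is [al]. *)
Definition lbl (al be : bool) : {ffun node 3 w -> bool} :=
  [ffun v => if conn V (na c) (nd v) then al
             else if conn V (nb c) (nd v) then be else lab v].

Lemma lbl_off al be v : ~~ tch (cw c) (sd c) U (nd v) -> lab v = lbl al be v.
Proof.
rewrite -tchE ?togglable_dg // -edge_tog /tch negb_or ffunE.
by case/andP => /negPf -> /negPf ->.
Qed.

Lemma lbl_cons al be : consistent (ks s, lbl al be).
Proof.
apply/consistentP => // u v uv; rewrite /neg !ffunE !dnK.
rewrite ![conn V _ u]conn_sym !(connl uv) ![conn V v _]conn_sym.
case: ifP => // n1; case: ifP => // n2; congr (~~ _).
have nv : ~~ tch (cw c) (sd c) U v.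
  by rewrite -tchE ?togglable_dg // -edge_tog /tch n1 n2.
have := clx (x := v) (y := u); rewrite (far_conn (togglable_dg t c) nv) -edge_tog conn_sym.
by move=> /(_ uv)/negb_inj ->.
Qed.

Definition Y al be : gen 3 w := exist _ (ks s, lbl al be) (lbl_cons al be).

Lemma offE (y : gen 3 w) : (val y).1 = ks s ->
  [forall v, ~~ touched (ks t) c v ==> (lab v == (val y).2 v)] =
  (y == Y ((val y).2 (dn (na c))) ((val y).2 (dn (nb c)))).
Proof.
move=> ys; have cy : cclosed V (neg (val y).2).
  by apply/consistentP => //; rewrite -ys -surjective_pairing; apply: (valP y).
apply/forallP/eqP => [H|-> v]; last first.
  by rewrite (touchedE edge_vst); apply/implyP => nv; rewrite -lbl_off.
apply: val_inj; rewrite [val y]surjective_pairing ys; congr (_, _); apply/ffunP => v.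
rewrite ffunE; case: ifP => [av|n1].
  by have := cy _ _ av; rewrite /neg ndK => /negb_inj ->.
case: ifP => [bv|n2].
  by have := cy _ _ bv; rewrite /neg ndK => /negb_inj ->.
have /implyP := H v; rewrite (touchedE edge_vst) -tchE ?togglable_dg // -edge_tog /tch n1 n2.
by move=> /(_ isT) /eqP.
Qed.

Lemma Y_a al be : (val (Y al be)).2 (dn (na c)) = al.
Proof. by rewrite /= ffunE dnK conn_refl. Qed.
Lemma Y_b al be : ~~ conn V (na c) (nb c) -> (val (Y al be)).2 (dn (nb c)) = be.
Proof. by move=> nab; rewrite /= ffunE dnK (negPf nab) conn_refl. Qed.
Lemma Y_mrg al be be' : conn V (na c) (nb c) -> Y al be = Y al be'.
Proof.
move=> ab; apply: val_inj; congr (_, _); apply/ffunP => v; rewrite !ffunE.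
by rewrite -!(connl ab); case: (conn V _ _).
Qed.

(** Replaces the counting of circles and labels near the crossing by equality with one or two
    explicit generators, so that sums over [y] can be evaluated. *)
Lemma local_coefE (y : gen 3 w) : (val y).1 = ks s ->
  local_coef c x y =
  if conn U (na c) (nb c) then
    if la then (y == Y true false) || (y == Y false true) else y == Y false false
  else (la || lb) && (y == Y (la && lb) false).
Proof.
move=> ys.
have cy : consistent (ks s, (val y).2) by rewrite -ys -surjective_pairing; apply: (valP y).
rewrite /local_coef xt ys offE // (ncirc_locE edge_vst) (ncirc_locE vs).
rewrite (nplus_locE edge_vst c cx) (nplus_locE vs c cy).
have fl := conn_tog (togglable_dg t c); rewrite -edge_tog in fl; rewrite fl.
case: (boolP (conn U (na c) (nb c))) fl => ab /= fl.
  case: (boolP la) => ha /=; last first.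
    rewrite addn_eq0 !eqb0; apply/andP/eqP => [[/eqP E /andP [/negPf ya /negPf yb]]|->].
      by rewrite E ya yb.
    by rewrite Y_a Y_b ?fl // eqxx.
  apply/andP/orP => [[/eqP E]|].
    move: E; case: ((val y).2 (dn (na c))); case: ((val y).2 (dn (nb c))) => // -> _.
      by left.
    by right.
  by case=> /eqP ->; rewrite Y_a Y_b ?fl // eqxx.
have -> : Y (la && lb) false = Y (la && lb) (la && lb) by apply: Y_mrg; rewrite fl.
have yb : (val y).2 (dn (nb c)) = (val y).2 (dn (na c)).
  by have /(consistentP _ vs)/(_ _ _ fl) := cy; rewrite /neg => /negb_inj ->.
rewrite yb; apply/andP/andP => [[/eqP E H]|[H /eqP E]].
  split; first by move: H; case: (la); case: (lb).
  have e : (val y).2 (dn (na c)) = la && lb.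
    by move: H; case: (la); case: (lb); case: ((val y).2 _).
  by rewrite {1}E e.
have ya : (val y).2 (dn (na c)) = la && lb by rewrite E Y_a.
by rewrite ya; split; [rewrite E | move: H; case: (la); case: (lb)].
Qed.

(** The matrix of merges and splits is, on monomials, multiplication by the saddle factor. *)
Lemma local_sum :
  cid xi V (mu xi U (cw c) (sd c) * mprod xi U (neg lab)
   - \sum_(y : gen 3 w | (val y).1 == ks s) (local_coef c x y)%:R * mprod xi V (neg (val y).2)).
Proof.
pose Yp al be := mprod xi V (neg (lbl al be)).
have cl al be : cclosed V (neg (lbl al be)) by apply/consistentP/lbl_cons.
have off al be v : ~~ tch (cw c) (sd c) U v -> neg lab v = neg (lbl al be) v.
  by move=> nv; rewrite /neg (lbl_off al be) // dnK.
have sum1 al be : \sum_(y : gen 3 w | (val y).1 == ks s) (y == Y al be)%:R * mprod xi V (neg (val y).2)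
    = Yp al be.
  rewrite (bigD1 (Y al be)) ?eqxx //= mul1r big1 ?addr0 // => y /andP [_ /negPf ->].
  by rewrite mul0r.
have E := edge_tog; have tg := togglable_dg t c.
have fl := conn_tog tg; rewrite -E in fl.
have clT al be : cclosed (tog U (cw c) (sd c)) (neg (lbl al be)) by rewrite -E.
have na_a al be : neg (lbl al be) (na c) = ~~ al by rewrite /neg ffunE dnK conn_refl.
rewrite muE; case: (boolP (conn U (na c) (nb c))) fl => ab fl.
  case: (boolP la) => ha.
    have -> : \sum_(y : gen 3 w | (val y).1 == ks s) (local_coef c x y)%:R * mprod xi V (neg (val y).2)
       = Yp false true + Yp true false.
      rewrite -!sum1 -big_split; apply: eq_bigr => y /eqP ys; rewrite local_coefE // ab ha.
      case: (eqVneq y (Y true false)) => [->|_] /=; last by rewrite mul0r addr0.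
      case: eqP => [Eq|_]; last by rewrite mul0r add0r.
      by have := Y_a true false; rewrite Eq Y_a.
    have na_b al be : neg (lbl al be) (nb c) = ~~ be.
      by rewrite /neg ffunE dnK fl conn_refl.
    rewrite /Yp E; apply: (cid_split1 xi tg clx (clT _ _) (off _ _) (clT _ _) (off _ _));
      by rewrite ?na_a ?na_b // /neg negbK.
  rewrite (eq_bigr (fun y => (y == Y false false)%:R * mprod xi V (neg (val y).2))); last first.
    by move=> y /eqP ys; rewrite local_coefE // ab (negPf ha).
  have na_b al be : neg (lbl al be) (nb c) = ~~ be.
    by rewrite /neg ffunE dnK fl conn_refl.
  rewrite sum1 /Yp E; apply: (cid_split0 xi tg clx (clT _ _) (off _ _));
    by rewrite ?na_a ?na_b.
rewrite mul1r; case: (boolP (la || lb)) => hab.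
  rewrite (eq_bigr (fun y => (y == Y (la && lb) false)%:R * mprod xi V (neg (val y).2))); last first.
    by move=> y /eqP ys; rewrite local_coefE // (negPf ab) hab.
  rewrite sum1 /Yp E; apply: (cid_merge xi tg clx (clT _ _) (off _ _)) => //.
    by rewrite na_a negb_and.
  by rewrite /neg -negb_or hab.
rewrite big1 ?subr0; last first.
  by move=> y /eqP ys; rewrite local_coefE // (negPf ab) (negPf hab) mul0r.
rewrite E; apply: (cid_merge0 xi tg clx) => //.
by rewrite /neg -negb_or.
Qed.
End Edge.
End Local.

Lemma odd_sum (I : Type) (r : seq I) (Q : pred I) (F G : I -> nat) :
  (forall i, Q i -> odd (F i) = odd (G i)) ->
  odd (\sum_(i <- r | Q i) F i) = odd (\sum_(i <- r | Q i) G i).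
Proof.
by move=> H; rewrite !(big_morph odd oddD (erefl (odd 0))); apply: eq_bigr.
Qed.

(** * From Khovanov chains to solutions *)

Section Bridge.
Variable w : bword.
Hypothesis vw : valid_word 3 w.
Notation N := (size w).
Notation W := (nth (Neg false 0) (rcons (map gl w) (Neg false 0))).
Notation sd c := (side (W (cw c))).

Lemma preE s (c : 'I_N) : vst W s ->
  pre (W (cw c)) (s (cw c)) = if ks s c then Some (s (cw c) == 0%N : nat) else None.
Proof.
move=> vs; have := vst1 c vs; rewrite W_cw /gl ffunE; case: (lett w c).2 => /=.
  by case: (s (cw c)) => [|[|]].
by case: (s (cw c)) => [|[|]].
Qed.

Lemma emE (P : comNzRingType) (xi : cnode N.+1 -> P) s (c : 'I_N) j : vst W s ->
  pre (W (cw c)) (s (cw c)) = Some j ->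
  em xi W s (cw c) j = mu xi (dg W (upd s (cw c) j)) (cw c) (sd c).
Proof.
move=> vs; rewrite /em; move: (vst1 c vs); rewrite W_cw /gl; case: (lett w c).2 => //=.
by case: (s (cw c)) => [|[|]].
Qed.

(* The sign of an edge in the cube of resolutions counts 1-resolutions, while [sg]
   counts turnbacks; [eta] compensates for the difference at negative crossings. *)
Definition nneg (c : 'I_N) : nat := (\sum_(l < N | (l < c)%N) ~~ (lett w l).2)%N.
Definition eta (P : comNzRingType) (s : state N.+1) : P := (-1) ^+ (\sum_(c < N) s (cw c) * nneg c)%N.

(** At a negative crossing exactly one of turnback and 1-resolution occurs, so the two counts before
    [c] differ in parity by [nneg c]. The edge changes the turnback count at [c] by one, hence
    changes [eta] by this same parity. *)
Lemma eta_sign (P : comNzRingType) s (c : 'I_N) j : vst W s ->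
  pre (W (cw c)) (s (cw c)) = Some j ->
  sg P s (cw c) * eta P (upd s (cw c) j) = eta P s * (edge_sign (ks (upd s (cw c) j)) c)%:~R.
Proof.
move=> vs pj; set t := upd _ _ _; rewrite /edge_sign /sg /eta rmorphXn rmorphN1 -!exprD.
rewrite -signr_odd -[RHS]signr_odd; congr (_ ^+ nat_of_bool _); rewrite !oddD.
have -> : odd #|[pred l : 'I_N | (l < c)%N && ks t l]| =
  odd (\sum_(k < N.+1 | (k < cw c)%N) s k) (+) odd (nneg c).
  have -> : (\sum_(k < N.+1 | (k < cw c)%N) s k = \sum_(l < N | (l < c)%N) s (cw l))%N.
    by rewrite big_mkcond big_ord_recr /= ltnNge ltnW //= addn0 -big_mkcond.
  rewrite -sum1_card big_mkcondr /= -oddD -big_split /=; apply: odd_sum => l lc.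
  rewrite /t (edge_ks vs pj).
  have -> : (l == c) = false by apply: contraTF lc => /eqP ->; rewrite ltnn.
  have := vst1 l vs; rewrite ffunE.
  by case: (lett w l).2; case: (s (cw l)) => [|[|]].
have -> : odd (\sum_(l < N) t (cw l) * nneg l) = odd (\sum_(l < N) s (cw l) * nneg l) (+) odd (nneg c).
  rewrite (bigD1 c) // [in RHS](bigD1 c) //= !oddD !oddM ffunE eqxx (edge_jE vs pj).
  rewrite (_ : odd (\sum_(l < N | l != c) _) = odd (\sum_(i < N | i != c) s (cw i) * nneg i)); last first.
    by apply: odd_sum => l /negPf lc; rewrite ffunE (inj_eq (@cw_inj w)) lc.
  have := vst1 c vs; case: (s (cw c)) => [|[|]] //= _; by case: (odd (nneg c)); case: (odd _).
by rewrite addbC -!addbA; congr (_ (+) _); rewrite addbC.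
Qed.

Section Core.
Variables (R P : comNzRingType) (rho : {rmorphism R -> P}) (xi : cnode N.+1 -> P).
Variable z : chain R 3 w.

Definition Zlab (s : state N.+1) : P :=
  \sum_(x : gen 3 w | (val x).1 == ks s) rho (z x) * mprod xi (dg W s) (neg (val x).2).
Definition Zg s := eta P s * Zlab s.
Definition bd s : P :=
  \sum_(y : gen 3 w | (val y).1 == ks s) rho (kh_d z y) * mprod xi (dg W s) (neg (val y).2).

Lemma cube_edgeE s (c : 'I_N) j (k : kstate w) : vst W s ->
  pre (W (cw c)) (s (cw c)) = Some j ->
  cube_edge k (ks s) c = (k == ks (upd s (cw c) j)).
Proof.
move=> vs pj; rewrite /cube_edge (edge_one vs pj) /=.
apply/andP/eqP => [[kc /forallP H]|->].
  apply/ffunP => l; rewrite edge_ks //; case: (eqVneq l c) => [->|lc]; first exact/negbTE.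
  by apply/eqP; have := H l; rewrite lc.
rewrite edge_ks // eqxx; split=> //; apply/forallP => l; apply/implyP => /negPf lc.
by rewrite edge_ks // lc.
Qed.

Lemma bdE s : vst W s -> bd s = \sum_(c < N)
  if pre (W (cw c)) (s (cw c)) is Some j then
    (edge_sign (ks (upd s (cw c) j)) c)%:~R * \sum_(x : gen 3 w | (val x).1 == ks (upd s (cw c) j))
     rho (z x) * \sum_(y : gen 3 w | (val y).1 == ks s)
       (local_coef c x y)%:R * mprod xi (dg W s) (neg (val y).2)
  else 0.
Proof.
move=> vs; rewrite /bd.
transitivity (\sum_(y : gen 3 w | (val y).1 == ks s) \sum_(c < N) \sum_(x : gen 3 w)
  (if cube_edge (val x).1 (val y).1 c then rho (z x) * ((edge_sign (val x).1 c)%:~R *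
     (local_coef c x y)%:R * mprod xi (dg W s) (neg (val y).2)) else 0)).
  apply: eq_bigr => y _; rewrite ffunE rmorph_sum mulr_suml exchange_big; apply: eq_bigr => x _.
  rewrite -big_mkcond -mulr_sumr rmorphM -mulrA; congr (_ * _).
  rewrite rmorph_int /edge_coef rmorph_sum mulr_suml; apply: eq_bigr => c _.
  by rewrite rmorphM /= rmorph_nat.
rewrite exchange_big; apply: eq_bigr => c _.
case Ep: (pre _ _) => [j|]; last first.
  apply: big1 => y /eqP ys; apply: big1 => x _; rewrite ifF // /cube_edge ys.
  by move: Ep; rewrite preE //; case: (ks s c); rewrite ?andbF.
rewrite exchange_big mulr_sumr [RHS]big_mkcond; apply: eq_bigr => x _.
case: ifP => xt; last first.
  by apply: big1 => y /eqP ->; rewrite (cube_edgeE _ vs Ep) xt.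
rewrite mulrCA mulr_sumr mulr_sumr; apply: eq_bigr => y /eqP ys.
by rewrite ys (cube_edgeE _ vs Ep) xt (eqP xt) !mulrA.
Qed.

Lemma Dc_bd s : vst W s -> cid xi (dg W s) (\sum_k Dc xi W Zg s k - eta P s * bd s).
Proof.
move=> vs; have Dmax : Dc xi W Zg s ord_max = 0 by rewrite /Dc W_max vst_max.
rewrite bdE // big_ord_recr Dmax [X in X - _]addr0 mulr_sumr -sumrB; apply: cideal_sum => c _.
rewrite -[widen_ord _ _]/(cw c) /Dc; case Ep: (pre _ _) => [j|]; last first.
  by rewrite mulr0 subrr; apply: cideal0.
rewrite emE // [eta P s * _]mulrA -(eta_sign _ vs Ep) /Zg.
rewrite [X in cideal _ _ X](_ : _ = sg P s (cw c) * eta P (upd s (cw c) j) *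
  (mu xi (dg W (upd s (cw c) j)) (cw c) (sd c) * Zlab (upd s (cw c) j)
   - \sum_(x : gen 3 w | (val x).1 == ks (upd s (cw c) j))
     rho (z x) * \sum_(y : gen 3 w | (val y).1 == ks s)
       (local_coef c x y)%:R * mprod xi (dg W s) (neg (val y).2))); last by ring.
apply: cidealM; rewrite /Zlab mulr_sumr -sumrB; apply: cideal_sum => x /eqP xt.
rewrite mulrCA -mulrBr; apply: cidealM; exact: local_sum.
Qed.
End Core.

Lemma ks_oriented s : vst W s -> (ks s == oriented_state w) = (s == st0 N.+1).
Proof.
move=> vs; apply/eqP/eqP => [E|->]; last first.
  by apply/ffunP => c; rewrite !ffunE; case: (lett w c).2.
apply/ffunP => k; rewrite [RHS]ffunE; case: (cw_or k) => [[c ->]|->]; last exact: vst_max.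
have := congr1 (fun k : kstate w => k c) E; rewrite !ffunE.
by case: (lett w c).2; case: eqP => // ->.
Qed.

Section Solve.
Variables (P : comNzRingType) (xi : cnode N.+1 -> P).

Lemma conn_vert (U : diag N.+1) x y : (forall k, U k = None) -> conn U x y -> x.2 = y.2.
Proof.
move=> U0; move: y; rewrite /conn; apply: porbit_ind => // y ->; rewrite dpermE.
by case: y => c [i|] /=; rewrite U0.
Qed.

Lemma mprod_vert (U : diag N.+1) : (forall k, U k = None) ->
  cid xi U (mprod xi U xpredT - xi (ord0, None) * xi (ord0, Some false) * xi (ord0, Some true)).
Proof.
move=> U0; pose a := (ord0, None) : cnode N.+1.
pose b := (ord0, Some false) : cnode N.+1; pose c := (ord0, Some true) : cnode N.+1.
have E x y : conn U x y = (x.2 == y.2).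
  apply/idP/eqP; first exact: conn_vert.
  by case: x y => [k p] [l q] /= ->; apply: conn_level.
have -> : mprod xi U xpredT = xi (rp U a) * xi (rp U b) * xi (rp U c).
  rewrite (@mprod_split _ _ xi U xpredT a b) // !E /=; congr (_ * _).
  have -> : xi (rp U c) = xi (rp U c) * mprod xi U xpred0.
    by rewrite /mprod big1 ?mulr1 // => x; rewrite andbF.
  rewrite -mprod_cons //; apply: mprod_ext => x; rewrite !E andbT orbF.
  by case: x => k [[]|].
have r x : cid xi U (xi (rp U x) - xi x) by apply: cid_conn; rewrite conn_sym; apply: rp_conn.
rewrite [X in cid _ _ X](_ : _ = xi (rp U b) * xi (rp U c) * (xi (rp U a) - xi a)
  + xi a * xi (rp U c) * (xi (rp U b) - xi b) + xi a * xi b * (xi (rp U c) - xi c)); last by ring.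
by apply: cidealD; [apply: cidealD|]; apply/cidealM/r.
Qed.

Lemma eta0 : eta P (st0 N.+1) = 1.
Proof. by rewrite /eta big1 // => c _; rewrite ffunE. Qed.

Variables (R : comNzRingType) (rho : {rmorphism R -> P}) (z : chain R 3 w).

Lemma bridge_psi : kh_d z = psi_chain R 3 w -> Sol xi W (Zg rho xi z).
Proof.
move=> E s vs c; suff H : cid xi (dg W s) (eta P s * bd rho xi z s - psiv xi s ord0).
  apply: cideal_eqm (Dc_bd rho xi z vs) _; apply: cideal_eqm H _; exact: psiv_level.
rewrite /bd E /psiv -ks_oriented //; case: eqP => [Es|Ns]; last first.
  rewrite big1 ?mulr0 ?subr0; first exact: cideal0.
  by move=> y /eqP ys; rewrite ffunE ys (introF eqP Ns) rmorph0 mul0r.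
have s0 : s = st0 N.+1 by apply/eqP; rewrite -ks_oriented // Es.
have c0 : consistent (ks s, [ffun _ : node 3 w => false]).
  by apply/(consistentP vw _ vs) => u v _; rewrite /neg !ffunE.
have -> : eta P s = 1 by rewrite s0 eta0.
pose y0 : gen 3 w := exist _ (ks s, [ffun _ : node 3 w => false]) c0.
rewrite mul1r (bigD1 y0) ?eqxx //=.
rewrite big1 ?addr0; last first.
  move=> y /andP [/eqP ys ny]; rewrite ffunE ys Es eqxx /= ifF ?rmorph0 ?mul0r //.
  apply: contraNF ny => /eqP yl; apply/eqP/val_inj; rewrite /= -yl -ys.
  exact: surjective_pairing.
rewrite ffunE /= Es !eqxx rmorph1 mul1r.
rewrite (@mprod_ext _ _ xi _ _ xpredT); last by move=> x; rewrite /neg ffunE.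
by apply: mprod_vert => k; rewrite s0 !ffunE.
Qed.

(** The factor [xi e] kills every generator whose marked circle is labelled [v_-], because [x_e]
    then occurs twice; an equation in the quotient complex thus becomes one in the full complex. It
    also turns the label [v_+] of the marked circle of psi' into [v_-], giving psi. *)
Lemma bridge_psi' (e : cnode N.+1) :
  (forall y : gen 3 w, (val y).2 (dn e) -> kh_d z y =
     if ((val y).1 == oriented_state w) &&
        ((val y).2 == [ffun v => same_circle (oriented_state w) (dn e) v]) then 1 else 0) ->
  Sol xi W (fun s => xi e * Zg rho xi z s).
Proof.
move=> E s vs c; suff H : cid xi (dg W s) (xi e * (eta P s * bd rho xi z s) - psiv xi s ord0).
  apply: (cideal_eqm (q := xi e * (eta P s * bd rho xi z s))); last first.
    apply: cideal_eqm H _; exact: psiv_level.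
  rewrite (_ : \sum_k _ = xi e * \sum_k Dc xi W (Zg rho xi z) s k).
    rewrite -mulrBr; apply: cidealM; exact: Dc_bd.
  rewrite mulr_sumr; apply: eq_bigr => k _; rewrite /Dc; case: (pre _ _) => [j|]; last by rewrite mulr0.
  by rewrite mulrCA.
have cy (y : gen 3 w) (ys : (val y).1 = ks s) : cclosed (dg W s) (neg (val y).2).
  by apply/consistentP => //; rewrite -ys -surjective_pairing; apply: (valP y).
have kill (y : gen 3 w) : (val y).1 = ks s -> ~~ (val y).2 (dn e) ->
    cid xi (dg W s) (xi e * mprod xi (dg W s) (neg (val y).2)).
  move=> ys ny; rewrite (mprod_split xi e e (cy _ ys)) conn_refl /neg ny mulr1 mulrA mulrC.
  apply: cidealM; rewrite [X in cideal _ _ X](_ : _ = xi e * (xi (rp (dg W s) e) - xi e) + xi e ^+ 2); last by ring.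
  apply: cidealD (cideal_sqr1 _ _ _); apply: cidealM; apply: cid_conn.
  by rewrite conn_sym; apply: rp_conn.
have bdE' : cid xi (dg W s) (xi e * bd rho xi z s -
   \sum_(y : gen 3 w | ((val y).1 == ks s) && (val y).2 (dn e))
     xi e * (rho (kh_d z y) * mprod xi (dg W s) (neg (val y).2))).
  rewrite /bd mulr_sumr [X in X - _](bigID (fun y : gen 3 w => (val y).2 (dn e))) /= addrAC subrr add0r.
  apply: cideal_sum => y /andP [/eqP ys ny]; rewrite mulrCA; apply: cidealM; exact: kill.
rewrite mulrCA.
apply: (cideal_eqm (q := eta P s * \sum_(y : gen 3 w | ((val y).1 == ks s) && (val y).2 (dn e))
     xi e * (rho (kh_d z y) * mprod xi (dg W s) (neg (val y).2)))).
  by rewrite -mulrBr; apply: cidealM.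
rewrite /psiv -ks_oriented //; case: eqP => [Es|Ns]; last first.
  rewrite big1 ?mulr0 ?subr0; first exact: cideal0.
  by move=> y /andP [/eqP ys ye]; rewrite E // ys (introF eqP Ns) rmorph0 mul0r mulr0.
have s0 : s = st0 N.+1 by apply/eqP; rewrite -ks_oriented // Es.
pose l0 := [ffun v => same_circle (oriented_state w) (dn e) v].
have l0E v : l0 (dn v) = conn (dg W s) e v by rewrite ffunE -Es same_circleE // !dnK.
have c0 : consistent (ks s, l0).
  by apply/(consistentP vw _ vs) => u v uv; rewrite /neg !l0E ![conn _ e _]conn_sym (connl uv).
have -> : eta P s = 1 by rewrite s0 eta0.
pose y0 : gen 3 w := exist _ (ks s, l0) c0.
rewrite mul1r (bigD1 y0) /=; last by rewrite eqxx l0E conn_refl.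
rewrite big1 ?addr0; last first.
  move=> y /andP [/andP [/eqP ys ye] ny]; rewrite E // ys Es eqxx /= ifF ?rmorph0 ?mul0r ?mulr0 //.
  apply: contraNF ny => /eqP yl; apply/eqP/val_inj; rewrite /= /l0 -yl -ys.
  exact: surjective_pairing.
rewrite E /= ?Es ?eqxx ?l0E ?conn_refl // rmorph1 mul1r.
have mE : mprod xi (dg W s) xpredT = xi (rp (dg W s) e) * mprod xi (dg W s) (neg l0).
  rewrite -mprod_cons.
  - by apply: mprod_ext => x; rewrite /neg l0E orbN.
  - exact: (elimT (consistentP vw l0 vs) c0).
  - by rewrite /neg l0E conn_refl.
apply: (cideal_eqm (q := mprod xi (dg W s) xpredT)); last first.
  by apply: mprod_vert => k; rewrite s0 !ffunE.
rewrite mE -mulrBl mulrC; apply: cidealM; apply: cid_conn; exact: rp_conn.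
Qed.
End Solve.
End Bridge.

Lemma BoundW_rcons (R : comNzRingType) w :
  Bound (size w).+1 R (nth (Neg false 0) (rcons (map gl w) (Neg false 0))) -> BoundW R w.
Proof.
move=> H; apply: (@BoundL_rot _ (map gl w) [:: _]).
by rewrite cats1 /BoundL size_rcons size_map.
Qed.

Lemma psi_nonzero_Bound (R : comNzRingType) w : valid_word 3 w -> ~ BoundW R w -> psi_nonzero R 3 w.
Proof.
move=> vw nB [z [_ E]]; apply: nB; apply: BoundW_rcons => P rho xi.
by exists (Zg rho xi z); apply: bridge_psi.
Qed.

Lemma psi'_nonzero_Bound w (mk : node 3 w) : valid_word 3 w -> ~ BoundW 'F_2 w -> psi'_nonzero mk.
Proof.
move=> vw nB [z [_ E]]; apply: nB; apply: BoundW_rcons => P rho xi.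
exists (fun s => xi (nd mk) * Zg rho xi z s); apply: bridge_psi' => // y.
by rewrite ndK => /E ->; rewrite ffunE.
Qed.

(** * The Dehornoy floor *)

Local Close Scope ring_scope.
Section Order.
Local Open Scope Z_scope.

(* A point of the universal cover of the rational projective line: the sheet [lev] and
   a vector [(px, py)] of the half-open half-plane [inH], of slope [px / py] in
   [-oo, +oo).  Here sigma_2 acts by [q -> q + 1] and sigma_1 by [q -> q / (1 - q)]. *)
Record hpt := Pt { lev : Z; px : Z; py : Z }.
Definition inH (p : hpt) : Prop := 0 < py p \/ (py p = 0 /\ px p < 0).
Definition fix_up (p : hpt) : hpt :=
  if (Z.ltb 0 (py p) || (Z.eqb (py p) 0 && Z.ltb (px p) 0))%bool then p
  else Pt (lev p + 1) (- px p) (- py p).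
Definition fix_down (p : hpt) : hpt :=
  if (Z.ltb 0 (py p) || (Z.eqb (py p) 0 && Z.ltb (px p) 0))%bool then p
  else Pt (lev p - 1) (- px p) (- py p).
Definition lact (l : letter) (p : hpt) : hpt :=
  match l with
  | (1%nat, true) => fix_up (Pt (lev p) (px p) (py p - px p))
  | (1%nat, false) => fix_down (Pt (lev p) (px p) (py p + px p))
  | (2%nat, true) => Pt (lev p) (px p + py p) (py p)
  | (2%nat, false) => Pt (lev p) (px p - py p) (py p)
  | _ => p
  end.
Definition act (w : bword) (p : hpt) : hpt := foldr lact p w.
Definition shift (n : Z) (p : hpt) : hpt := Pt (lev p + n) (px p) (py p).
Definition ple (p q : hpt) : Prop :=
  lev p < lev q \/ (lev p = lev q /\ px p * py q <= px q * py p).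
(** Slope [-oo] in sheet 0: the least point of its sheet, and a fixed point of sigma_2. *)
Notation o := (Pt 0 (-1) 0).

Lemma act_cat u v p : act (u ++ v) p = act u (act v p).
Proof. by rewrite /act foldr_cat. Qed.

Ltac noif t := lazymatch t with context [if _ then _ else _] => fail | _ => idtac end.
Ltac ifs := repeat (match goal with
  | |- context [Z.ltb ?a ?b] => noif a; noif b; destruct (Z.ltb_spec a b); try (exfalso; lia)
  | |- context [Z.eqb ?a ?b] => noif a; noif b; destruct (Z.eqb_spec a b); try (exfalso; lia)
  end; cbn [lev px py orb andb]).
Ltac lsolve := rewrite /lact /fix_up /fix_down /inH; cbn [lev px py]; ifs; try lia.

Lemma lact_H l p : inH p -> inH (lact l p).
Proof. by case: p => m x y; case: l => [[|[|[|i]]] []] //; lsolve. Qed.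
Lemma act_H w p : inH p -> inH (act w p).
Proof. by move=> H; elim: w => //= l w; apply: lact_H. Qed.
Lemma H_o : inH o. Proof. by right. Qed.

Lemma lact_inv l p : inH p -> lact (inv_letter l) (lact l p) = p.
Proof.
case: p => m x y; case: l => [[|[|[|i]]] []] //; rewrite /inv_letter; cbn [fst snd negb]; lsolve; intros;
  f_equal; lia.
Qed.

Lemma lact_shift l n p : lact l (shift n p) = shift n (lact l p).
Proof.
case: p => m x y; case: l => [[|[|[|i]]] []] //; rewrite /shift; lsolve; f_equal; lia.
Qed.
Lemma act_shift w n p : act w (shift n p) = shift n (act w p).
Proof. by elim: w => //= l w ->; rewrite lact_shift. Qed.

Lemma lact_mono l p q : inH p -> inH q -> ple p q -> ple (lact l p) (lact l q).
Proof.
case: p => m x y; case: q => m' x' y'; case: l => [[|[|[|i]]] []] //; rewrite /ple; lsolve; intros; try nia.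
Qed.

Lemma act_mono w p q : inH p -> inH q -> ple p q -> ple (act w p) (act w q).
Proof.
by move=> Hp Hq pq; elim: w => //= l w; apply: lact_mono; apply: act_H.
Qed.

Lemma act_relator x y p : relator 3 x y -> inH p -> act x p = act y p.
Proof.
case=> [i b Hi|i j b c Hi Hj Hij|i Hi Hi'] Hp.
- rewrite -[act _ p]/(lact (i, b) (lact (i, ~~ b) p)).
  by have := lact_inv (i, ~~ b) Hp; rewrite /inv_letter /= negbK.
- by move: Hi Hj Hij => /andP [/ltP Hi _] /andP [_ /ltP Hj] /leP Hij; lia.
- have -> : i = 1%N by move/ltP: Hi; move/ltP: Hi'; lia.
  case: p Hp => m x' y'; rewrite /act /inH => /= H; cbn [foldr]; lsolve; f_equal; lia.
Qed.

Lemma act_braid_eq u v p : braid_eq 3 u v -> inH p -> act u p = act v p.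
Proof.
move=> H Hp; elim: H => [_ _ [l r x y H]|x|x y _ ->|x y z _ -> _ ->] //.
by rewrite !act_cat (act_relator H (act_H r Hp)).
Qed.

Lemma act_inv w p : inH p -> act (inv_word w) (act w p) = p.
Proof.
move=> Hp; rewrite /inv_word; elim: w => [|l w IH] //.
rewrite map_cons rev_cons -cats1 act_cat -[act [:: _] _]/(lact (inv_letter l) (lact l (act w p))).
by rewrite lact_inv ?IH //; apply: act_H.
Qed.

Lemma inv_wordK w : inv_word (inv_word w) = w.
Proof.
rewrite /inv_word map_rev revK -map_comp -[RHS]map_id; apply: eq_map => -[i b].
by rewrite /inv_letter /= negbK.
Qed.

(** The matrix of the full twist is minus the identity, a half turn of the plane and one full turn
    of the projective line. *)
Lemma act_full_twist p : inH p -> act (full_twist 3) p = shift 1 p.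
Proof.
case: p => m x y; rewrite /act full_twist3 /shift /inH => /= H; cbn [foldr]; lsolve; f_equal; lia.
Qed.

Lemma act_wpow_shift u n : (forall p, inH p -> act u p = shift n p) ->
  forall k p, inH p -> act (wpow u k) p = shift (n * Z.of_nat k) p.
Proof.
move=> H; elim=> [|k IH] p Hp; first by rewrite /shift Z.mul_0_r Z.add_0_r; case: p Hp.
rewrite -[wpow _ _]/(u ++ wpow u k) act_cat H; last exact: act_H.
rewrite IH //.
rewrite /shift; cbn [lev px py]; f_equal; lia.
Qed.

Lemma act_full_twist_pow n p : inH p -> act (full_twist_pow 3 n) p = shift n p.
Proof.
move=> Hp; rewrite /full_twist_pow; case: Z.leb_spec => Hn.
  rewrite (act_wpow_shift act_full_twist) //; congr shift; lia.
rewrite (@act_wpow_shift _ (-1)) //; first by congr shift; lia.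
move=> q Hq; have Hs : inH (shift (-1) q) by [].
have -> : q = act (full_twist 3) (shift (-1) q).
  rewrite act_full_twist // /shift; case: q {Hq Hs} => m x y; cbn [lev px py]; f_equal; lia.
rewrite act_inv // act_full_twist //; rewrite /shift; cbn [lev px py]; f_equal; lia.
Qed.

Lemma braid_eq_valid u v : braid_eq 3 u v -> valid_word 3 u = valid_word 3 v.
Proof.
rewrite /valid_word; elim=> [_ _ [l r x y H]|x|x y _ ->|x y z _ -> _ ->] //.
rewrite !all_cat; congr (_ && (_ && _)).
case: H => [i b /andP [H1 H2]|i j b c /andP [H1 H2] /andP [H3 H4] _|i H1 H2] /=; rewrite /valid_letter /= ?H1 ?H2 ?H3 ?H4 //.
by rewrite (ltnW H2).
Qed.

(** sigma_1 stays in its sheet or goes up by one, and both sigma_2 and its inverse preserve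
    sheets. *)
Lemma act_nonneg v : (1%N, false) \notin v -> 0 <= lev (act v o).
Proof.
elim: v => [|l v IH] //; rewrite inE negb_or => /andP [nl /IH {}IH].
have := act_H v H_o; move: IH; rewrite /= ; case: (act v o) => m x y.
by move: nl; case: l => [[|[|[|i]]] []] //= _; lsolve.
Qed.

Lemma dehornoy_posP w : valid_word 3 w -> dehornoy_pos 3 w ->
  exists2 v, braid_eq 3 w v &
    [/\ valid_word 3 v, (1%N, false) \notin v & (1%N, true) \in v \/ all (fun x : letter => x.2) v].
Proof.
move=> vw [v [wv [i /and3P [/allP ge it nif]]]]; exists v => //.
have vv : valid_word 3 v by rewrite -(braid_eq_valid wv).
have := allP vv _ it; rewrite /valid_letter /= => /andP [i0 i3]; split=> //.
  apply/negP => H1; have := ge _ H1; rewrite /= => i1.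
  by move: nif; rewrite (_ : i = 1%N) ?H1 //; apply/eqP; rewrite eqn_leq i1.
case: (eqVneq i 1%N) => [i1|ni1]; [by left; rewrite -i1 | right].
have i2 : i = 2%N by case: i i0 i3 ni1 {it nif ge} => [|[|[|]]].
apply/allP => -[j b] jv; have := ge _ jv; have := allP vv _ jv.
rewrite /valid_letter i2 /= => /andP [_ j3] j2.
have E : j = 2%N by apply/eqP; rewrite eqn_leq j2 -ltnS j3.
by apply: contraNT nif => /negPf bf; rewrite i2 -E -bf.
Qed.

Lemma valid_inv u : valid_word 3 (inv_word u) = valid_word 3 u.
Proof. by rewrite /valid_word /inv_word all_rev all_map. Qed.

Lemma valid_wpow u k : valid_word 3 u -> valid_word 3 (wpow u k).
Proof.
by move=> vu; elim: k => // k IH; rewrite /valid_word -[wpow _ _]/(u ++ wpow u k) all_cat; apply/andP.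
Qed.

Lemma valid_full_twist_pow n : valid_word 3 (full_twist_pow 3 n).
Proof. by rewrite /full_twist_pow; case: Z.leb; apply: valid_wpow. Qed.

(** A Dehornoy positive word does not move [o] down, since [o] is least in its sheet; applying the
    monotone action of [u] gives the bound. *)
Lemma blt_act u n : valid_word 3 u -> blt 3 u (full_twist_pow 3 n) -> ple (act u o) (shift n o).
Proof.
move=> vu H; have vw : valid_word 3 (inv_word u ++ full_twist_pow 3 n).
  by rewrite /valid_word all_cat -!/(valid_word 3 _) valid_inv vu valid_full_twist_pow.
have [v /act_braid_eq/(_ H_o) E [_ /act_nonneg v0 _]] := dehornoy_posP vw H.
have Ho := H_o.
have -> : shift n o = act u (act v o).
  rewrite -E act_cat act_full_twist_pow // -{1}[u]inv_wordK act_inv //.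
apply: act_mono => //; first exact: act_H.
have := act_H v Ho; rewrite /ple /inH; cbn [lev px py]; lia.
Qed.

Lemma ble_act u n : valid_word 3 u -> ble 3 (full_twist_pow 3 n) u -> n <= lev (act u o).
Proof.
move=> vu [H|/act_braid_eq/(_ H_o) <-]; last by rewrite act_full_twist_pow ?/shift; cbn; [lia | right].
have vw : valid_word 3 (inv_word (full_twist_pow 3 n) ++ u).
  by rewrite /valid_word all_cat -!/(valid_word 3 _) valid_inv vu valid_full_twist_pow.
have [v /act_braid_eq/(_ H_o) E [_ /act_nonneg v0 _]] := dehornoy_posP vw H.
move: v0; rewrite -E act_cat.
have Hu := act_H u H_o.
have := act_full_twist_pow n (p := act (inv_word (full_twist_pow 3 n)) (act u o)).
move=> /(_ (act_H _ Hu)); rewrite -{1}[full_twist_pow 3 n]inv_wordK act_inv // => /(congr1 lev).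
rewrite /shift; cbn [lev px py]; lia.
Qed.

(** The usual estimate for translation numbers: a monotone action commuting with the shift
    accumulates at most [n] sheets per factor. *)
Lemma act_wpow_le w n : ple (act w o) (shift n o) ->
  forall k, ple (act (wpow w k) o) (shift (n * Z.of_nat k) o).
Proof.
move=> H; elim=> [|k IH]; first by right; rewrite /shift Z.mul_0_r; cbn; split; lia.
have Ho := H_o.
have -> : wpow w k.+1 = wpow w k ++ w.
  by elim: k {IH} => [|k IH]; [rewrite /wpow /= cats0 | rewrite -[LHS]/(w ++ wpow w k.+1) {1}IH catA].
rewrite act_cat; have := act_mono (wpow w k) (act_H w Ho) (H_o : inH (shift n o)) H.
rewrite act_shift => H1.
move: IH H1 (act_H (wpow w k) Ho) (act_H (wpow w k) (act_H w Ho)).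
case: (act (wpow w k) o) => m x y; case: (act _ _) => m' x' y'.
by rewrite /ple /shift /inH; cbn [lev px py]; nia.
Qed.

(** [f k] is the floor of the power [k.+1]. If the floor of [w] is at most 0, then [w] moves [o] up
    by at most one sheet, and its power [k.+1] by at most [k.+1] sheets. *)
Lemma floor_bound w (f : nat -> Z) : valid_word 3 w ->
  (forall k, floor_spec 3 (wpow w k.+1) (f k)) -> f 0%N <= 0 -> forall k, f k <= Z.of_nat k.+1.
Proof.
move=> vw Hf f0 k; have [_ H0] := Hf 0%N; have [Hk _] := Hf k.
have := ble_act (valid_wpow _ vw) Hk.
have E1 : wpow w 1 = w by rewrite /wpow /= cats0.
rewrite E1 in H0; have := act_wpow_le (blt_act vw H0) k.+1.
move: (act_H (wpow w k.+1) H_o).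
by case: (act _ o) => m x y; rewrite /ple /shift /inH; cbn [lev px py]; nia.
Qed.
End Order.

Lemma fdtc_floor w : valid_word 3 w -> fdtc_gt1 3 w ->
  exists n, Z.lt 0 n /\ ble 3 (full_twist_pow 3 n) w.
Proof.
move=> vw [t [f [Hf [cv t1]]]]; exists (f 0%N); split; last first.
  by have [H _] := Hf 0%N; move: H; rewrite /wpow /= cats0.
case: (Z.ltb_spec 0 (f 0%N)) => // f0.
have fb := floor_bound vw Hf f0.
(* Within [t - 1] of the limit the quotients exceed 1, against [floor_bound]. *)
have e0 : Rdefinitions.Rgt (Rdefinitions.Rminus t Rdefinitions.R1) Rdefinitions.R0 by lra.
have [n /(_ n (le_n n))] := cv _ e0.
rewrite /Rfunctions.Rdist => /Rbasic_fun.Rabs_def2 [_ H].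
have nn : Rdefinitions.Rlt Rdefinitions.R0 (Raxioms.INR n.+1) by apply: RIneq.lt_0_INR; apply: PeanoNat.Nat.lt_0_succ.
have := RIneq.IZR_le _ _ (fb n); rewrite -RIneq.INR_IZR_INZ => le.
have : Rdefinitions.Rle (Rdefinitions.Rdiv (Rdefinitions.IZR (f n)) (Raxioms.INR n.+1)) Rdefinitions.R1.
  apply: (RIneq.Rmult_le_reg_r _ _ _ nn); rewrite /Rdefinitions.Rdiv Raxioms.Rmult_assoc Raxioms.Rinv_l; lra.
lra.
Qed.

Lemma braid_eq_mulV u : valid_word 3 u -> braid_eq 3 (u ++ inv_word u) [::].
Proof.
elim: u => [|[i b] u IH]; first by move=> _; apply: rst_refl.
move=> /andP [vi /IH H]; rewrite /inv_word map_cons rev_cons -cats1.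
have := braid_eq_ctx [:: (i, b)] [:: inv_letter (i, b)] H.
rewrite -catA => H1; apply: rst_trans H1 _; apply: rst_step.
exact: (@bstep 3 [::] [::] _ _ (rel_cancel b vi)).
Qed.

Lemma fdtc_decomp w : valid_word 3 w -> fdtc_gt1 3 w -> exists k v,
  [/\ braid_eq 3 w (wpow (full_twist 3) k.+1 ++ v), valid_word 3 v, (1, false) \notin v
    & (1, true) \in v \/ all (fun x : letter => x.2) v].
Proof.
move=> vw /(fdtc_floor vw) [n [n0 H]].
have En : exists k, full_twist_pow 3 n = wpow (full_twist 3) k.+1.
  exists (Z.to_nat n).-1; rewrite /full_twist_pow; case: Z.leb_spec => Hn; last by lia.
  by congr wpow; lia.
have [k Ek] := En; exists k; rewrite -Ek.
case: H => [H|H]; last first.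
  (* Equality with a power of the full twist: the remaining word is empty, and counts as
     positive. *)
  by exists [::]; rewrite cats0; split=> //; [apply: rst_sym | right].
have vi : valid_word 3 (inv_word (full_twist_pow 3 n) ++ w).
  by rewrite /valid_word all_cat -!/(valid_word 3 _) valid_inv vw valid_full_twist_pow.
have [v E [vv nv Hv]] := dehornoy_posP vi H; exists v; split=> //.
have := braid_eq_ctx (full_twist_pow 3 n) [::] E; rewrite !cats0; apply: rst_trans.
have := braid_eq_ctx [::] w (braid_eq_mulV (valid_full_twist_pow n)).
by rewrite -catA /= => H1; apply: rst_sym.
Qed.
Local Open Scope ring_scope.

Local Close Scope ring_scope.
Lemma not_BoundW (R : comNzRingType) w : valid_word 3 w -> fdtc_gt1 3 w -> ~ BoundW R w.
Proof.
move=> vw /(fdtc_decomp vw) [k [v [wv vv nv Hv]]] /(BoundW_braid_eq R wv) B.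
case: Hv => Hv.
  by have [n] := BoundW_reduce vv nv Hv B; apply: not_BoundL_base.
apply: (not_BoundL_null (R := R)); apply: BoundW_positive B; rewrite all_cat Hv andbT.
by elim: k {wv} => // k IH.
Qed.

Theorem theorem1p4 (w : bword) :
  valid_word 3 w -> is_knot_closure 3 w -> fdtc_gt1 3 w ->
  [/\ psi_nonzero rat 3 w, psi_nonzero int 3 w, psi_nonzero 'F_2 3 w
    & psi'_nonzero ((ord0, ord0) : node 3 w)].
Proof.
move=> vw _ fw; split.
- exact/(psi_nonzero_Bound (R := rat) vw)/not_BoundW.
- exact/(psi_nonzero_Bound (R := int) vw)/not_BoundW.
- exact/(psi_nonzero_Bound (R := 'F_2) vw)/not_BoundW.
- exact/psi'_nonzero_Bound/not_BoundW.
Qed.
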